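(* Let $\Omega\subset\mathbb C^n$ be a bounded open set and $1<q\le\infty$. Suppose that for every $\zeta\in\partial\Omega$ there exists $f_\zeta\in\bigcap_{p<q}\mathcal{O}L^p(\Omega)$ such that $f_\zeta\notin\mathcal{O}L^q(B(\zeta,\varepsilon)\cap\Omega)$ for every $\varepsilon>0$ and $\lim_{z\to\zeta,\,z\in\Omega}f_\zeta(z)=\infty$. Then the set $$\Big\{g\in\bigcap_{p<q}\mathcal{O}L^p(\Omega): g\text{ is totally unbounded in }\Omega\text{ and } g\notin\mathcal{O}L^q(B(\zeta,\varepsilon)\cap\Omega)\ \forall\zeta\in\partial\Omega,\ \forall\varepsilon>0\Big\}$$ is dense and $G_\delta$ in $\bigcap_{p<q}\mathcal{O}L^p(\Omega)$.
   Context: For an open bounded set $D$ and $p\ge1$, $\mathcal{O}L^p(D)$ is the space of holomorphic $f$ on $D$ with $\int_D|f|^p\,dv<\infty$; $\mathcal{O}L^\infty(D)$ is the space of bounded holomorphic functions on $D$. ''$g\notin\mathcal{O}L^q(B(\zeta,\varepsilon)\cap\Omega)$'' means the restriction of $g$ to $B(\zeta,\varepsilon)\cap\Omega$ is not in that space. For $1<q\le\infty$, $\bigcap_{p<q}\mathcal{O}L^p(\Omega)$ carries the complete metric $d(f,g)=\sum_j2^{-j}\frac{\|f-g\|_{p_j}}{1+\|f-g\|_{p_j}}$ with $1<p_1<p_2<\dots$, $p_j\to q$; convergence means $\|f_k-f\|_p\to0$ for all $p<q$. A holomorphic $f$ is totally unbounded in $\Omega$ if for every $w\in\partial\Omega$,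 $\delta>0$ and every connected component $E$ of $B(w,\delta)\cap\Omega$, $\sup_E|f|=\infty$. *)

(* Defs.v *)
From HB Require Import structures.
From mathcomp Require Import all_boot all_order all_algebra.
From mathcomp Require Import all_classical all_reals all_analysis.
From mathcomp Require Import complex.
Set Implicit Arguments. Unset Strict Implicit. Unset Printing Implicit Defensive.
Import Order.TTheory GRing.Theory Num.Theory.
Import numFieldNormedType.Exports.
Local Open Scope classical_set_scope.
Local Open Scope ring_scope.

Section Defs.
Variable R : realType.
Local Notation C := R[i].

Definition cvec (n : nat) := 'I_n -> C.

Definition cmod (z : C) : R := let: Complex a b := z in Num.sqrt (a ^+ 2 + b ^+ 2).

Definition cnorm n (z : cvec n) : R := Num.sqrt (\sum_(i < n) cmod (z i) ^+ 2).

Definition cball n (z : cvec n) (r : R) : set (cvec n) :=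
  [set w | cnorm (fun i => w i - z i) < r].

Definition copen n (D : set (cvec n)) : Prop :=
  forall z, D z -> exists2 r : R, 0 < r & cball z r `<=` D.

Definition cbounded n (D : set (cvec n)) : Prop :=
  exists M : R, forall z, D z -> cnorm z <= M.

Definition cboundary n (D : set (cvec n)) : set (cvec n) :=
  [set z | forall r : R, 0 < r ->
     (cball z r `&` D) !=set0 /\ (cball z r `&` ~` D) !=set0].

Definition cconnected n (A : set (cvec n)) : Prop :=
  forall U V : set (cvec n), copen U -> copen V ->
    A `<=` U `|` V -> A `&` U `&` V = set0 ->
    A `&` U = set0 \/ A `&` V = set0.

Definition ccomponent n (A : set (cvec n)) (x : cvec n) : set (cvec n) :=
  [set y | exists K : set (cvec n), [/\ K `<=` A, cconnected K, K x & K y]].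

Definition holomorphic_on n (D : set (cvec n)) (f : cvec n -> C) : Prop :=
  forall z, D z -> exists a : cvec n, forall e : R, 0 < e ->
    exists2 d : R, 0 < d & forall h : cvec n, cnorm h < d ->
      cmod (f (fun i => z i + h i) - f z - \sum_(i < n) a i * h i)
        <= e * cnorm h.

Definition ccons n (a : C) (v : cvec n) : cvec n.+1 :=
  fun i => match unlift ord0 i with None => a | Some j => v j end.

(* volume (Lebesgue measure on C^n = R^(2n)) integral of a nonnegative
   function, computed as an iterated Lebesgue integral over the 2n real
   coordinates (Tonelli) *)
Fixpoint volint (n : nat) : (cvec n -> \bar R) -> \bar R :=
  match n as m return (cvec m -> \bar R) -> \bar R with
  | 0 => fun F => F (fun _ => 0)
  | m.+1 => fun F =>
      (\int[lebesgue_measure]_(x in setT)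
        \int[lebesgue_measure]_(y in setT)
          volint (fun v => F (ccons (Complex x y) v)))%E
  end.

Definition Lpint n (D : set (cvec n)) (p : R) (f : cvec n -> C) : \bar R :=
  volint (fun z => if `[< D z >] then ((cmod (f z)) `^ p)%:E else 0%E).

(* ||f||_{p,D} (meaningful when the integral is finite) *)
Definition Lpnorm n (D : set (cvec n)) (p : R) (f : cvec n -> C) : R :=
  (fine (Lpint D p f)) `^ p^-1.

Definition OL n (q : \bar R) (D : set (cvec n)) (f : cvec n -> C) : Prop :=
  holomorphic_on D f /\
  match q with
  | +oo%E => exists M : R, forall z, D z -> cmod (f z) <= M
  | (r%:E)%E => (Lpint D r f < +oo)%E
  | -oo%E => False
  end.

Definition OLlt n (q : \bar R) (D : set (cvec n)) (f : cvec n -> C) : Prop :=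
  forall p : R, 1 <= p -> (p%:E < q)%E -> OL p%:E D f.

(* the metric d(f,g) = sum_j 2^-j ||f-g||_{p_j}/(1+||f-g||_{p_j}), j >= 1;
   here the sequence is indexed from 0, p j playing the role of p_(j+1) *)
Definition dmetric n (D : set (cvec n)) (p : nat -> R) (f g : cvec n -> C) : R :=
  limn (fun N : nat => \sum_(j < N)
    (2%:R ^- j.+1) * (Lpnorm D (p j) (fun z => f z - g z)
       / (1 + Lpnorm D (p j) (fun z => f z - g z)))).

Definition totally_unbounded n (D : set (cvec n)) (g : cvec n -> C) : Prop :=
  forall w, cboundary D w -> forall delta : R, 0 < delta ->
    forall x, (cball w delta `&` D) x ->
      forall M : R, exists z, ccomponent (cball w delta `&` D) x z /\ M < cmod (g z).

Definition dense_in n (d : (cvec n -> C) -> (cvec n -> C) -> R)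
    (X S : set (cvec n -> C)) : Prop :=
  forall f, X f -> forall e : R, 0 < e -> exists g, S g /\ d f g < e.

Definition Gdelta_in n (d : (cvec n -> C) -> (cvec n -> C) -> R)
    (X S : set (cvec n -> C)) : Prop :=
  exists U : nat -> set (cvec n -> C),
    (forall k f, X f -> U k f -> exists2 r : R, 0 < r &
        forall g, X g -> d f g < r -> U k g) /\
    S = X `&` \bigcap_k U k.

End Defs.

(* Main.v *)
(* The set is a countable intersection of sets U_k, one for each rational ball, rational point
   and integer bound M: |g| exceeds M somewhere on a given component, or the integral of
   |g|^q over a given ball exceeds M. Each U_k is open already for the L^(p_0) distance
   (Chebyshev, resp. bounded truncations of |g|^q). For every g, either g itself or g + t f_zeta for
   every t > 0 belongs to U_k, for a suitable boundary point zeta; for components, zeta is the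
   first point outside Omega on the segment from a point of the component to a boundary point.
   Instead of completeness and Baire's theorem, one sums f + sum_k t_k F_k with t_k so small that
   the series converges locally uniformly and in every L^(p_j) and never leaves the U_k already
   reached. That the sum is holomorphic is Weierstrass' theorem, which rests on a Lipschitz estimate
   |f(z) - f(0)| <= C sup|f| |z| / s obtained from Goursat's theorem and a Cauchy formula on squares.
   Integrals over C^n are handled through Fatou's lemma for lower semicontinuous functions. *)

(* The premise of each condition (a ball about a boundary point lies in the rational ball and, for
   components, contains the rational point) does not mention g, so only the conclusion has to be
   stable and reachable. If a condition fails for g, then |g| is at most M on the component, or g
   has finite q-integral on the ball; adding any nonzero multiple of a function that blows up there,
   or is not q-integrable there, destroys this. Hence every t > 0 works, and t can be shrunk to
   serve many exponents at once. For q infinite no integral condition is imposed: unboundedness near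
   zeta follows from total unboundedness, since every ball about zeta meets Omega. The volume
   integral is iterated, so its laws need measurable partial integrals. For f continuous on an open
   set, an increasing left-continuous nonnegative function of |f|, extended by 0, is lower
   semicontinuous; this covers |f|^p, its truncations and constants. Constants are nowhere sharp:
   Weierstrass' theorem only asks for some finite Lipschitz constant. *)
Require Import Defs.
From HB Require Import structures.
From mathcomp Require Import all_boot all_order all_algebra.
From mathcomp Require Import all_classical all_reals all_analysis.
From mathcomp Require Import measurable_realfun complex.
From mathcomp Require Import ring lra.
Import Order.TTheory GRing.Theory Num.Theory.
Import numFieldNormedType.Exports.
Local Open Scope classical_set_scope.
Local Open Scope ring_scope.
Set Implicit Arguments. Unset Strict Implicit. Unset Printing Implicit Defensive.

(** * Modulus and norm *)

Section Modulus.
Variable R : realType.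
Local Notation C := R[i].
Implicit Types (z w : C) (x y : R).

Lemma cmodE z : cmod z = Normc.normc z. Proof. by case: z. Qed.

Lemma cmod_ge0 z : 0 <= cmod z.
Proof. by case: z => a b; exact: sqrtr_ge0. Qed.

Lemma cmodM z w : cmod (z * w) = cmod z * cmod w.
Proof. by rewrite !cmodE Normc.normcM. Qed.

Lemma cmodN z : cmod (- z) = cmod z.
Proof. by rewrite !cmodE normcN. Qed.

Lemma cmodV z : cmod z^-1 = (cmod z)^-1.
Proof. by rewrite !cmodE Normc.normcV. Qed.

Lemma cmodD z w : cmod (z + w) <= cmod z + cmod w.
Proof. by rewrite !cmodE; exact: le_normcD. Qed.

Lemma cmodB z w : cmod (z - w) <= cmod z + cmod w.
Proof. by rewrite (le_trans (cmodD _ _))// cmodN. Qed.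

Lemma cmodBC z w : cmod (z - w) = cmod (w - z).
Proof. by rewrite -cmodN opprB. Qed.

Lemma cmod0 : cmod (0 : C) = 0.
Proof. by rewrite cmodE Normc.normc0. Qed.

Lemma cmod1 : cmod (1 : C) = 1.
Proof. by rewrite cmodE Normc.normc1. Qed.

Lemma cmod0_eq0 z : cmod z = 0 -> z = 0.
Proof. by rewrite cmodE; exact: Normc.eq0_normc. Qed.

Lemma cmod_gt0 z : (0 < cmod z) = (z != 0).
Proof.
rewrite lt_def cmod_ge0 andbT; congr (~~ _); apply/eqP/eqP => [/cmod0_eq0//|->].
exact: cmod0.
Qed.

Lemma cmod_triang z w t : cmod (z - w) <= cmod (z - t) + cmod (t - w).
Proof. by rewrite -[z - w](subrKA t) cmodD. Qed.

Lemma cmod_lb z w : cmod z - cmod w <= cmod (z + w).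
Proof.
rewrite lerBlDr -[X in cmod X <= _](addrK w); exact: cmodB.
Qed.

Lemma cmod_real x : cmod (Complex x 0) = `|x|.
Proof. by rewrite /cmod expr0n addr0 sqrtr_sqr. Qed.

Lemma cmod_imag x : cmod (Complex 0 x) = `|x|.
Proof. by rewrite /cmod expr0n add0r sqrtr_sqr. Qed.

Lemma normr_Re_le z : `|complex.Re z| <= cmod z.
Proof.
case: z => a b /=; rewrite -sqrtr_sqr ler_sqrt ?addr_ge0 ?sqr_ge0//.
by rewrite lerDl sqr_ge0.
Qed.

Lemma normr_Im_le z : `|complex.Im z| <= cmod z.
Proof.
case: z => a b /=; rewrite -sqrtr_sqr ler_sqrt ?addr_ge0 ?sqr_ge0//.
by rewrite lerDr sqr_ge0.
Qed.

Lemma cmod_le_ReIm z : cmod z <= `|complex.Re z| + `|complex.Im z|.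
Proof.
case: z => a b.
have e : Complex a b = Complex a 0 + Complex 0 b by apply/eqP; rewrite eq_complex /= addr0 add0r !eqxx.
by rewrite {1}e (le_trans (cmodD _ _))// cmod_real cmod_imag.
Qed.

Lemma cmod_sum (I : Type) (r : seq I) (P : pred I) (F : I -> C) :
  cmod (\sum_(i <- r | P i) F i) <= \sum_(i <- r | P i) cmod (F i).
Proof.
elim/big_rec2: _ => [|i y z _ h]; first by rewrite cmod0.
by rewrite (le_trans (cmodD _ _))// lerD2l.
Qed.

End Modulus.

Section CauchySchwarz.
Variable R : realType.

Lemma sum_CauchySchwarz n (x y : 'I_n -> R) :
  (\sum_i x i * y i) ^+ 2 <= (\sum_i x i ^+ 2) * (\sum_i y i ^+ 2).
Proof.
set A := \sum_i x i ^+ 2; set B := \sum_i y i ^+ 2; set S := \sum_i _.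
have A0 : 0 <= A by apply: sumr_ge0 => i _; exact: sqr_ge0.
have B0 : 0 <= B by apply: sumr_ge0 => i _; exact: sqr_ge0.
have H (s t : R) : 0 <= s ^+ 2 * A + 2 * (s * t) * S + t ^+ 2 * B.
  rewrite !mulr_sumr -!big_split /=; apply: sumr_ge0 => i _.
  have -> : s ^+ 2 * x i ^+ 2 + 2 * (s * t) * (x i * y i) + t ^+ 2 * y i ^+ 2
     = (s * x i + t * y i) ^+ 2 by ring.
  exact: sqr_ge0.
have [A00|An0] := eqVneq A 0.
  have x0 i : x i = 0.
    apply/eqP; rewrite -sqrf_eq0; apply/eqP.
    have := A00; rewrite /A => /eqP; rewrite psumr_eq0; last by move=> j _; exact: sqr_ge0.
    by move=> /allP/(_ i); rewrite mem_index_enum => /(_ isT)/eqP.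
  by rewrite A00 mul0r /S big1 ?expr0n// => i _; rewrite x0 mul0r.
have Ap : 0 < A by rewrite lt_def An0.
(* For [t = - A] the quadratic form is minimal at [s = S]; its value there is [A] times the wanted
   difference. *)
have := H S (- A).
have -> : S ^+ 2 * A + 2 * (S * - A) * S + (- A) ^+ 2 * B = A * (A * B - S ^+ 2) by ring.
by rewrite pmulr_rge0// subr_ge0.
Qed.

Lemma sqrt_sum_sqrD n (x y : 'I_n -> R) :
  Num.sqrt (\sum_i (x i + y i) ^+ 2)
    <= Num.sqrt (\sum_i x i ^+ 2) + Num.sqrt (\sum_i y i ^+ 2).
Proof.
have A0 : 0 <= \sum_i x i ^+ 2 by apply: sumr_ge0 => i _; exact: sqr_ge0.
have B0 : 0 <= \sum_i y i ^+ 2 by apply: sumr_ge0 => i _; exact: sqr_ge0.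
rewrite -(ler_pXn2r (n:=2))// ?nnegrE ?addr_ge0 ?sqrtr_ge0//.
rewrite sqrrD !sqr_sqrtr//; last by apply: sumr_ge0 => i _; exact: sqr_ge0.
under eq_bigr do rewrite sqrrD.
rewrite !big_split /= lerD2r lerD2l. rewrite -mulr2n lerMn2r/=.
apply: le_trans (ler_norm _) _.
rewrite -sqrtrM// -sqrtr_sqr ler_sqrt ?mulr_ge0//.
exact: sum_CauchySchwarz.
Qed.

End CauchySchwarz.

Section VectorNorm.
Variables (R : realType) (n : nat).
Local Notation C := R[i].
Implicit Types (z w h : cvec R n).

Lemma cnorm_ge0 z : 0 <= cnorm z. Proof. exact: sqrtr_ge0. Qed.

Lemma cnormD z w : cnorm (fun i => z i + w i) <= cnorm z + cnorm w.
Proof.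
apply: le_trans (sqrt_sum_sqrD (fun i => cmod (z i)) (fun i => cmod (w i))).
rewrite ler_sqrt; last by apply: sumr_ge0 => i _; exact: sqr_ge0.
apply: ler_sum => i _; rewrite ler_pXn2r ?nnegrE ?addr_ge0 ?cmod_ge0//.
exact: cmodD.
Qed.

Lemma cnormZ (a : C) z : cnorm (fun i => a * z i) = cmod a * cnorm z.
Proof.
rewrite /cnorm -[cmod a]ger0_norm ?cmod_ge0// -sqrtr_sqr -sqrtrM ?sqr_ge0//.
congr Num.sqrt; rewrite mulr_sumr; apply: eq_bigr => i _.
by rewrite cmodM exprMn.
Qed.

Lemma cnormBC z w : cnorm (fun i => z i - w i) = cnorm (fun i => w i - z i).
Proof. by rewrite /cnorm; under eq_bigr do rewrite cmodBC. Qed.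

Lemma cnorm0 : cnorm (fun i : 'I_n => 0 : C) = 0.
Proof.
by rewrite /cnorm big1 ?sqrtr0// => i _; rewrite cmod0 expr0n.
Qed.

Lemma cnorm_triang z w t :
  cnorm (fun i => z i - w i)
    <= cnorm (fun i => z i - t i) + cnorm (fun i => t i - w i).
Proof.
apply: le_trans (cnormD _ _).
by under [X in _ <= cnorm X]eq_fun do rewrite subrKA.
Qed.

Lemma cmod_le_cnorm z i : cmod (z i) <= cnorm z.
Proof.
rewrite -[cmod _]ger0_norm ?cmod_ge0// -sqrtr_sqr ler_sqrt; last first.
  by apply: sumr_ge0 => j _; exact: sqr_ge0.
rewrite (bigD1 i)//= lerDl; apply: sumr_ge0 => j _; exact: sqr_ge0.
Qed.

Lemma cnorm_le_sum z : cnorm z <= \sum_i cmod (z i).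
Proof.
have S0 : 0 <= \sum_i cmod (z i) by apply: sumr_ge0 => i _; exact: cmod_ge0.
rewrite -[X in _ <= X]ger0_norm// -sqrtr_sqr ler_sqrt ?sqr_ge0//.
rewrite expr2 mulr_suml; apply: ler_sum => i _.
rewrite expr2 ler_wpM2l ?cmod_ge0// (bigD1 i)//= lerDl.
by apply: sumr_ge0 => j _; exact: cmod_ge0.
Qed.

Lemma cball_center z (r : R) : 0 < r -> cball z r z.
Proof. by rewrite /cball/= => r0; under eq_fun do rewrite subrr; rewrite cnorm0. Qed.

Lemma cball_sub z w (r s : R) :
  cnorm (fun i => w i - z i) + s <= r -> cball w s `<=` cball z r.
Proof.
move=> h t ts; rewrite /cball/= (le_lt_trans (cnorm_triang _ _ w))//.
by rewrite (lt_le_trans _ h)// addrC ltrD2l.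
Qed.

Lemma copen_cball z (r : R) : copen (cball z r).
Proof.
move=> w wz; exists (r - cnorm (fun i => w i - z i)); first by rewrite subr_gt0; exact: wz.
by apply: cball_sub; rewrite addrC subrK.
Qed.

Lemma copenI (A B : set (cvec R n)) : copen A -> copen B -> copen (A `&` B).
Proof.
move=> oA oB z [/oA[r r0 rA] /oB[s s0 sB]].
exists (Num.min r s); first by rewrite lt_min r0.
by move=> w /=; rewrite /cball/= lt_min => /andP[wr ws]; split; [exact: rA|exact: sB].
Qed.

End VectorNorm.

(** * Lower semicontinuity and the volume integral *)

Section LowerLimits.
Variable R : realType.
Implicit Types (u v : (\bar R)^nat) (c d : \bar R).
Local Open Scope ereal_scope.

(** Real test values reduce estimates of lower limits to eventual inequalities, infinite values
    included. *)
Lemma lee_real_approx c d :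
  (forall a : R, a%:E < c -> a%:E <= d) -> c <= d.
Proof.
move=> h; rewrite leNgt; apply/negP => dc.
have [a /andP[ac da]] : exists a : R, (a%:E < c) && (d < a%:E).
  case: c d dc {h} => [r| |] [s| |] //=.
  - by rewrite lte_fin => sr; exists ((r + s) / 2)%R; rewrite !lte_fin; lra.
  - by move=> _; exists (r - 1)%R; rewrite ltNyr lte_fin; lra.
  - by move=> _; exists (s + 1)%R; rewrite ltry lte_fin; lra.
  - by move=> _; exists 0%R; rewrite ltNyr ltry.
by have := h a ac; rewrite leNgt da.
Qed.

Lemma limn_einf_sup_einfs u : limn_einf u = ereal_sup (range (einfs u)).
Proof. by rewrite limn_einf_lim; apply/cvg_lim => //; exact: cvg_einfs_sup. Qed.

Lemma le_limn_einf u c :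
  (forall a : R, a%:E < c -> exists N, forall k, (N <= k)%N -> a%:E <= u k) ->
  c <= limn_einf u.
Proof.
move=> h; apply: lee_real_approx => a /h[N hN].
rewrite limn_einf_sup_einfs; apply: le_trans (ereal_sup_ubound _); last by exists N.
by apply: le_ereal_inf_tmp => _ [k /= Nk <-]; exact: hN.
Qed.

Lemma lt_limn_einf u c : c < limn_einf u ->
  exists N, forall k, (N <= k)%N -> c < u k.
Proof.
rewrite limn_einf_sup_einfs => /ereal_sup_gt[_ [N _ <-] cN]; exists N => k Nk.
by rewrite (lt_le_trans cN)//; apply: ereal_inf_lbound; exists k.
Qed.

Lemma limn_einf_le u c : (forall N, exists2 k, (N <= k)%N & u k <= c) ->
  limn_einf u <= c.
Proof.
move=> h; rewrite leNgt; apply/negP => /lt_limn_einf[N hN].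
by have [k /hN] := h N; rewrite ltNge => /negP.
Qed.

Lemma limn_einf_cst c : limn_einf (fun=> c) = c.
Proof.
apply/eqP; rewrite eq_le; apply/andP; split.
  by apply: limn_einf_le => N; exists N.
by apply: le_limn_einf => a /ltW ac; exists 0%N.
Qed.

(** A real below c + d is at most a sum s + t of reals with s < c and t < d, also when c or d is
    +oo; nonnegativity excludes -oo. *)
Lemma le_limn_einfD u v c d : 0 <= c -> 0 <= d ->
  (forall k, 0 <= u k) -> (forall k, 0 <= v k) ->
  c <= limn_einf u -> d <= limn_einf v -> c + d <= limn_einf (fun k => u k + v k).
Proof.
move=> c0 d0 u0 v0 cu dv.
have H w e : 0 <= e -> (forall k, 0 <= w k) -> e <= limn_einf w ->
    forall a : R, a%:E < e -> exists N, forall k, (N <= k)%N -> a%:E <= w k.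
  move=> e0 w0 ew a ae; have [N hN] := lt_limn_einf (lt_le_trans ae ew).
  by exists N => k /hN /ltW.
apply: le_limn_einf => a acd.
have [s [t [sc td ast]]] : exists s t : R, [/\ s%:E < c, t%:E < d & (a <= s + t)%R].
  case: c d c0 d0 acd {cu dv} => [x| |] [y| |] //= x0 y0.
  - rewrite lte_fin => axy; exists (x - (x + y - a) / 2)%R, (y - (x + y - a) / 2)%R.
    by rewrite !lte_fin; split; lra.
  - by move=> _; exists (x - 1)%R, (a - x + 1)%R; rewrite ltry lte_fin; split => //; lra.
  - by move=> _; exists (a - y + 1)%R, (y - 1)%R; rewrite ltry lte_fin; split => //; lra.
  - by move=> _; exists a, 0%R; rewrite !ltry; split => //; lra.
have [N hN] := H _ _ c0 u0 cu _ sc; have [M hM] := H _ _ d0 v0 dv _ td.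
exists (maxn N M) => k; rewrite geq_max => /andP[/hN us /hM vt].
by rewrite (@le_trans _ _ (s%:E + t%:E))// ?leeD// -EFinD lee_fin.
Qed.

Lemma le_limn_einfZ u (a : R) c : (0 <= a)%R -> 0 <= c ->
  c <= limn_einf u -> a%:E * c <= limn_einf (fun k => a%:E * u k).
Proof.
rewrite le_eqVlt => /orP[/eqP <-|a0] c0 cu.
  by rewrite mul0e; under [X in _ <= limn_einf X]eq_fun do rewrite mul0e;
    rewrite limn_einf_cst.
apply: le_limn_einf => b bac.
have /lt_le_trans/(_ cu)/lt_limn_einf[N hN] : (a^-1 * b)%:E < c.
  by rewrite -(@lte_pmul2l _ a%:E)// -EFinM mulrA divff ?gt_eqF// mul1r.
exists N => k /hN /ltW h.
have -> : b%:E = a%:E * (a^-1 * b)%:E.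
  by rewrite -EFinM mulrA divff ?gt_eqF// mul1r.
by rewrite lee_pmul2l.
Qed.

End LowerLimits.

Section RealLsc.
Variable R : realType.
Local Open Scope ereal_scope.
Local Notation mu := (@lebesgue_measure R).

Definition rlsc (H : R -> \bar R) :=
  forall (x : nat -> R) l, x @ \oo --> l -> H l <= limn_einf (fun k => H (x k)).

Lemma rlsc_measurable H : rlsc H -> measurable_fun setT H.
Proof.
move=> Hl; apply: lower_semicontinuous_measurable => x a aHx.
apply: contrapT => hV.
have hk (k : nat) : exists y : R, (`|y - x| < k.+1%:R^-1)%R /\ H y <= a%:E.
  apply: contrapT => hy; apply: hV.
  exists (ball x k.+1%:R^-1)%R; first by apply: nbhsx_ballx; rewrite invr_gt0.
  move=> y; rewrite /ball/= distrC => yx; rewrite ltNge; apply/negP => Hy.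
  by apply: hy; exists y.
have [y hy] := choice hk.
have : y @ \oo --> x.
  apply/cvgrPdist_lt => e e0.
  have [N _ hN] := near_infty_natSinv_lt (PosNum e0).
  exists N => // k /hN /= ke; rewrite distrC; apply: lt_trans ke.
  by case: (hy k).
move=> /Hl; rewrite leNgt => /negP; apply; apply: le_lt_trans aHx.
by apply: limn_einf_le => N; exists N => //; case: (hy N).
Qed.

Lemma measurable_limn_einf (f : nat -> R -> \bar R) :
  (forall k, measurable_fun setT (f k)) ->
  measurable_fun setT (fun x => limn_einf (f^~ x)).
Proof.
move=> mf; apply: measurableT_comp => //.
by apply: measurable_fun_limn_esup => k; exact: measurableT_comp.
Qed.

Lemma integral_fatou_le (H : R -> \bar R) (Hk : nat -> R -> \bar R) :
  (forall x, 0 <= H x) -> measurable_fun setT H ->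
  (forall k x, 0 <= Hk k x) -> (forall k, measurable_fun setT (Hk k)) ->
  (forall x, H x <= limn_einf (Hk^~ x)) ->
  \int[mu]_x H x <= limn_einf (fun k => \int[mu]_x Hk k x).
Proof.
move=> H0 mH Hk0 mHk h; apply: le_trans (fatou _ _ _ _) => //.
by apply: ge0_le_integral => //; exact: measurable_limn_einf.
Qed.

Lemma integral_itv_lb (H : R -> \bar R) (K a b : R) :
  (a < b)%R -> (forall x, 0 <= H x) -> measurable_fun setT H -> (0 <= K)%R ->
  (forall x, (a < x < b)%R -> K%:E <= H x) ->
  (K * (b - a))%:E <= \int[mu]_x H x.
Proof.
move=> ab H0 mH K0 KH.
apply: le_trans (ge0_subset_integral mu (measurable_itv `]a, b[) measurableT mH _ _) => //.
have -> : (K * (b - a))%:E = \int[mu]_(x in `]a, b[) cst K%:E x.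
  by rewrite integral_cst//= lebesgue_measure_itv/= lte_fin ab EFinM.
apply: ge0_le_integral => //.
exact: measurable_funTS.
Qed.

Lemma integral_itv_ub (H : R -> \bar R) (K a b : R) :
  (a < b)%R -> (forall x, 0 <= H x) -> measurable_fun setT H -> (0 <= K)%R ->
  (forall x, (a < x < b)%R -> H x <= K%:E) ->
  (forall x, ~~ (a < x < b)%R -> H x = 0) ->
  \int[mu]_x H x <= (K * (b - a))%:E.
Proof.
move=> ab H0 mH K0 HK H00.
have -> : \int[mu]_x H x = \int[mu]_(x in `]a, b[) H x.
  rewrite [RHS]integral_mkcond; congr (integral _ _ _); apply/funext => x.
  rewrite patchE; case: ifPn => // /negP; rewrite inE /= in_itv /= => /negP.
  exact: H00.
have -> : (K * (b - a))%:E = \int[mu]_(x in `]a, b[) cst K%:E x.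
  by rewrite integral_cst//= lebesgue_measure_itv/= lte_fin ab EFinM.
apply: ge0_le_integral => //.
exact: measurable_funTS.
Qed.

End RealLsc.

(** * The iterated volume integral: Fatou's lemma, additivity, cubes *)

Section VolumeIntegral.
Variable R : realType.
Local Notation C := R[i].
Local Notation mu := (@lebesgue_measure R).
Local Open Scope ereal_scope.

Definition vcvg n (u : nat -> cvec R n) (z : cvec R n) : Prop :=
  forall e : R, (0 < e)%R ->
    exists N, forall k, (N <= k)%N -> cball z e (u k).

(* By Fatou, this class is stable under partial integration: [volint], an iterated integral, can
   be handled on it without product measures or Fubini. *)
Definition vlsc n (F : cvec R n -> \bar R) : Prop :=
  forall u z, vcvg u z -> F z <= limn_einf (fun k => F (u k)).

Lemma vcvg_cst n (z : cvec R n) : vcvg (fun=> z) z.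
Proof. by move=> e e0; exists 0%N => k _; exact: cball_center. Qed.

Lemma cnorm_ccons n (a b : C) (v w : cvec R n) :
  (cnorm (fun i => ccons a v i - ccons b w i)
     <= cmod (a - b) + cnorm (fun i => v i - w i))%R.
Proof.
rewrite -[X in (_ <= X)%R]ger0_norm ?addr_ge0 ?cmod_ge0 ?cnorm_ge0//.
rewrite -sqrtr_sqr ler_sqrt ?sqr_ge0// big_ord_recl /= /ccons unlift_none.
under eq_bigr do rewrite liftK.
rewrite sqrrD sqr_sqrtr; last by apply: sumr_ge0 => i _; exact: sqr_ge0.
by rewrite lerD2r lerDl mulrn_wge0// mulr_ge0 ?cmod_ge0 ?cnorm_ge0.
Qed.

Lemma vcvg_ccons n (x y : nat -> R) (a b : R) (u : nat -> cvec R n) v :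
  x @ \oo --> a -> y @ \oo --> b -> vcvg u v ->
  vcvg (fun k => ccons (Complex (x k) (y k)) (u k)) (ccons (Complex a b) v).
Proof.
move=> xa yb uv e e0; have e3 : (0 < e / 3)%R by rewrite divr_gt0.
have [N hN] := uv _ e3.
move/cvgrPdist_lt : xa => /(_ _ e3)[Nx _ hx].
move/cvgrPdist_lt : yb => /(_ _ e3)[Ny _ hy].
exists (maxn N (maxn Nx Ny)) => k; rewrite !geq_max => /and3P[/hN uk /hx xk /hy yk].
apply: le_lt_trans (cnorm_ccons _ _ _ _) _.
have : (cmod (Complex (x k) (y k) - Complex a b) <= `|a - x k| + `|b - y k|)%R.
  by apply: le_trans (cmod_le_ReIm _) _; rewrite /= (distrC a) (distrC b).
by move: uk xk yk; rewrite /cball/=; lra.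
Qed.

Lemma vlsc_ccons n (F : cvec R n.+1 -> \bar R) (a : C) :
  vlsc F -> vlsc (fun v => F (ccons a v)).
Proof.
case: a => x y hF u z uz.
by apply: hF; apply: vcvg_ccons => //; exact: cvg_cst.
Qed.

Lemma volint_ge0 n (F : cvec R n -> \bar R) :
  (forall z, 0 <= F z) -> 0 <= volint F.
Proof.
elim: n F => [|n IH] F F0 /=; first exact: F0.
by apply: integral_ge0 => x _; apply: integral_ge0 => y _; exact: IH.
Qed.

(** Named so that it can serve as induction hypothesis: measurability of the partial integrals in
    dimension n + 1 rests on Fatou's lemma in dimension n. *)
Definition vfatou n : Prop :=
  forall (F : cvec R n -> \bar R) (Fk : nat -> cvec R n -> \bar R),
  (forall z, 0 <= F z) -> vlsc F ->
  (forall k z, 0 <= Fk k z) -> (forall k, vlsc (Fk k)) ->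
  (forall z, F z <= limn_einf (Fk^~ z)) ->
  volint F <= limn_einf (fun k => volint (Fk k)).

Definition slice n (F : cvec R n.+1 -> \bar R) (x y : R) : \bar R :=
  volint (fun v => F (ccons (Complex x y) v)).

Section Slices.
Variable n : nat.
Hypothesis IH : vfatou n.
Variable F : cvec R n.+1 -> \bar R.
Hypotheses (F0 : forall z, 0 <= F z) (Fl : vlsc F).

(** Fatou in the remaining variables, applied to the slices along a convergent sequence, passes
    lower semicontinuity from [F] to its partial integral. *)
Lemma slice_lsc_of (x y : nat -> R) (a b : R) :
  x @ \oo --> a -> y @ \oo --> b ->
  slice F a b <= limn_einf (fun k => slice F (x k) (y k)).
Proof.
move=> xa yb; apply: IH => //; first exact: vlsc_ccons.
  by move=> k; exact: vlsc_ccons.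
by move=> v; apply: Fl; apply: vcvg_ccons => //; exact: vcvg_cst.
Qed.

Lemma slice_measurable_of x : measurable_fun setT (slice F x).
Proof.
apply: rlsc_measurable => y l yl; apply: slice_lsc_of => //; exact: cvg_cst.
Qed.

Lemma int_slice_measurable_of :
  measurable_fun setT (fun x => \int[mu]_y slice F x y).
Proof.
apply: rlsc_measurable => x l xl; apply: integral_fatou_le => //.
- by move=> y; exact: volint_ge0.
- exact: slice_measurable_of.
- by move=> k y; exact: volint_ge0.
- by move=> k; exact: slice_measurable_of.
- by move=> y; apply: slice_lsc_of => //; exact: cvg_cst.
Qed.

End Slices.

Lemma volint_fatou n : vfatou n.
Proof.
elim: n => [|n IH] F Fk F0 Fl Fk0 Fkl h; first exact: h.
apply: integral_fatou_le.
- by move=> x; apply: integral_ge0 => y _; exact: volint_ge0.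
- exact: int_slice_measurable_of.
- by move=> k x; apply: integral_ge0 => y _; exact: volint_ge0.
- by move=> k; exact: int_slice_measurable_of.
move=> x; apply: integral_fatou_le.
- by move=> y; exact: volint_ge0.
- exact: slice_measurable_of.
- by move=> k y; exact: volint_ge0.
- by move=> k; exact: slice_measurable_of.
move=> y; apply: IH => //; first exact: vlsc_ccons.
by move=> k; exact: vlsc_ccons.
Qed.

Definition slice_measurable n := @slice_measurable_of n (@volint_fatou n).
Definition int_slice_measurable n := @int_slice_measurable_of n (@volint_fatou n).

(** Monotonicity is Fatou's lemma for a constant sequence. *)
Lemma le_volint n (F G : cvec R n -> \bar R) :
  (forall z, 0 <= F z) -> vlsc F -> vlsc G ->
  (forall z, F z <= G z) -> volint F <= volint G.
Proof.
move=> F0 Fl Gl FG; rewrite -[leRHS]limn_einf_cst.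
apply: (@volint_fatou _ F (fun=> G)) => //.
- by move=> _ z; exact: le_trans (F0 z) (FG z).
- by move=> z; rewrite limn_einf_cst.
Qed.

Lemma volintD n (F G : cvec R n -> \bar R) :
  (forall z, 0 <= F z) -> (forall z, 0 <= G z) -> vlsc F -> vlsc G ->
  volint (fun z => F z + G z) = volint F + volint G.
Proof.
elim: n F G => [//|n IH] F G F0 G0 Fl Gl /=.
rewrite -ge0_integralD//; first last.
- exact: int_slice_measurable.
- by move=> x _; apply: integral_ge0 => y _; exact: volint_ge0.
- exact: int_slice_measurable.
- by move=> x _; apply: integral_ge0 => y _; exact: volint_ge0.
apply: eq_integral => x _; rewrite -ge0_integralD//; first last.
- exact: slice_measurable.
- by move=> y _; exact: volint_ge0.
- exact: slice_measurable.
- by move=> y _; exact: volint_ge0.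
by apply: eq_integral => y _; rewrite IH//; exact: vlsc_ccons.
Qed.

Lemma volintZ n (F : cvec R n -> \bar R) (a : R) :
  (0 <= a)%R -> (forall z, 0 <= F z) -> vlsc F ->
  volint (fun z => a%:E * F z) = a%:E * volint F.
Proof.
move=> a0; elim: n F => [//|n IH] F F0 Fl /=.
rewrite -ge0_integralZl_EFin//; first last.
- exact: int_slice_measurable.
- by move=> x _; apply: integral_ge0 => y _; exact: volint_ge0.
apply: eq_integral => x _; rewrite -ge0_integralZl_EFin//; first last.
- exact: slice_measurable.
- by move=> y _; exact: volint_ge0.
by apply: eq_integral => y _; rewrite IH//; exact: vlsc_ccons.
Qed.

Lemma vlscD n (F G : cvec R n -> \bar R) :
  (forall z, 0 <= F z) -> (forall z, 0 <= G z) -> vlsc F -> vlsc G ->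
  vlsc (fun z => F z + G z).
Proof.
move=> F0 G0 Fl Gl u z uz.
by apply: le_limn_einfD => //; [exact: Fl|exact: Gl].
Qed.

Lemma vlscZ n (F : cvec R n -> \bar R) (a : R) :
  (0 <= a)%R -> (forall z, 0 <= F z) -> vlsc F -> vlsc (fun z => a%:E * F z).
Proof. by move=> a0 F0 Fl u z uz; apply: le_limn_einfZ => //; exact: Fl. Qed.

Lemma vlsc0 n : vlsc (fun _ : cvec R n => 0).
Proof. by move=> u z _; rewrite limn_einf_cst. Qed.

Lemma volint0 n : volint (fun _ : cvec R n => 0) = 0 :> \bar R.
Proof.
elim: n => [//|n IH] /=.
by under eq_integral => x _ do (under eq_integral => y _ do rewrite IH);
  rewrite integral0_eq// => x _; rewrite integral0_eq.
Qed.

Lemma volint_sum n (F : nat -> cvec R n -> \bar R) N :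
  (forall k z, 0 <= F k z) -> (forall k, vlsc (F k)) ->
  vlsc (fun z => \sum_(k < N) F k z) /\
  volint (fun z => \sum_(k < N) F k z) = \sum_(k < N) volint (F k).
Proof.
move=> F0 Fl; elim: N => [|N [IHl IH]].
  have -> : (fun z => \sum_(k < 0) F k z) = (fun=> 0).
    by apply/funext => z; rewrite big_ord0.
  by rewrite big_ord0 volint0; split => //; exact: vlsc0.
have e : (fun z => \sum_(k < N.+1) F k z) = (fun z => \sum_(k < N) F k z + F N z).
  by apply/funext => z; rewrite big_ord_recr.
have S0 z : 0 <= \sum_(k < N) F k z by exact: sume_ge0.
by rewrite e volintD// IH big_ord_recr; split => //; exact: vlscD.
Qed.

(** Fatou for partial sums; the lower limit stands in for a pointwise infinite sum. *)
Lemma volint_sum_le n (F : nat -> cvec R n -> \bar R) (G : cvec R n -> \bar R) B :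
  (forall k z, 0 <= F k z) -> (forall k, vlsc (F k)) ->
  (forall z, 0 <= G z) -> vlsc G ->
  (forall z, G z <= limn_einf (fun N => \sum_(k < N) F k z)) ->
  (forall N, \sum_(k < N) volint (F k) <= B) -> volint G <= B.
Proof.
move=> F0 Fl G0 Gl h hB.
apply: le_trans (volint_fatou (Fk := fun N z => \sum_(k < N) F k z) _ _ _ _ _) _ => //.
- by move=> N z; exact: sume_ge0.
- by move=> N; case: (volint_sum N F0 Fl).
apply: limn_einf_le => N; exists N => //.
by case: (volint_sum N F0 Fl) => _ ->.
Qed.

(** A cube in the 2n real coordinates: being a product, unlike a ball, it is integrated one
    coordinate at a time. *)
Definition cbox n (w : cvec R n) (s : R) : set (cvec R n) :=
  [set z | forall i, (`|complex.Re (z i - w i)| < s)%R /\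
                     (`|complex.Im (z i - w i)| < s)%R].

Lemma cbox_ccons n (w : cvec R n.+1) (s x y : R) (v : cvec R n) :
  cbox w s (ccons (Complex x y) v) <->
  [/\ (`|x - complex.Re (w ord0)| < s)%R, (`|y - complex.Im (w ord0)| < s)%R
    & cbox (fun i => w (lift ord0 i)) s v].
Proof.
split=> [h|[hx hy h] i].
  split.
  - by have [] := h ord0; rewrite /ccons unlift_none; case: (w ord0) => ? ?.
  - by have [] := h ord0; rewrite /ccons unlift_none; case: (w ord0) => ? ?.
  - by move=> i; have := h (lift ord0 i); rewrite /ccons liftK.
rewrite /ccons; case: unliftP => [j ->|->]; first exact: h.
by move: hx hy; case: (w ord0).
Qed.

Lemma volint_box_lb n (F : cvec R n -> \bar R) w (s c : R) :
  (0 < s)%R -> (0 <= c)%R -> (forall z, 0 <= F z) -> vlsc F ->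
  (forall z, cbox w s z -> c%:E <= F z) ->
  (c * ((2 * s) ^+ 2) ^+ n)%:E <= volint F.
Proof.
move=> s0 c0; elim: n F w => [|n IH] F w F0 Fl h.
  by rewrite expr0 mulr1; apply: h => -[].
have P0 : (0 <= c * ((2 * s) ^+ 2) ^+ n)%R.
  by rewrite mulr_ge0// exprn_ge0// exprn_ge0// mulr_ge0// ltW.
have -> : (c * ((2 * s) ^+ 2) ^+ n.+1 =
  (c * ((2 * s) ^+ 2) ^+ n * ((complex.Im (w ord0) + s) - (complex.Im (w ord0) - s)))
     * ((complex.Re (w ord0) + s) - (complex.Re (w ord0) - s)))%R.
  by rewrite exprS; ring.
apply: integral_itv_lb.
- lra.
- by move=> x; apply: integral_ge0 => y _; exact: volint_ge0.
- exact: int_slice_measurable.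
- rewrite mulr_ge0//; lra.
move=> x hx; apply: integral_itv_lb => //.
- lra.
- by move=> y; exact: volint_ge0.
- exact: slice_measurable.
move=> y hy; apply: (IH _ (fun i => w (lift ord0 i))) => //; first exact: vlsc_ccons.
move=> z hz; apply: h; apply/cbox_ccons; split=> //.
- by rewrite ltr_norml; lra.
- by rewrite ltr_norml; lra.
Qed.

Lemma volint_box_ub n (F : cvec R n -> \bar R) w (s c : R) :
  (0 < s)%R -> (0 <= c)%R -> (forall z, 0 <= F z) -> vlsc F ->
  (forall z, cbox w s z -> F z <= c%:E) ->
  (forall z, ~ cbox w s z -> F z = 0) ->
  volint F <= (c * ((2 * s) ^+ 2) ^+ n)%:E.
Proof.
move=> s0 c0; elim: n F w => [|n IH] F w F0 Fl h h0.
  by rewrite expr0 mulr1; apply: h => -[].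
have P0 : (0 <= c * ((2 * s) ^+ 2) ^+ n)%R.
  by rewrite mulr_ge0// exprn_ge0// exprn_ge0// mulr_ge0// ltW.
have -> : (c * ((2 * s) ^+ 2) ^+ n.+1 =
  (c * ((2 * s) ^+ 2) ^+ n * ((complex.Im (w ord0) + s) - (complex.Im (w ord0) - s)))
     * ((complex.Re (w ord0) + s) - (complex.Re (w ord0) - s)))%R.
  by rewrite exprS; ring.
have out x y v : ~ ((`|x - complex.Re (w ord0)| < s)%R /\
    (`|y - complex.Im (w ord0)| < s)%R) -> F (ccons (Complex x y) v) = 0.
  by move=> xy; apply: h0 => /cbox_ccons[hx hy _]; exact: xy.
have out0 x y : ~ ((`|x - complex.Re (w ord0)| < s)%R /\
    (`|y - complex.Im (w ord0)| < s)%R) -> slice F x y = 0.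
  move=> xy; rewrite /slice -[RHS](volint0 n); congr volint.
  by apply/funext => v; exact: out.
apply: integral_itv_ub.
- lra.
- by move=> x; apply: integral_ge0 => y _; exact: volint_ge0.
- exact: int_slice_measurable.
- rewrite mulr_ge0//; lra.
- move=> x hx; apply: integral_itv_ub => //.
  + lra.
  + by move=> y; exact: volint_ge0.
  + exact: slice_measurable.
  + move=> y hy; apply: (IH _ (fun i => w (lift ord0 i))) => //.
    * exact: vlsc_ccons.
    * move=> z hz; apply: h; apply/cbox_ccons; split=> //.
      - by rewrite ltr_norml; lra.
      - by rewrite ltr_norml; lra.
    * by move=> z hz; apply: h0 => /cbox_ccons[].
  + move=> y hy; apply: out0 => -[_]; rewrite ltr_norml => hy'; move/negP: hy; apply; lra.
- move=> x hx; apply: integral0_eq => y _; apply: out0 => -[+ _].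
  by rewrite ltr_norml => hx'; move/negP: hx; apply; lra.
Qed.

End VolumeIntegral.

(** * Goursat and Cauchy on rectangles *)

Section ComplexIntegral.
Variable R : realType.
Local Notation C := R[i].
Local Notation mu := (@lebesgue_measure R).
Implicit Types (phi psi : R -> C) (a b c d : R).

(** The points y are not confined to [a, b]: the integrands come from functions on the plane that
    are continuous at each point of a segment. *)
Definition cts_on a b phi : Prop :=
  forall x, a <= x <= b -> forall e, 0 < e ->
    exists2 r, 0 < r & forall y, `|y - x| < r -> cmod (phi y - phi x) <= e.

Definition cint a b phi : C :=
  Complex (\int[mu]_(x in `[a, b]) complex.Re (phi x))
          (\int[mu]_(x in `[a, b]) complex.Im (phi x)).

Lemma cts_on_integrable a b phi (p : C -> R) : cts_on a b phi ->
  (forall z w, p (z - w) = p z - p w) -> (forall z, `|p z| <= cmod z) ->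
  mu.-integrable `[a, b] (EFin \o (p \o phi)).
Proof.
move=> cphi pB pz.
apply: continuous_compact_integrable; first exact: segment_compact.
apply: continuous_in_subspaceT => x; rewrite inE /= in_itv /= => xab.
apply/cvgrPdist_lt => e e0.
have [r r0 hr] := cphi x xab (e / 2) (divr_gt0 e0 (ltr0n _ 2)).
near=> y => /=; rewrite -pB (le_lt_trans (pz _))// cmodBC.
apply: (@le_lt_trans _ _ (e / 2)); last lra.
by apply: hr; rewrite distrC; near: y; exact: cvgr_dist_lt.
Unshelve. all: by end_near. Qed.

Lemma cts_on_Re a b phi : cts_on a b phi ->
  mu.-integrable `[a, b] (EFin \o (fun x => complex.Re (phi x))).
Proof.
move=> h; apply: (cts_on_integrable h); last exact: normr_Re_le.
by move=> [? ?] [? ?].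
Qed.

Lemma cts_on_Im a b phi : cts_on a b phi ->
  mu.-integrable `[a, b] (EFin \o (fun x => complex.Im (phi x))).
Proof.
move=> h; apply: (cts_on_integrable h); last exact: normr_Im_le.
by move=> [? ?] [? ?].
Qed.

Lemma cts_onD a b phi psi : cts_on a b phi -> cts_on a b psi ->
  cts_on a b (fun x => phi x + psi x).
Proof.
move=> h k x xab e e0; have e2 : 0 < e / 2 by rewrite divr_gt0.
have [r r0 hr] := h x xab _ e2; have [s s0 hs] := k x xab _ e2.
exists (Num.min r s); first by rewrite lt_min r0.
move=> y; rewrite lt_min => /andP[/hr A /hs B].
rewrite opprD addrACA (le_trans (cmodD _ _))//; lra.
Qed.

Lemma cts_onZ a b phi (k : C) : cts_on a b phi ->
  cts_on a b (fun x => k * phi x).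
Proof.
move=> h x xab e e0.
have k0 : 0 < cmod k + 1 by rewrite ltr_wpDl ?cmod_ge0.
have [r r0 hr] := h x xab _ (divr_gt0 e0 k0); exists r => // y /hr.
rewrite -mulrBr cmodM ler_pdivlMr// mulrC; apply: le_trans.
by rewrite ler_wpM2r ?cmod_ge0// lerDl.
Qed.

Lemma cts_on_cst a b (k : C) : cts_on a b (fun=> k).
Proof. by move=> x _ e e0; exists 1 => // y _; rewrite subrr cmod0 ltW. Qed.

Lemma cintD a b phi psi : cts_on a b phi -> cts_on a b psi ->
  cint a b (fun x => phi x + psi x) = cint a b phi + cint a b psi.
Proof.
move=> h k; apply/eqP; rewrite eq_complex /=; apply/andP; split; apply/eqP.
  rewrite -RintegralD//; [|exact: cts_on_Re..].
  by apply: eq_Rintegral => x _; case: (phi x) => ? ?; case: (psi x).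
rewrite -RintegralD//; [|exact: cts_on_Im..].
by apply: eq_Rintegral => x _; case: (phi x) => ? ?; case: (psi x).
Qed.

Lemma cintZ a b phi (k : C) : cts_on a b phi ->
  cint a b (fun x => k * phi x) = k * cint a b phi.
Proof.
move=> h; have hR := cts_on_Re h; have hI := cts_on_Im h.
have Z p (f : R -> R) : mu.-integrable `[a, b] (EFin \o f) ->
    mu.-integrable `[a, b] (EFin \o (fun x => p * f x)).
  move=> hf; rewrite (_ : EFin \o _ = (fun x => p%:E * (EFin \o f) x)%E).
    by apply: integrableZl => //; exact: measurable_itv.
  by apply/funext => x /=; rewrite EFinM.
case: k => p q; apply/eqP; rewrite eq_complex /=; apply/andP; split; apply/eqP.
  rewrite -!RintegralZl// -RintegralB//; try exact: Z.
  by apply: eq_Rintegral => x _; case: (phi x).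
rewrite -!RintegralZl// -RintegralD//; try exact: Z.
by apply: eq_Rintegral => x _; case: (phi x).
Qed.

Lemma cint_cst a b (k : C) : a <= b -> cint a b (fun=> k) = k * Complex (b - a) 0.
Proof.
move=> ab; have e : fine (mu `[a, b]) = b - a.
  rewrite lebesgue_measure_itv /= lte_fin; move: ab; rewrite le_eqVlt.
  by case/orP => [/eqP->|->]; rewrite ?ltxx ?subrr.
rewrite /cint !Rintegral_cst//; case: k => p q /=.
by rewrite e; apply/eqP; rewrite eq_complex /= !mulr0 subr0 add0r !eqxx.
Qed.

Lemma cint_split a m b phi : a <= m <= b -> cts_on a b phi ->
  cint a b phi = cint a m phi + cint m b phi.
Proof.
move=> /andP[am mb] h.
have S (f : R -> R) : mu.-integrable `[a, b] (EFin \o f) ->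
    \int[mu]_(x in `[a, b]) f x = \int[mu]_(x in `[a, m]) f x + \int[mu]_(x in `[m, b]) f x.
  move=> hf; have := @Rintegral_itvB R f (BLeft a) (BRight b) m hf.
  rewrite !bnd_simp => /(_ am mb) /eqP; rewrite subr_eq addrC => /eqP ->; congr (_ + _).
  rewrite Rintegral_itv_obnd_cbnd//; apply: integrableS hf => //.
  by apply: subset_itvr; rewrite bnd_simp.
by apply/eqP; rewrite eq_complex /= !S ?eqxx//; [exact: cts_on_Im|exact: cts_on_Re].
Qed.

(** The factor 2 comes from bounding real and imaginary parts separately. *)
Lemma cint_bound a b phi M : a <= b -> cts_on a b phi ->
  (forall x, a <= x <= b -> cmod (phi x) <= M) ->
  cmod (cint a b phi) <= 2 * M * (b - a).
Proof.
move=> ab h hM.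
have B (f : R -> R) : mu.-integrable `[a, b] (EFin \o f) ->
    (forall x, a <= x <= b -> `|f x| <= M) ->
    `|\int[mu]_(x in `[a, b]) f x| <= M * (b - a).
  move=> hf fM; apply: le_trans (le_normr_Rintegral _ hf) _ => //.
  have -> : M * (b - a) = \int[mu]_(x in `[a, b]) (cst M x).
    rewrite Rintegral_cst//= lebesgue_measure_itv /= lte_fin; move: ab; rewrite le_eqVlt.
    by case/orP => [/eqP->|->]; rewrite ?ltxx ?subrr.
  apply: le_Rintegral => //.
  - exact: integrable_norm.
  - apply: continuous_compact_integrable; first exact: segment_compact.
    by apply: continuous_subspaceT => x; exact: cvg_cst.
apply: le_trans (cmod_le_ReIm _) _ => /=.
have -> : 2 * M * (b - a) = M * (b - a) + M * (b - a) by ring.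
apply: lerD; apply: B.
- exact: cts_on_Re.
- by move=> x /hM; apply: le_trans; exact: normr_Re_le.
- exact: cts_on_Im.
- by move=> x /hM; apply: le_trans; exact: normr_Im_le.
Qed.

Lemma cint_Re_lb a b phi K : a <= b -> cts_on a b phi ->
  (forall x, a <= x <= b -> K <= complex.Re (phi x)) ->
  K * (b - a) <= complex.Re (cint a b phi).
Proof.
move=> ab h hK /=.
have -> : K * (b - a) = \int[mu]_(x in `[a, b]) (cst K x).
  rewrite Rintegral_cst//= lebesgue_measure_itv /= lte_fin; move: ab; rewrite le_eqVlt.
  by case/orP => [/eqP->|->]; rewrite ?ltxx ?subrr.
apply: le_Rintegral => //; last exact: cts_on_Re.
apply: continuous_compact_integrable; first exact: segment_compact.
by apply: continuous_subspaceT => x; exact: cvg_cst.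
Qed.

End ComplexIntegral.

(** * Compactness of a rectangle by bisection *)

Section Bisection.
Variable R : realType.

Lemma nested_itv (a b : nat -> R) :
  (forall k, a k <= a k.+1) -> (forall k, b k.+1 <= b k) -> (forall k, a k <= b k) ->
  exists x, forall k, a k <= x <= b k.
Proof.
move=> ai bi ab.
have am : {homo a : i j / (i <= j)%N >-> i <= j} by exact/nondecreasing_seqP.
have bm : {homo b : i j / (i <= j)%N >-> j <= i} by exact/nonincreasing_seqP.
have abm i j : a i <= b j.
  have [ij|/ltnW ji] := leqP i j; first exact: le_trans (am _ _ ij) (ab j).
  exact: le_trans (ab i) (bm _ _ ji).
have hs : has_sup (range a).
  by split; [exists (a 0%N), 0%N|exists (b 0%N) => _ [k _ <-]].
exists (sup (range a)) => k; apply/andP; split.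
  by apply: sup_upper_bound => //; exists k.
by apply: ge_sup => //; [exists (a 0%N), 0%N|move=> _ [j _ <-]].
Qed.

Variables a0 b0 c0 d0 : R.
Hypotheses (ab0 : a0 <= b0) (cd0 : c0 <= d0).

Definition subrect a b c d := [/\ a0 <= a, a <= b & b <= b0] /\ [/\ c0 <= c, c <= d & d <= d0].

(** Compactness as an induction principle: a failure would yield nested bad rectangles shrinking to
    a point, where the local hypothesis applies. *)
Lemma rect_bisection (P : R -> R -> R -> R -> Prop) :
  (forall a b c d, subrect a b c d ->
    let m := (a + b) / 2 in let n := (c + d) / 2 in
    P a m c n -> P m b c n -> P a m n d -> P m b n d -> P a b c d) ->
  (forall x y, a0 <= x <= b0 -> c0 <= y <= d0 -> exists2 r, 0 < r &
    forall a b c d, subrect a b c d -> a <= x <= b -> c <= y <= d ->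
      (b - a) + (d - c) < r -> P a b c d) ->
  P a0 b0 c0 d0.
Proof.
move=> Psplit Ploc; apply: contrapT => nP.
pose T := (R * R * (R * R))%type.
pose Pt (t : T) := P t.1.1 t.1.2 t.2.1 t.2.2.
pose st (t : T) := subrect t.1.1 t.1.2 t.2.1 t.2.2.
pose half (a b a' b' : R) := [/\ a <= a', b' <= b & b' - a' = (b - a) / 2].
(* The existential precedes the implications so that [choice] yields a total map, which can be
   iterated. *)
have step (t : T) : exists t' : T, st t -> ~ Pt t ->
    [/\ st t', ~ Pt t', half t.1.1 t.1.2 t'.1.1 t'.1.2 & half t.2.1 t.2.2 t'.2.1 t'.2.2].
  have [[st_t nPt]|H] := pselect (st t /\ ~ Pt t); last by exists t => h1 h2; case: H.
  apply: contrapT => hn; apply: nPt.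
  case: t st_t hn => [[a b] [c d]] s_t hn; have [[/= ? ? ?] [? ? ?]] := s_t.
  have Q a' b' c' d' : st ((a', b'), (c', d')) -> half a b a' b' -> half c d c' d' ->
      P a' b' c' d'.
    by move=> s' h1 h2; apply: contrapT => nP'; apply: hn; exists ((a', b'), (c', d')).
  apply: (Psplit a b c d s_t); apply: Q; rewrite /st /subrect /half /=; do ?split; lra.
have [f hf] := choice step.
pose u k := iter k f ((a0, b0), (c0, d0)).
have inv k : st (u k) /\ ~ Pt (u k).
  elim: k => [|k [s1 s2]]; first by split => //; split; split.
  by have [] := hf _ s1 s2.
have hu k : half (u k).1.1 (u k).1.2 (u k.+1).1.1 (u k.+1).1.2 /\
            half (u k).2.1 (u k).2.2 (u k.+1).2.1 (u k.+1).2.2.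
  by have [s1 s2] := inv k; have [] := hf _ s1 s2.
have [x hx] := @nested_itv (fun k => (u k).1.1) (fun k => (u k).1.2)
  (fun k => let: conj (And3 h _ _) _ := hu k in h)
  (fun k => let: conj (And3 _ h _) _ := hu k in h)
  (fun k => let: conj (conj (And3 _ h _) _) _ := inv k in h).
have [y hy] := @nested_itv (fun k => (u k).2.1) (fun k => (u k).2.2)
  (fun k => let: conj _ (And3 h _ _) := hu k in h)
  (fun k => let: conj _ (And3 _ h _) := hu k in h)
  (fun k => let: conj (conj _ (And3 _ h _)) _ := inv k in h).
have [r r0 hr] := Ploc x y (hx 0%N) (hy 0%N).
have len k : ((u k).1.2 - (u k).1.1) + ((u k).2.2 - (u k).2.1) =
    ((b0 - a0) + (d0 - c0)) / 2 ^+ k.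
  elim: k => [|k IH]; first by rewrite expr0 divr1.
  have [[_ _ ->] [_ _ ->]] := hu k; rewrite -mulrDl IH exprSr invfM mulrA.
  by rewrite -!mulrA.
have [k hk] : exists k, ((b0 - a0) + (d0 - c0)) / 2 ^+ k < r.
  set L := _ + _; have L0 : 0 <= L by rewrite addr_ge0// subr_ge0.
  have [k hk] : exists k : nat, L / r < k%:R.
    exists (Num.bound (L / r)); apply: archi_boundP.
    by rewrite divr_ge0// ltW.
  exists k; rewrite ltr_pdivrMr ?exprn_gt0// mulrC -ltr_pdivrMr//.
  apply: lt_trans hk _; rewrite -natrX ltr_nat; exact: ltn_expl.
have [s1 s2] := inv k; apply: s2; apply: hr => //.
by rewrite len.
Qed.

End Bisection.

(** * Goursat's theorem, with and without a puncture *)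

Section Cauchy.
Variable R : realType.
Local Notation C := R[i].
Implicit Types (f g : C -> C) (a b c d x y : R).
Local Notation I := (Complex 0 1 : C).

Definition ccont_at f z : Prop := forall e : R, 0 < e ->
  exists2 r : R, 0 < r & forall h, cmod h < r -> cmod (f (z + h) - f z) <= e.

Definition cdiff_at f z : Prop := exists a : C, forall e : R, 0 < e ->
  exists2 r : R, 0 < r & forall h, cmod h < r ->
    cmod (f (z + h) - f z - a * h) <= e * cmod h.

Lemma cdiff_cont f z : cdiff_at f z -> ccont_at f z.
Proof.
move=> [a ha] e e0; have [r r0 hr] := ha 1 ltr01.
have k0 : 0 < cmod a + 1 by rewrite ltr_wpDl ?cmod_ge0.
exists (Num.min r (e / (cmod a + 1))); first by rewrite lt_min r0 divr_gt0.
move=> h; rewrite lt_min => /andP[/hr h1]; rewrite ltr_pdivlMr// => h2.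
rewrite -[_ - _](subrK (a * h)) (le_trans (cmodD _ _))// cmodM; nra.
Qed.

(** The integral of f dz over the counterclockwise boundary; dz is I dy on the vertical sides. *)
Definition oint f a b c d : C :=
  cint a b (fun x => f (Complex x c)) - cint a b (fun x => f (Complex x d))
  + I * (cint c d (fun y => f (Complex b y)) - cint c d (fun y => f (Complex a y))).

Lemma ccont_hseg f a b y : (forall x, a <= x <= b -> ccont_at f (Complex x y)) ->
  cts_on a b (fun x => f (Complex x y)).
Proof.
move=> h x xab e e0; have [r r0 hr] := h x xab e e0; exists r => // x' xx.
have -> : Complex x' y = Complex x y + Complex (x' - x) 0.
  by apply/eqP; rewrite eq_complex /= addr0 addrC subrK !eqxx.
by apply: hr; rewrite cmod_real.
Qed.

Lemma ccont_vseg f c d x : (forall y, c <= y <= d -> ccont_at f (Complex x y)) ->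
  cts_on c d (fun y => f (Complex x y)).
Proof.
move=> h y ycd e e0; have [r r0 hr] := h y ycd e e0; exists r => // y' yy.
have -> : Complex x y' = Complex x y + Complex 0 (y' - y).
  by apply/eqP; rewrite eq_complex /= addr0 [y + _]addrC subrK !eqxx.
by apply: hr; rewrite cmod_imag.
Qed.

Definition edge a b c d (z : C) : Prop :=
  let: Complex x y := z in
  (a <= x <= b /\ (y = c \/ y = d)) \/ ((x = a \/ x = b) /\ c <= y <= d).

Definition edge_cont f a b c d := forall z, edge a b c d z -> ccont_at f z.

Lemma edge_cts f a b c d : edge_cont f a b c d ->
  [/\ cts_on a b (fun x => f (Complex x c)), cts_on a b (fun x => f (Complex x d)),
      cts_on c d (fun y => f (Complex a y)) & cts_on c d (fun y => f (Complex b y))].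
Proof.
move=> h; split.
- by apply: ccont_hseg => x xab; apply: h; left; split => //; left.
- by apply: ccont_hseg => x xab; apply: h; left; split => //; right.
- by apply: ccont_vseg => y ycd; apply: h; right; split => //; left.
- by apply: ccont_vseg => y ycd; apply: h; right; split => //; right.
Qed.

Lemma ointD f g a b c d : edge_cont f a b c d -> edge_cont g a b c d ->
  oint (fun z => f z + g z) a b c d = oint f a b c d + oint g a b c d.
Proof.
move=> /edge_cts[f1 f2 f3 f4] /edge_cts[g1 g2 g3 g4].
by rewrite /oint !cintD//; ring.
Qed.

Lemma ointZ f (k : C) a b c d : edge_cont f a b c d ->
  oint (fun z => k * f z) a b c d = k * oint f a b c d.
Proof.
move=> /edge_cts[f1 f2 f3 f4].
by rewrite /oint !cintZ//; ring.
Qed.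

Lemma oint_hsplit f a m b c d : a <= m <= b ->
  cts_on a b (fun x => f (Complex x c)) -> cts_on a b (fun x => f (Complex x d)) ->
  oint f a b c d = oint f a m c d + oint f m b c d.
Proof.
by move=> amb h1 h2; rewrite /oint (cint_split amb h1) (cint_split amb h2); ring.
Qed.

Lemma oint_vsplit f a b c m d : c <= m <= d ->
  cts_on c d (fun y => f (Complex a y)) -> cts_on c d (fun y => f (Complex b y)) ->
  oint f a b c d = oint f a b c m + oint f a b m d.
Proof.
by move=> amb h1 h2; rewrite /oint (cint_split amb h1) (cint_split amb h2); ring.
Qed.

Lemma oint_bound f a b c d M : a <= b -> c <= d -> edge_cont f a b c d ->
  (forall z, edge a b c d z -> cmod (f z) <= M) ->
  cmod (oint f a b c d) <= 4 * M * ((b - a) + (d - c)).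
Proof.
move=> ab cd /edge_cts[f1 f2 f3 f4] h.
have h1 := cint_bound ab f1 (fun x xab => h (Complex x c) (or_introl (conj xab (or_introl erefl)))).
have h2 := cint_bound ab f2 (fun x xab => h (Complex x d) (or_introl (conj xab (or_intror erefl)))).
have h3 := cint_bound cd f3 (fun y ycd => h (Complex a y) (or_intror (conj (or_introl erefl) ycd))).
have h4 := cint_bound cd f4 (fun y ycd => h (Complex b y) (or_intror (conj (or_intror erefl) ycd))).
rewrite /oint; apply: le_trans (cmodD _ _) _; rewrite cmodM cmod_imag normr1 mul1r.
apply: le_trans (lerD (cmodB _ _) (cmodB _ _)) _.
by move: h1 h2 h3 h4; lra.
Qed.

(** On opposite sides the integrand differs by a constant, q I (c - d) or q (b - a); integrating
    these constants gives two terms that cancel. *)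
Lemma oint_affine (p q : C) a b c d : a <= b -> c <= d ->
  oint (fun z => p + q * z) a b c d = 0.
Proof.
move=> ab cd.
have H y : cts_on a b (fun x => p + q * Complex x y).
  apply: cts_onD; first exact: cts_on_cst.
  apply: cts_onZ => x _ e e0; exists e => // x' /ltW xx.
  have -> : Complex x' y - Complex x y = Complex (x' - x) 0.
    by apply/eqP; rewrite eq_complex /= subrr !eqxx.
  by rewrite cmod_real.
have V x : cts_on c d (fun y => p + q * Complex x y).
  apply: cts_onD; first exact: cts_on_cst.
  apply: cts_onZ => y _ e e0; exists e => // y' /ltW yy.
  have -> : Complex x y' - Complex x y = Complex 0 (y' - y).
    by apply/eqP; rewrite eq_complex /= subrr !eqxx.
  by rewrite cmod_imag.
have eH : cint a b (fun x => p + q * Complex x c) =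
    cint a b (fun x => p + q * Complex x d) + q * Complex 0 (c - d) * Complex (b - a) 0.
  rewrite -(cint_cst (q * Complex 0 (c - d)) ab) -cintD//; last exact: cts_on_cst.
  congr cint; apply/funext => x; rewrite -addrA -mulrDr; congr (_ + _ * _).
  by apply/eqP; rewrite eq_complex /= addr0 [d + _]addrC subrK !eqxx.
have eV : cint c d (fun y => p + q * Complex b y) =
    cint c d (fun y => p + q * Complex a y) + q * Complex (b - a) 0 * Complex (d - c) 0.
  rewrite -(cint_cst (q * Complex (b - a) 0) cd) -cintD//; last exact: cts_on_cst.
  congr cint; apply/funext => x; rewrite -addrA -mulrDr; congr (_ + _ * _).
  by apply/eqP; rewrite eq_complex /= addr0 [a + _]addrC subrK !eqxx.
rewrite /oint eH eV.
have -> : Complex 0 (c - d) = - (I * Complex (d - c) 0) :> C.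
  by apply/eqP; rewrite eq_complex /= ; apply/andP; split; apply/eqP; ring.
ring.
Qed.

Lemma cmod_rect_diam a b c d x y x' y' : a <= x <= b -> c <= y <= d ->
  a <= x' <= b -> c <= y' <= d ->
  cmod (Complex x y - Complex x' y') <= (b - a) + (d - c).
Proof.
move=> h1 h2 h3 h4; apply: le_trans (cmod_le_ReIm _) _ => /=.
by apply: lerD; rewrite ler_norml; lra.
Qed.

Lemma edge_rect a b c d x y : a <= b -> c <= d -> edge a b c d (Complex x y) ->
  a <= x <= b /\ c <= y <= d.
Proof. by move=> ab cd [[h [->|->]]|[[->|->] h]]; split=> //; rewrite ?lexx ?ab ?cd. Qed.

(** The bound eta l^2, with l the half-perimeter, survives bisection since 4 (l / 2)^2 = l^2. It
    holds for small rectangles around any point, because f minus its affine part is at most (eta /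
    4) l on the edge and [oint_bound] contributes 4 l. *)
Theorem goursat f a b c d : a <= b -> c <= d ->
  (forall x y, a <= x <= b -> c <= y <= d -> cdiff_at f (Complex x y)) ->
  oint f a b c d = 0.
Proof.
move=> ab cd hf.
have fc a' b' c' d' : subrect a b c d a' b' c' d' -> edge_cont f a' b' c' d'.
  move=> [[aa ab' bb] [cc cd' dd]] [x y] /edge_rect => /(_ ab' cd')[/andP[? ?] /andP[? ?]].
  by apply: cdiff_cont; apply: hf; lra.
apply: cmod0_eq0; apply/eqP; rewrite eq_le cmod_ge0 andbT; apply/ler_addgt0Pr => e e0.
rewrite add0r.
(* The + 1 keeps the denominator positive for a degenerate rectangle. *)
pose eta := e / (((b - a) + (d - c)) ^+ 2 + 1).
have eta0 : 0 < eta by rewrite divr_gt0// ltr_wpDl// sqr_ge0.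
have etae : eta * ((b - a) + (d - c)) ^+ 2 <= e.
  rewrite /eta mulrAC ler_pdivrMr; last by rewrite ltr_wpDl// sqr_ge0.
  by rewrite ler_pM2l// lerDl.
apply: le_trans etae.
apply: (rect_bisection ab cd (P := fun a b c d =>
  cmod (oint f a b c d) <= eta * ((b - a) + (d - c)) ^+ 2)).
  move=> a' b' c' d' s m n h1 h2 h3 h4.
  have [[aa ab' bb] [cc cd' dd]] := s.
  have am : a' <= m <= b' by rewrite /m; lra.
  have cn : c' <= n <= d' by rewrite /n; lra.
  have hs x : a' <= x <= b' -> cts_on c' d' (fun y => f (Complex x y)).
    move=> /andP[ax xb]; apply: ccont_vseg => y /andP[cy yd]; apply: cdiff_cont.
    by apply: hf; rewrite ?(le_trans aa) ?(le_trans xb) ?(le_trans cc) ?(le_trans yd).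
  have vs y : c' <= y <= d' -> cts_on a' b' (fun x => f (Complex x y)).
    move=> /andP[cy yd]; apply: ccont_hseg => x /andP[ax xb]; apply: cdiff_cont.
    by apply: hf; rewrite ?(le_trans aa) ?(le_trans xb) ?(le_trans cc) ?(le_trans yd).
  have -> : oint f a' b' c' d' = (oint f a' m c' n + oint f a' m n d') +
      (oint f m b' c' n + oint f m b' n d').
    rewrite (@oint_hsplit f a' m b')//; [|by apply: vs; rewrite lexx cd'..].
    by congr (_ + _); apply: oint_vsplit => //; apply: hs; rewrite ?lexx ?ab'.
  apply: le_trans (cmodD _ _) _.
  apply: le_trans (lerD (cmodD _ _) (cmodD _ _)) _.
  apply: le_trans (lerD (lerD h1 h3) (lerD h2 h4)) _.
  by rewrite le_eqVlt; apply/orP; left; apply/eqP; rewrite /m /n; field.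
move=> x y xab ycd; have [q hq] := hf x y xab ycd.
have [r r0 hr] := hq (eta / 4) (divr_gt0 eta0 (ltr0n _ 4)).
exists r => // a' b' c' d' s xab' ycd' hlt; have [[aa ab' bb] [cc cd' dd]] := s.
set z := Complex x y in hq hr *.
pose g w := f w - ((f z - q * z) + q * w).
have ac : edge_cont (fun w => f z - q * z + q * w) a' b' c' d'.
  move=> w _; apply: cdiff_cont; exists q => e' e'0; exists 1 => // h _.
  have -> : f z - q * z + q * (w + h) - (f z - q * z + q * w) - q * h = 0 by ring.
  by rewrite cmod0 mulr_ge0 ?cmod_ge0// ltW.
have acN : edge_cont (fun w => - 1 * (f z - q * z + q * w)) a' b' c' d'.
  move=> w /ac h e' e'0; have [r' r'0 hr'] := h e' e'0; exists r' => // h' /hr'.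
  by rewrite !mulN1r -opprD cmodN.
have ge : oint f a' b' c' d' = oint g a' b' c' d'.
  have -> : g = (fun w => f w + (-1) * (f z - q * z + q * w)).
    by apply/funext => w; rewrite /g mulN1r.
  by rewrite ointD//; [rewrite ointZ// oint_affine// mulr0 addr0|exact: fc].
have gc : edge_cont g a' b' c' d'.
  move=> w wE e' e'0; have e2 : 0 < e' / 2 by lra.
  have [r1 r10 hr1] := fc _ _ _ _ s w wE _ e2.
  have [r2 r20 hr2] := ac w wE _ e2.
  exists (Num.min r1 r2); first by rewrite lt_min r10.
  move=> h; rewrite lt_min => /andP[/hr1 k1 /hr2 k2].
  have -> : g (w + h) - g w = (f (w + h) - f w) -
    ((f z - q * z + q * (w + h)) - (f z - q * z + q * w)) by rewrite /g; ring.
  apply: le_trans (cmodB _ _) _; lra.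
rewrite ge.
have := @oint_bound g a' b' c' d' (eta / 4 * (b' - a' + (d' - c'))) ab' cd' gc.
have -> : 4 * (eta / 4 * (b' - a' + (d' - c'))) * (b' - a' + (d' - c')) =
   eta * (b' - a' + (d' - c')) ^+ 2 by field.
apply; move=> [x' y'] /edge_rect => /(_ ab' cd')[h1 h2].
have hd := cmod_rect_diam h1 h2 xab' ycd'.
have -> : g (Complex x' y') = f (z + (Complex x' y' - z)) - f z - q * (Complex x' y' - z).
  by rewrite [z + _]addrC subrK /g; ring.
apply: le_trans (hr _ _) _; first exact: le_lt_trans hd hlt.
by rewrite ler_wpM2l// ltW// divr_gt0.
Qed.

Lemma cdiff_cst (k : C) z : cdiff_at (fun=> k) z.
Proof.
exists 0 => e e0; exists 1 => // h _.
by rewrite subrr mul0r subr0 cmod0 mulr_ge0 ?cmod_ge0// ltW.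
Qed.

Lemma cdiffB f g z : cdiff_at f z -> cdiff_at g z -> cdiff_at (fun w => f w - g w) z.
Proof.
move=> [a ha] [b hb]; exists (a - b) => e e0; have e2 : 0 < e / 2 by lra.
have [r r0 hr] := ha _ e2; have [s s0 hs] := hb _ e2.
exists (Num.min r s); first by rewrite lt_min r0.
move=> h; rewrite lt_min => /andP[/hr A /hs B].
have -> : f (z + h) - g (z + h) - (f z - g z) - (a - b) * h =
  (f (z + h) - f z - a * h) - (g (z + h) - g z - b * h) by ring.
apply: le_trans (cmodB _ _) _; lra.
Qed.

Lemma cdiffM f g z : cdiff_at f z -> cdiff_at g z -> cdiff_at (fun w => f w * g w) z.
Proof.
move=> fd gd; have fc := cdiff_cont fd.
case: fd gd => [a ha] [b hb]; exists (a * g z + f z * b) => e e0.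
pose M := cmod (f z) + 1 + cmod (g z) + cmod b.
have M0 : 0 < M by rewrite /M; have := cmod_ge0 (f z); have := cmod_ge0 (g z); have := cmod_ge0 b; lra.
(* Each of the three terms below is at most e' M |h|; the bound e' <= 1 gives |f (z + h)| <= |f z| +
   1. *)
pose e' := Num.min 1 (e / (3 * M)).
have e'0 : 0 < e' by rewrite lt_min ltr01 divr_gt0// mulr_gt0.
have e'1 : e' <= 1 by rewrite ge_min lexx.
have e'M : e' * (3 * M) <= e.
  by rewrite -ler_pdivlMr ?mulr_gt0// ge_min lexx orbT.
have [r r0 hr] := ha _ e'0; have [s s0 hs] := hb _ e'0; have [t t0 ht] := fc _ e'0.
exists (Num.min r (Num.min s t)); first by rewrite !lt_min r0 s0.
move=> h; rewrite !lt_min => /and3P[/hr A /hs B /ht D].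
have -> : f (z + h) * g (z + h) - f z * g z - (a * g z + f z * b) * h =
  (f (z + h) - f z) * (b * h) + (f (z + h) - f z - a * h) * g z
  + f (z + h) * (g (z + h) - g z - b * h) by ring.
have F : cmod (f (z + h)) <= cmod (f z) + 1.
  rewrite -[f (z + h)](subrK (f z)); apply: le_trans (cmodD _ _) _; lra.
have h0 := cmod_ge0 h; have g0 := cmod_ge0 (g z); have b0 := cmod_ge0 b.
have f0 := cmod_ge0 (f z).
apply: le_trans (cmodD _ _) _; rewrite cmodM.
apply: le_trans (lerD (cmodD _ _) (lexx _)) _; rewrite !cmodM.
have T1 : cmod (f (z + h) - f z) * (cmod b * cmod h) <= e' * (M * cmod h).
  apply: ler_pM; rewrite ?mulr_ge0 ?cmod_ge0//.
  by apply: ler_wpM2r => //; rewrite /M; lra.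
have T2 : cmod (f (z + h) - f z - a * h) * cmod (g z) <= e' * cmod h * M.
  by apply: ler_pM; rewrite ?cmod_ge0// /M; lra.
have T3 : cmod (f (z + h)) * cmod (g (z + h) - g z - b * h) <= M * (e' * cmod h).
  by apply: ler_pM; rewrite ?cmod_ge0// /M; lra.
have T : e' * (3 * M) * cmod h <= e * cmod h by rewrite ler_wpM2r.
by move: T1 T2 T3 T; lra.
Qed.

Lemma cdiff_invB (z1 z : C) : z != z1 -> cdiff_at (fun w => (w - z1)^-1) z.
Proof.
move=> zz; have p0 : z - z1 != 0 by rewrite subr_eq0.
set p := z - z1 in p0; have pp : 0 < cmod p by rewrite cmod_gt0.
exists (- (p ^+ 2)^-1) => e e0.
exists (Num.min (cmod p / 2) (e * cmod p ^+ 3 / 2)).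
  by rewrite lt_min !divr_gt0 ?mulr_gt0 ?exprn_gt0.
move=> h; rewrite lt_min => /andP[h1 h2].
have ph : cmod p / 2 <= cmod (p + h) by have := cmod_lb p h; lra.
have ph0 : p + h != 0 by rewrite -cmod_gt0; lra.
have -> : z + h - z1 = p + h by rewrite /p; ring.
(* The remainder is quadratic in h: the first radius keeps |p + h| above |p| / 2, the second absorbs
   the spare factor h. *)
have -> : (p + h)^-1 - p^-1 - - (p ^+ 2)^-1 * h = h * (h / (p ^+ 2 * (p + h))).
  by field; rewrite ph0 p0.
rewrite cmodM mulrC; apply: ler_wpM2r; first exact: cmod_ge0.
have E : cmod (p ^+ 2 * (p + h)) = cmod p ^+ 2 * cmod (p + h).
  by rewrite cmodM !expr2 cmodM.
rewrite cmodM cmodV E ler_pdivrMr; last first.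
  by rewrite mulr_gt0 ?exprn_gt0//; lra.
apply: le_trans (ltW h2) _.
have -> : e * cmod p ^+ 3 / 2 = e * cmod p ^+ 2 * (cmod p / 2) by field.
by rewrite [leRHS]mulrA; apply: ler_wpM2l => //; rewrite mulr_ge0 ?sqr_ge0 ?(ltW e0).
Qed.

(** Four rectangles around a small central square avoid the puncture and contribute 0; the square,
    of half-side t, contributes at most 16 (|M| + 1) t. *)
Lemma goursat_punctured f a b c d x0 y0 (M r : R) : a < x0 < b -> c < y0 < d ->
  (forall x y, a <= x <= b -> c <= y <= d -> Complex x y != Complex x0 y0 ->
     cdiff_at f (Complex x y)) ->
  0 < r -> (forall w, w != Complex x0 y0 -> cmod (w - Complex x0 y0) < r -> cmod (f w) <= M) ->
  oint f a b c d = 0.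
Proof.
move=> xab ycd hf r0 hM.
have nex x y : x != x0 -> Complex x y != Complex x0 y0.
  by move=> xx; rewrite eq_complex /= negb_and xx.
have ney x y : y != y0 -> Complex x y != Complex x0 y0.
  by move=> xx; rewrite eq_complex /= negb_and xx orbT.
apply: cmod0_eq0; apply/eqP; rewrite eq_le cmod_ge0 andbT; apply/ler_addgt0Pr => e e0.
rewrite add0r.
have M1 : 0 < `|M| + 1 by rewrite ltr_wpDl.
pose u := Num.min (Num.min (x0 - a) (b - x0)) (Num.min (y0 - c) (d - y0)).
have u0 : 0 < u by rewrite !lt_min; lra.
(* [u] keeps the square inside the rectangle; [r / 8] keeps its points within 4 t <= r / 2 of the
   puncture, where f is bounded. *)
pose t := Num.min u (Num.min (r / 8) (e / (16 * (`|M| + 1)))).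
have t0 : 0 < t.
  by rewrite lt_min u0 lt_min !divr_gt0//= mulr_gt0.
have tu : t <= u by rewrite ge_min lexx.
have tr : t <= r / 8 by rewrite !ge_min lexx orbT.
have te : 16 * (`|M| + 1) * t <= e.
  by rewrite mulrC -ler_pdivlMr ?mulr_gt0// !ge_min lexx !orbT.
have {tu u0} : [/\ t <= x0 - a, t <= b - x0, t <= y0 - c & t <= d - y0].
  by move: tu; rewrite !le_min => /andP[/andP[-> ->] /andP[-> ->]].
move=> [t1 t2 t3 t4].
have hs x : a <= x <= b -> x != x0 -> forall c' d', c <= c' -> d' <= d ->
    cts_on c' d' (fun y => f (Complex x y)).
  move=> xab' xx c' d' cc dd; apply: ccont_vseg => y ycd'; apply: cdiff_cont; apply: hf => //.
    lra.
  exact: nex.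
have vs y : c <= y <= d -> y != y0 -> forall a' b', a <= a' -> b' <= b ->
    cts_on a' b' (fun x => f (Complex x y)).
  move=> ycd' yy a' b' aa bb; apply: ccont_hseg => x xab'; apply: cdiff_cont; apply: hf => //.
    lra.
  exact: ney.
rewrite (@oint_hsplit f a (x0 - t) b); [|lra|apply: vs; lra|apply: vs; lra].
rewrite (@oint_hsplit f (x0 - t) (x0 + t) b); [|lra|apply: vs; lra|apply: vs; lra].
rewrite (@oint_vsplit f (x0 - t) (x0 + t) c (y0 - t) d); [|lra|apply: hs; lra|apply: hs; lra].
rewrite (@oint_vsplit f (x0 - t) (x0 + t) (y0 - t) (y0 + t) d); [|lra|apply: hs; lra|apply: hs; lra].
rewrite (@goursat f a (x0 - t) c d); [|lra|lra|]; last first.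
  by move=> x y hx hy; apply: hf; [lra|lra|apply: nex; lra].
rewrite (@goursat f (x0 + t) b c d); [|lra|lra|]; last first.
  by move=> x y hx hy; apply: hf; [lra|lra|apply: nex; lra].
rewrite (@goursat f (x0 - t) (x0 + t) c (y0 - t)); [|lra|lra|]; last first.
  by move=> x y hx hy; apply: hf; [lra|lra|apply: ney; lra].
rewrite (@goursat f (x0 - t) (x0 + t) (y0 + t) d); [|lra|lra|]; last first.
  by move=> x y hx hy; apply: hf; [lra|lra|apply: ney; lra].
rewrite !add0r !addr0.
have en x y : edge (x0 - t) (x0 + t) (y0 - t) (y0 + t) (Complex x y) ->
    [/\ x0 - t <= x <= x0 + t, y0 - t <= y <= y0 + t & Complex x y != Complex x0 y0].
  have xt : x0 - t <= x0 + t by lra.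
  have yt : y0 - t <= y0 + t by lra.
  move=> h; have [h1 h2] := edge_rect xt yt h; split => //.
  have tn0 : t != 0 by rewrite gt_eqF.
  case: h => [[_ [->|->]]|[[->|->] _]].
  - by apply: ney; rewrite -subr_eq0 addrAC subrr sub0r oppr_eq0.
  - by apply: ney; rewrite -subr_eq0 addrAC subrr add0r.
  - by apply: nex; rewrite -subr_eq0 addrAC subrr sub0r oppr_eq0.
  - by apply: nex; rewrite -subr_eq0 addrAC subrr add0r.
apply: le_trans (@oint_bound f (x0 - t) (x0 + t) (y0 - t) (y0 + t) (`|M| + 1) _ _ _ _) _.
- lra.
- lra.
- move=> [x y] /en[h1 h2 h3]; apply: cdiff_cont; apply: hf => //; lra.
- move=> [x y] /en[h1 h2 h3]; apply: le_trans (hM _ h3 _) _; last first.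
    by rewrite (le_trans (ler_norm _))// lerDl.
  apply: le_lt_trans (@cmod_rect_diam (x0 - t) (x0 + t) (y0 - t) (y0 + t) _ _ _ _ _ _ _ _) _; lra.
- apply: le_trans te; rewrite le_eqVlt; apply/orP; left; apply/eqP; ring.
Qed.

(** With k equal to 1, -1, I or - I, the contribution of one side of a square to the imaginary part
    of a contour integral becomes a real part. *)
Lemma cint_sign_lb a b phi (k : C) K : a <= b -> cts_on a b phi ->
  (forall x, a <= x <= b -> K <= complex.Re (k * phi x)) ->
  K * (b - a) <= complex.Re (k * cint a b phi).
Proof.
move=> ab h hK; rewrite -cintZ//; apply: cint_Re_lb => //; exact: cts_onZ.
Qed.

End Cauchy.

(** * Cauchy's formula on a square and the Lipschitz estimate *)

Section CauchySquare.
Variable R : realType.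
Local Notation C := R[i].
Implicit Types (f g : C -> C) (x y : R).
Local Notation I := (Complex 0 1 : C).
Variables (s : R) (s_gt0 : 0 < s).

Definition sqker z1 : C := oint (fun w => (w - z1)^-1) (- s) s (- s) s.

Definition inner (z : C) := `|complex.Re z| <= s / 2 /\ `|complex.Im z| <= s / 2.

Lemma edge_inner z1 w : inner z1 -> edge (- s) s (- s) s w ->
  s / 2 <= cmod (w - z1) /\ s <= cmod w.
Proof.
case: z1 w => [x1 y1] [x y] [] /ler_normlP h1 /ler_normlP h2 h.
rewrite /= in h1 h2; case: h1 h2 => [h1 h1'] [h2 h2'].
case: h => [[_ h]|[h _]].
  split.
    apply: le_trans (normr_Im_le _) => /=.
    by case: h => ->; rewrite ler_normr; apply/orP; [right|left]; lra.
  apply: le_trans (normr_Im_le _) => /=.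
  by case: h => ->; rewrite ler_normr; apply/orP; [right|left]; lra.
split.
  apply: le_trans (normr_Re_le _) => /=.
  by case: h => ->; rewrite ler_normr; apply/orP; [right|left]; lra.
apply: le_trans (normr_Re_le _) => /=.
by case: h => ->; rewrite ler_normr; apply/orP; [right|left]; lra.
Qed.

Lemma edge_neq z1 w : inner z1 -> edge (- s) s (- s) s w -> w != z1.
Proof.
have s0 := s_gt0.
move=> h1 h2; have [h3 _] := edge_inner h1 h2.
by rewrite -subr_eq0 -cmod_gt0; lra.
Qed.

Lemma edge_cont_ker z1 : inner z1 -> edge_cont (fun w => (w - z1)^-1) (- s) s (- s) s.
Proof. by move=> h w /(edge_neq h) wz; apply: cdiff_cont; exact: cdiff_invB. Qed.

(* The exact value is [2 i pi], but a lower bound suffices: each side of the square contributes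
   a nonnegative imaginary part. *)
Lemma sqker_lb z1 : inner z1 -> 2 / 9 <= cmod (sqker z1).
Proof.
have s0 := s_gt0.
move=> h; apply: le_trans (normr_Im_le _); apply: le_trans (ler_norm _).
have [c1 c2 c3 c4] := edge_cts (edge_cont_ker h).
have ss : - s <= s by lra.
case: z1 h c1 c2 c3 c4 => x1 y1 h c1 c2 c3 c4.
case: (h); rewrite !ler_norml => hx hy; rewrite /= in hx hy.
have P (k : C) phi K := @cint_sign_lb R (- s) s phi k K ss.
have e x y : Complex x y - Complex x1 y1 = Complex (x - x1) (y - y1) by [].
have D (x y : R) : 0 <= x ^+ 2 + y ^+ 2 by rewrite addr_ge0 ?sqr_ge0.
have := P (- I) _ 0 c1 _; have := P I _ 0 c2 _; have := P (- 1) _ 0 c3 _.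
have := P 1 _ (1 / (9 * s)) c4 _.
rewrite /sqker /oint.
case: (cint _ _ (fun x => (Complex x (- s) - _)^-1)) => b1 b2.
case: (cint _ _ (fun x => (Complex x s - _)^-1)) => t1 t2.
case: (cint _ _ (fun y => (Complex (- s) y - _)^-1)) => l1 l2.
case: (cint _ _ (fun y => (Complex s y - _)^-1)) => r1 r2 H4 H3 H2 H1.
(* With u = s - x1 and v = y - y1 the real part of the kernel is u / (u^2 + v^2), where s / 2 <= u
   <= 3 s / 2 and |v| <= 3 s / 2. This is at least 1 / (9 s), and the side has length 2 s. *)
have {}H4 : 2 / 9 <= r1.
  have -> : r1 = complex.Re (1 * Complex r1 r2) by rewrite mul1r.
  have -> : 2 / 9 = 1 / (9 * s) * (s - - s) by field; lra.
  apply: H4 => y hy'; rewrite [X in complex.Re X]mul1r e.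
  change (1 / (9 * s) <= (s - x1) / ((s - x1) ^+ 2 + (y - y1) ^+ 2)).
  have q : 0 < (s - x1) ^+ 2 + (y - y1) ^+ 2 by rewrite ltr_pwDl ?sqr_ge0// exprn_gt0; lra.
  rewrite ler_pdivlMr// mulrC mulrA ler_pdivrMr; last by lra.
  by nra.
have {}H3 : 0 <= - l1.
  have -> : - l1 = complex.Re (- 1 * Complex l1 l2) by rewrite mulN1r.
  apply: le_trans (H3 _); first by rewrite mul0r.
  move=> y hy'; rewrite mulN1r e /= -mulNr; apply: divr_ge0 => //; lra.
have {}H2 : 0 <= - t2.
  have -> : - t2 = complex.Re (I * Complex t1 t2) by rewrite /= mul0r mul1r sub0r.
  apply: le_trans (H2 _); first by rewrite mul0r.
  move=> y hy'; rewrite e /= mul0r mul1r sub0r opprK; apply: divr_ge0 => //; lra.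
have {}H1 : 0 <= b2.
  have -> : b2 = complex.Re (- I * Complex b1 b2) by rewrite /= oppr0 mul0r mulN1r sub0r opprK.
  apply: le_trans (H1 _); first by rewrite mul0r.
  move=> y hy'; rewrite e /= oppr0 mul0r mulN1r sub0r opprK -mulNr; apply: divr_ge0 => //; lra.
rewrite /=; lra.
Qed.

(** Write g w = (g w - g z1) + g z1. The difference quotient is bounded near z1 by
    differentiability, so the punctured Goursat theorem removes the first part. *)
Lemma cauchy_square g z1 : inner z1 ->
  (forall x y, - s <= x <= s -> - s <= y <= s -> cdiff_at g (Complex x y)) ->
  oint (fun w => g w * (w - z1)^-1) (- s) s (- s) s = g z1 * sqker z1.
Proof.
have s0 := s_gt0.
move=> h hg; have [] := h; rewrite !ler_norml => hx hy.
have gd z : edge (- s) s (- s) s z -> cdiff_at g z.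
  by case: z => x y /edge_rect => -[||h1 h2]; [lra|lra|exact: hg].
have ec k : edge_cont (fun w => (g w - k) * (w - z1)^-1) (- s) s (- s) s.
  move=> w hw; apply: cdiff_cont; apply: cdiffM.
    by apply: cdiffB; [exact: gd|exact: cdiff_cst].
  by apply: cdiff_invB; exact: edge_neq hw.
have ss : - s <= s by lra.
have -> : (fun w => g w * (w - z1)^-1) =
    (fun w => (g w - g z1) * (w - z1)^-1 + g z1 * (w - z1)^-1).
  by apply/funext => w; ring.
have kc := edge_cont_ker h.
rewrite ointD//; last first.
  move=> w hw; apply: cdiff_cont; apply: cdiffM; first exact: cdiff_cst.
  by apply: cdiff_invB; exact: edge_neq hw.
rewrite ointZ// -[RHS]add0r; congr (_ + _).
have : cdiff_at g z1 by case: z1 h hx hy {ec kc} => x1 y1 h /= hx hy; apply: hg; lra.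
case=> q /(_ 1 ltr01)[r r0 hr].
case: z1 h hx hy {ec kc} hr => x1 y1 h /= hx hy hr.
apply: (@goursat_punctured R _ _ _ _ _ x1 y1 (cmod q + 1) r) => //; try lra.
  move=> x y hx' hy' ne; apply: cdiffM; last exact: cdiff_invB.
  by apply: cdiffB; [exact: hg|exact: cdiff_cst].
move=> w ne /hr; have wz : 0 < cmod (w - Complex x1 y1) by rewrite cmod_gt0 subr_eq0.
rewrite [_ + (w - _)]addrC subrK cmodM cmodV ler_pdivrMr// => h1.
set D := w - Complex x1 y1 in h1 wz *.
rewrite -[g w - _](subrK (q * D)); apply: le_trans (cmodD _ _) _.
by rewrite cmodM; lra.
Qed.

(* The Cauchy formulas at [z0] and at [0] for [f - f 0] are subtracted. *)
Lemma cauchy_lipschitz f z0 (M : R) : inner z0 ->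
  (forall x y, - s <= x <= s -> - s <= y <= s -> cdiff_at f (Complex x y)) ->
  (forall x y, - s <= x <= s -> - s <= y <= s -> cmod (f (Complex x y)) <= M) ->
  cmod (f z0 - f 0) <= 288 * M / s * cmod z0.
Proof.
have s0 := s_gt0.
move=> hz hf hM; pose g w := f w - f 0.
have i0 : inner 0 by rewrite /inner /= normr0; lra.
have ss : - s <= s by lra.
have M0 : 0 <= M by apply: le_trans (cmod_ge0 _) (hM 0 0 _ _); lra.
have hg x y : - s <= x <= s -> - s <= y <= s -> cdiff_at g (Complex x y).
  by move=> hx hy; apply: cdiffB; [exact: hf|exact: cdiff_cst].
have gM x y : - s <= x <= s -> - s <= y <= s -> cmod (g (Complex x y)) <= 2 * M.
  move=> hx hy; apply: le_trans (cmodB _ _) _; have := hM _ _ hx hy.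
  have : cmod (f 0) <= M by apply: (hM 0 0); lra.
  lra.
have ge z : edge (- s) s (- s) s z -> cdiff_at g z /\ cmod (g z) <= 2 * M.
  by case: z => x y /edge_rect => -[||h1 h2]; [lra|lra|split; [exact: hg|exact: gM]].
have e0 := cauchy_square i0 hg; have e1 := cauchy_square hz hg.
have kd z1 : inner z1 -> edge_cont (fun w => g w * (w - z1)^-1) (- s) s (- s) s.
  move=> h w hw; apply: cdiff_cont; apply: cdiffM; first by case: (ge w hw).
  by apply: cdiff_invB; exact: edge_neq hw.
have g0 : g 0 = 0 by rewrite /g subrr.
rewrite g0 mul0r in e0.
pose k w := g w * (w - z0)^-1 - g w * (w - 0)^-1.
have kN : edge_cont (fun w => -1 * (g w * (w - 0)^-1)) (- s) s (- s) s.
  move=> w hw; apply: cdiff_cont; apply: cdiffM; first exact: cdiff_cst.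
  apply: cdiffM; first by case: (ge w hw).
  by apply: cdiff_invB; exact: edge_neq hw.
have ek : oint k (- s) s (- s) s = g z0 * sqker z0.
  have -> : k = (fun w => g w * (w - z0)^-1 + -1 * (g w * (w - 0)^-1)).
    by apply/funext => w; rewrite /k mulN1r.
  rewrite ointD//; last exact: kd.
  by rewrite ointZ ?e0 ?e1 ?mulr0 ?addr0//; exact: kd.
have kc : edge_cont k (- s) s (- s) s.
  move=> w hw; have [gd _] := ge w hw; apply: cdiff_cont.
  by apply: cdiffB; apply: cdiffM => //; apply: cdiff_invB; exact: edge_neq hw.
(* The two kernels differ by z0 / ((w - z0) w), and on the edge |w - z0| >= s / 2 and |w| >= s. *)
have kb w : edge (- s) s (- s) s w -> cmod (k w) <= 4 * M * cmod z0 / s ^+ 2.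
  move=> hw; have [_ gw] := ge w hw; have [w1 w2] := edge_inner hz hw.
  have nw0 := edge_neq i0 hw; have nwz := edge_neq hz hw.
  have -> : k w = g w * (z0 * ((w - z0)^-1 * w^-1)).
    by rewrite /k subr0; field; rewrite nw0 subr_eq0 nwz.
  rewrite !cmodM !cmodV.
  have -> : 4 * M * cmod z0 / s ^+ 2 = 2 * M * (cmod z0 * ((s / 2)^-1 * s^-1)) by field; lra.
  have z00 := cmod_ge0 z0.
  apply: ler_pM => //; rewrite ?mulr_ge0 ?invr_ge0 ?cmod_ge0//.
  apply: ler_wpM2l => //; apply: ler_pM; rewrite ?invr_ge0 ?cmod_ge0//.
    by rewrite lef_pV2 ?posrE//; lra.
  by rewrite lef_pV2 ?posrE//; lra.
have := oint_bound ss ss kc kb; rewrite ek cmodM.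
have := sqker_lb hz; set K := cmod (sqker z0); set G := cmod (g z0) => hK hG.
have G0 : 0 <= G by exact: cmod_ge0.
(* 64 is the product of the 4 of [oint_bound], the 4 of [kb] and the half-perimeter 4 s; division by
   2 / 9 gives 288. *)
have : G * (2 / 9) <= 64 * M * cmod z0 / s.
  apply: le_trans (ler_wpM2l G0 hK) _; apply: le_trans hG _.
  by rewrite le_eqVlt; apply/orP; left; apply/eqP; field; lra.
have -> : 288 * M / s * cmod z0 = 9 / 2 * (64 * M * cmod z0 / s) by field; lra.
rewrite -/(g z0) -/G; lra.
Qed.

End CauchySquare.

(** * Holomorphic functions of several variables *)

Section SeveralVariables.
Variable R : realType.
Local Notation C := R[i].

Section Holomorphic.
Variable n : nat.
Implicit Types (z w h v : cvec R n) (f g : cvec R n -> C) (D : set (cvec R n)).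

Lemma addrBK_fun z w : (fun i => z i + (w i - z i)) = w.
Proof. by apply/funext => i; rewrite addrC subrK. Qed.

Lemma cmod_linear (a : cvec R n) h :
  cmod (\sum_i a i * h i) <= (\sum_i cmod (a i)) * cnorm h.
Proof.
apply: le_trans (cmod_sum _ _ _) _; rewrite mulr_suml; apply: ler_sum => i _.
by rewrite cmodM ler_wpM2l ?cmod_ge0 ?cmod_le_cnorm.
Qed.

Lemma holomorphic_continuous D f z : holomorphic_on D f -> D z ->
  forall e : R, 0 < e -> exists2 d : R, 0 < d &
    forall w, cball z d w -> cmod (f w - f z) <= e.
Proof.
move=> hf Dz e e0; have [a ha] := hf z Dz; have [d d0 hd] := ha 1 ltr01.
set A := \sum_i cmod (a i); have A0 : 0 <= A by apply: sumr_ge0 => i _; exact: cmod_ge0.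
have A1 : 0 < A + 1 by lra.
exists (Num.min d (e / (A + 1))); first by rewrite lt_min d0 divr_gt0.
move=> w; rewrite /cball /= lt_min ltr_pdivlMr// => /andP[h1 h2].
have := hd _ h1; rewrite addrBK_fun mul1r => h3.
rewrite -[f w - f z](subrK (\sum_i a i * (w i - z i))).
apply: le_trans (cmodD _ _) _.
have := cmod_linear a (fun i => w i - z i); rewrite -/A.
have := cnorm_ge0 (fun i => w i - z i); nra.
Qed.

Lemma holomorphic_sub D E f : E `<=` D -> holomorphic_on D f -> holomorphic_on E f.
Proof. by move=> ED hf z /ED; exact: hf. Qed.

Lemma holomorphicD D f g : holomorphic_on D f -> holomorphic_on D g ->
  holomorphic_on D (fun z => f z + g z).
Proof.
move=> hf hg z Dz; have [a ha] := hf z Dz; have [b hb] := hg z Dz.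
exists (fun i => a i + b i) => e e0; have e2 : 0 < e / 2 by lra.
have [r r0 hr] := ha _ e2; have [s s0 hs] := hb _ e2.
exists (Num.min r s); first by rewrite lt_min r0.
move=> h; rewrite lt_min => /andP[/hr A /hs B].
under eq_bigr do rewrite mulrDl; rewrite big_split /=.
set S := \sum_i a i * h i in A *; set T := \sum_i b i * h i in B *.
set p := f _ in A *; set q := g _ in B *.
have -> : p + q - (f z + g z) - (S + T) = (p - f z - S) + (q - g z - T) by ring.
apply: le_trans (cmodD _ _) _; lra.
Qed.

Lemma holomorphicZ D f (k : C) : holomorphic_on D f ->
  holomorphic_on D (fun z => k * f z).
Proof.
move=> hf z Dz; have [a ha] := hf z Dz; exists (fun i => k * a i) => e e0.
have k1 : 0 < cmod k + 1 by have := cmod_ge0 k; lra.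
have [r r0 hr] := ha _ (divr_gt0 e0 k1); exists r => // h /hr A.
under eq_bigr do rewrite -mulrA; rewrite -mulr_sumr -mulrBr -mulrBr cmodM.
apply: le_trans (ler_wpM2l (cmod_ge0 k) A) _.
rewrite mulrA ler_wpM2r ?cnorm_ge0// mulrCA ler_piMr ?(ltW e0)//.
by rewrite ler_pdivrMr// mul1r lerDl.
Qed.

Lemma holomorphicB D f g : holomorphic_on D f -> holomorphic_on D g ->
  holomorphic_on D (fun z => f z - g z).
Proof.
move=> hf /(holomorphicZ (-1)) hg.
have -> : (fun z => f z - g z) = (fun z => f z + -1 * g z).
  by apply/funext => z; rewrite mulN1r.
exact: holomorphicD.
Qed.

Lemma holomorphic_line D f z v (t : C) : holomorphic_on D f ->
  D (fun i => z i + t * v i) -> cdiff_at (fun t => f (fun i => z i + t * v i)) t.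
Proof.
move=> hf Dt; have [a ha] := hf _ Dt; exists (\sum_i a i * v i) => e e0.
have v1 : 0 < cnorm v + 1 by have := cnorm_ge0 v; lra.
have [r r0 hr] := ha _ (divr_gt0 e0 v1).
exists (r / (cnorm v + 1)); first by rewrite divr_gt0.
move=> h; rewrite ltr_pdivlMr// => hh.
have lt : cnorm (fun i => h * v i) < r.
  rewrite cnormZ; apply: le_lt_trans hh; apply: ler_wpM2l; first exact: cmod_ge0.
  by rewrite lerDl.
have := hr _ lt.
have -> : (fun i => z i + t * v i + h * v i) = (fun i => z i + (t + h) * v i).
  by apply/funext => i; rewrite mulrDl addrA.
have -> : \sum_i a i * (h * v i) = (\sum_i a i * v i) * h.
  by rewrite mulr_suml; apply: eq_bigr => i _; rewrite [h * _]mulrC mulrA.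
move=> h1; apply: le_trans h1 _; rewrite cnormZ.
have -> : e / (cnorm v + 1) * (cmod h * cnorm v) = e * cnorm v / (cnorm v + 1) * cmod h by ring.
apply: ler_wpM2r; first exact: cmod_ge0.
by rewrite ler_pdivrMr// ler_pM2l// lerDl.
Qed.

(** Reduction to one variable on the complex line through z in direction h. A unit direction sends
    the square of half-side s into the ball of radius 3 s, since |x| + |y| <= 2 s; and |h| <= s / 2
    makes the parameter [inner]. *)
Lemma holomorphic_lipschitz D f z (s M : R) : 0 < s -> holomorphic_on D f ->
  cball z (3 * s) `<=` D -> (forall w, cball z (3 * s) w -> cmod (f w) <= M) ->
  forall h, cnorm h <= s / 2 ->
    cmod (f (fun i => z i + h i) - f z) <= 288 * M / s * cnorm h.
Proof.
move=> s0 hf zD fM h hs.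
have M0 : 0 <= M by apply: le_trans (cmod_ge0 _) (fM z _); apply: cball_center; lra.
have [h0|hn0] := eqVneq (cnorm h) 0.
  have -> : (fun i => z i + h i) = z.
    apply/funext => i; suff -> : h i = 0 by rewrite addr0.
    apply: cmod0_eq0; apply/eqP; rewrite eq_le cmod_ge0 andbT -h0.
    exact: cmod_le_cnorm.
  by rewrite h0 subrr cmod0 mulr0.
have hp : 0 < cnorm h by rewrite lt_def hn0 cnorm_ge0.
pose v i := Complex (cnorm h)^-1 0 * h i.
have v1 : cnorm v = 1.
  by rewrite /v cnormZ cmod_real ger0_norm ?invr_ge0 ?cnorm_ge0// mulVf.
have vh : (fun i => z i + Complex (cnorm h) 0 * v i) = (fun i => z i + h i).
  apply/funext => i; rewrite /v mulrA.
  have -> : Complex (cnorm h) 0 * Complex (cnorm h)^-1 0 = 1 :> C.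
    by apply/eqP; rewrite eq_complex /= !mulr0 !mul0r subr0 addr0 mulfV// !eqxx.
  by rewrite mul1r.
have inb x y : - s <= x <= s -> - s <= y <= s ->
    cball z (3 * s) (fun i => z i + Complex x y * v i).
  move=> hx hy; rewrite /cball /=.
  have -> : (fun i => z i + Complex x y * v i - z i) = (fun i => Complex x y * v i).
    by apply/funext => i; rewrite addrAC subrr add0r.
  rewrite cnormZ v1 mulr1; apply: le_lt_trans (cmod_le_ReIm _) _ => /=.
  have : `|x| <= s by rewrite ler_norml.
  have : `|y| <= s by rewrite ler_norml.
  lra.
have := @cauchy_lipschitz R s s0 (fun t => f (fun i => z i + t * v i)) (Complex (cnorm h) 0) M.
rewrite vh.
have -> : (fun i => z i + 0 * v i) = z by apply/funext => i; rewrite mul0r addr0.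
rewrite cmod_real ger0_norm ?cnorm_ge0//; apply.
- by rewrite /inner /= normr0 ger0_norm ?cnorm_ge0//; split => //; lra.
- by move=> x y hx hy; apply: (holomorphic_line hf); apply: zD; exact: inb.
- by move=> x y hx hy; apply: fM; exact: inb.
Qed.

(** Test at t h with small real t and divide by t: the differentiability error becomes negligible.
    For differences of approximants it bounds the differences of their differentials. *)
Lemma linear_bound f z (a : cvec R n) (L r : R) : 0 < r ->
  (forall h, cnorm h < r -> cmod (f (fun i => z i + h i) - f z) <= L * cnorm h) ->
  (forall e : R, 0 < e -> exists2 d : R, 0 < d & forall h, cnorm h < d ->
      cmod (f (fun i => z i + h i) - f z - \sum_i a i * h i) <= e * cnorm h) ->
  forall h, cmod (\sum_i a i * h i) <= L * cnorm h.
Proof.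
move=> r0 hL ha h; apply/ler_addgt0Pr => e e0.
have h1 : 0 < cnorm h + 1 by have := cnorm_ge0 h; lra.
have [d d0 hd] := ha _ (divr_gt0 e0 h1).
pose t := Num.min r d / (cnorm h + 1) / 2.
have m0 : 0 < Num.min r d by rewrite lt_min r0.
have t0 : 0 < t by rewrite !divr_gt0.
have cth : cnorm (fun i => Complex t 0 * h i) = t * cnorm h.
  by rewrite cnormZ cmod_real ger0_norm ?(ltW t0).
have lt : t * cnorm h < Num.min r d.
  rewrite /t mulrAC ltr_pdivrMr// mulrAC ltr_pdivrMr//.
  have := cnorm_ge0 h; nra.
have := lt; rewrite lt_min -cth => /andP[/hL A /hd B].
have es : \sum_i a i * (Complex t 0 * h i) = Complex t 0 * \sum_i a i * h i.
  by rewrite mulr_sumr; apply: eq_bigr => i _; rewrite mulrCA.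
rewrite es cth in A B *.
set S := \sum_i _ in B *.
have : t * cmod S <= t * (L * cnorm h + e / (cnorm h + 1) * cnorm h).
  rewrite -{1}[t](ger0_norm (ltW t0)) -cmod_real -cmodM.
  set p := f _ in A B; have -> : Complex t 0 * S = (p - f z) - (p - f z - Complex t 0 * S) by ring.
  apply: le_trans (cmodB _ _) _; lra.
rewrite ler_pM2l// => h2; apply: le_trans h2 _; rewrite lerD2l.
rewrite mulrAC ler_pdivrMr// ler_wpM2l ?(ltW e0)// lerDl.
exact: ler01.
Qed.

Lemma linear_bound_coef (a : cvec R n) (L : R) :
  (forall h, cmod (\sum_i a i * h i) <= L * cnorm h) -> forall i, cmod (a i) <= L.
Proof.
move=> hL i; have := hL (fun j => (j == i)%:R).
have -> : \sum_j a j * (j == i)%:R = a i.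
  rewrite (bigD1 i)//= eqxx mulr1 big1 ?addr0// => j /negPf ->; exact: mulr0.
have -> : cnorm (fun j : 'I_n => (j == i)%:R : C) = 1.
  rewrite /cnorm (bigD1 i)//= eqxx cmod1 expr1n big1 ?addr0 ?sqrtr1// => j /negPf ->.
  by rewrite cmod0 expr0n.
by rewrite mulr1.
Qed.

End Holomorphic.

(** * Complex limits and Weierstrass' theorem *)

Section ComplexLimits.
Implicit Types (u : nat -> C) (a : C).

Definition clim u a := forall e : R, 0 < e ->
  exists K, forall k, (K <= k)%N -> cmod (u k - a) <= e.

Lemma real_cauchy (x : nat -> R) :
  (forall e : R, 0 < e -> exists K, forall k l, (K <= k)%N -> (K <= l)%N ->
     `|x k - x l| <= e) ->
  exists a : R, forall e : R, 0 < e -> exists K, forall k, (K <= k)%N -> `|x k - a| <= e.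
Proof.
move=> hx; have : cvgn x.
  apply/cauchy_cvgP/cauchy_exP => e e0.
  have e2 : 0 < e / 2 by lra.
  have [K hK] := hx _ e2.
  exists (x K); exists K => // k Kk /=; have := hK _ _ (leqnn K) Kk; rewrite /ball/=; lra.
move=> /cvgrPdist_le xa; exists (limn x) => e e0; have [K _ hK] := xa e e0.
by exists K => k /hK; rewrite distrC.
Qed.

Lemma complex_cauchy u :
  (forall e : R, 0 < e -> exists K, forall k l, (K <= k)%N -> (K <= l)%N ->
     cmod (u k - u l) <= e) ->
  exists a, clim u a.
Proof.
move=> hu.
have [a ha] : exists a : R, forall e : R, 0 < e -> exists K, forall k, (K <= k)%N ->
    `|complex.Re (u k) - a| <= e.
  apply: real_cauchy => e /hu[K hK]; exists K => k l Kk Kl.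
  apply: le_trans (hK _ _ Kk Kl); have := normr_Re_le (u k - u l).
  by case: (u k) (u l) => [? ?] [? ?].
have [b hb] : exists a : R, forall e : R, 0 < e -> exists K, forall k, (K <= k)%N ->
    `|complex.Im (u k) - a| <= e.
  apply: real_cauchy => e /hu[K hK]; exists K => k l Kk Kl.
  apply: le_trans (hK _ _ Kk Kl); have := normr_Im_le (u k - u l).
  by case: (u k) (u l) => [? ?] [? ?].
exists (Complex a b) => e e0; have e2 : 0 < e / 2 by lra.
have [K hK] := ha _ e2; have [K' hK'] := hb _ e2.
exists (maxn K K') => k; rewrite geq_max => /andP[/hK A /hK' B].
apply: le_trans (cmod_le_ReIm _) _; move: A B; case: (u k) => x y /=; lra.
Qed.

Lemma clim_dist_le u a (x : C) (e : R) K : clim u a ->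
  (forall k, (K <= k)%N -> cmod (x - u k) <= e) -> cmod (x - a) <= e.
Proof.
move=> ua hx; apply/ler_addgt0Pr => d /ua[N hN].
apply: le_trans (cmod_triang _ _ (u (maxn K N))) _.
by apply: lerD; [apply: hx; exact: leq_maxl|apply: hN; exact: leq_maxr].
Qed.

Lemma climB u v a b : clim u a -> clim v b -> clim (fun k => u k - v k) (a - b).
Proof.
move=> ua vb e e0; have e2 : 0 < e / 2 by lra.
have [K hK] := ua _ e2; have [N hN] := vb _ e2.
exists (maxn K N) => k; rewrite geq_max => /andP[/hK A /hN B].
have -> : u k - v k - (a - b) = (u k - a) - (v k - b) by ring.
apply: le_trans (cmodB _ _) _; lra.
Qed.

End ComplexLimits.

(** The Lipschitz estimate for g k - g l controls increments uniformly in late k and l and, through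
    [linear_bound], makes the differentials Cauchy. Their limit is the differential of G, by
    comparison with one late g k. *)
Theorem holomorphic_limit n (D : set (cvec R n)) (g : nat -> cvec R n -> C) G :
  copen D -> (forall k, holomorphic_on D (g k)) ->
  (forall z, D z -> exists2 r : R, 0 < r & forall e : R, 0 < e ->
     exists K, forall k, (K <= k)%N -> forall w, cball z r w -> cmod (g k w - G w) <= e) ->
  holomorphic_on D G.
Proof.
move=> oD hg hG z Dz.
have [r1 r10 r1D] := oD z Dz; have [r2 r20 hr2] := hG z Dz.
pose s := Num.min r1 r2 / 3.
have s0 : 0 < s by rewrite divr_gt0// lt_min r10.
have s3 : 3 * s = Num.min r1 r2 by rewrite /s; field.
have sD : cball z (3 * s) `<=` D.
  by move=> w; rewrite s3 /cball/= lt_min => /andP[+ _]; exact: r1D.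
have sr2 w : cball z (3 * s) w -> cball z r2 w.
  by rewrite s3 /cball/= lt_min => /andP[_].
have z3 : cball z (3 * s) z by apply: cball_center; lra.
(* 576 = 2 * 288, as g k - g l is at most 2 e on the ball. *)
pose c : R := 576 / s; have c0 : 0 < c by rewrite /c; apply: divr_gt0; [rewrite ltr0n|exact: s0].
have sub h : cnorm h <= s / 2 -> cball z (3 * s) (fun i => z i + h i).
  move=> hs; rewrite /cball/=.
  have -> : (fun i => z i + h i - z i) = h by apply/funext => i; rewrite addrAC subrr add0r.
  lra.
have lim w : cball z (3 * s) w -> clim (g^~ w) (G w).
  move=> /sr2 wr e /hr2[K hK]; exists K => k /hK; exact.
have Lip e : 0 < e -> exists K, forall k l, (K <= k)%N -> (K <= l)%N ->
    forall h, cnorm h <= s / 2 ->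
    cmod ((g k (fun i => z i + h i) - g l (fun i => z i + h i)) - (g k z - g l z))
      <= c * e * cnorm h.
  move=> e0; have [K hK] := hr2 e e0; exists K => k l Kk Kl h hs.
  have -> : c * e = 288 * (2 * e) / s by rewrite /c; field; lra.
  apply: (holomorphic_lipschitz (f := fun w => g k w - g l w) s0 _ sD) => //.
    exact: holomorphicB.
  move=> w /sr2 wr; have -> : g k w - g l w = (g k w - G w) - (g l w - G w) by ring.
  apply: le_trans (cmodB _ _) _; have := hK _ Kk _ wr; have := hK _ Kl _ wr; lra.
have [A hA] := choice (fun k => hg k z Dz).
have Acau e : 0 < e -> exists K, forall k l, (K <= k)%N -> (K <= l)%N ->
    forall i, cmod (A k i - A l i) <= c * e.
  move=> e0; have [K hK] := Lip e e0; exists K => k l Kk Kl.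
  apply: linear_bound_coef.
  apply: (@linear_bound n (fun w => g k w - g l w) z (fun i => A k i - A l i) _ (s / 2)).
  - by rewrite divr_gt0.
  - by move=> h /ltW hs; exact: hK.
  move=> e' e'0; have e2 : 0 < e' / 2 by lra.
  have [d1 d10 hd1] := hA k _ e2; have [d2 d20 hd2] := hA l _ e2.
  exists (Num.min d1 d2); first by rewrite lt_min d10.
  move=> h; rewrite lt_min => /andP[/hd1 X /hd2 Y].
  under eq_bigr do rewrite mulrBl; rewrite sumrB.
  set S := \sum_i A k i * h i in X *; set T := \sum_i A l i * h i in Y *.
  set p := g k _ in X *; set q := g l _ in Y *.
  have -> : p - q - (g k z - g l z) - (S - T) = (p - g k z - S) - (q - g l z - T) by ring.
  apply: le_trans (cmodB _ _) _; lra.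
have Alim i : exists x : C, clim (fun k => A k i) x.
  apply: complex_cauchy => e e0.
  have [K hK] := Acau _ (divr_gt0 e0 c0); exists K => k l Kk Kl.
  by have := hK _ _ Kk Kl i; rewrite mulrC divfK ?gt_eqF.
have [a ha] := choice Alim.
exists a => e e0.
pose N : R := n%:R.
have N0 : 0 <= N by exact: ler0n.
have N1 : 0 < c * (N + 2) by rewrite mulr_gt0//; lra.
(* Half of e goes to the differentiability of g k; the other half pays for the comparison of
   increments (c e') and for the n coefficients of the differential (n c e'). *)
pose e' := e / 2 / (c * (N + 2)).
have e'0 : 0 < e' by rewrite divr_gt0// divr_gt0.
have e'e : c * e' * (N + 2) = e / 2 by rewrite /e' mulrAC mulrC divfK ?gt_eqF.
have [K1 hK1] := Lip e' e'0; have [K2 hK2] := Acau e' e'0.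
pose k := maxn K1 K2.
have k1 : (K1 <= k)%N by exact: leq_maxl.
have k2 : (K2 <= k)%N by exact: leq_maxr.
have e2 : 0 < e / 2 by lra.
have [d d0 hd] := hA k _ e2.
exists (Num.min d (s / 2)); first by rewrite lt_min d0 divr_gt0.
move=> h; rewrite lt_min => /andP[/hd X hs].
have hs' := ltW hs.
set w := (fun i => z i + h i) in X *.
have Y : cmod ((g k w - g k z) - (G w - G z)) <= c * e' * cnorm h.
  apply: (@clim_dist_le (fun l => g l w - g l z) _ _ _ K1).
    by apply: climB; apply: lim => //; exact: sub.
  move=> l Kl; have -> : g k w - g k z - (g l w - g l z) = g k w - g l w - (g k z - g l z) by ring.
  exact: hK1.
have Z : cmod (\sum_i A k i * h i - \sum_i a i * h i) <= N * (c * e') * cnorm h.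
  rewrite -sumrB; under eq_bigr do rewrite -mulrBl.
  apply: le_trans (cmod_linear _ _) _; apply: ler_wpM2r; first exact: cnorm_ge0.
  apply: le_trans (ler_sum _ (G := fun=> c * e') _) _.
    move=> i _; apply: (@clim_dist_le (fun l => A l i) _ _ _ K2); first exact: ha.
    by move=> l Kl; exact: hK2.
  by rewrite sumr_const card_ord /N mulr_natl.
set S := \sum_i A k i * h i in X Z; set T := \sum_i a i * h i in Z *.
have -> : G w - G z - T = (g k w - g k z - S) - ((g k w - g k z) - (G w - G z)) + (S - T) by ring.
apply: le_trans (cmodD _ _) _; apply: le_trans (lerD (cmodB _ _) Z) _.
have : c * e' * (N + 2) * cnorm h = e / 2 * cnorm h by rewrite e'e.
have : 0 <= c * e' * cnorm h by rewrite mulr_ge0 ?cnorm_ge0// mulr_ge0// ltW.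
nra.
Qed.

(** * Cluster points and bounds away from the boundary *)

Section Compactness.
Variable n : nat.

(** Real and imaginary parts, listed as 2n real coordinates, stay in a compact cube. *)
Lemma cvec_cluster (u : nat -> cvec R n) (M : R) : (forall k, cnorm (u k) <= M) ->
  exists z, forall r : R, 0 < r -> forall N, exists2 k, (N <= k)%N & cball z r (u k).
Proof.
move=> uM.
pose U k : 'rV[R]_(n + n) := row_mx (\row_i complex.Re (u k i)) (\row_i complex.Im (u k i)).
have cK := @rV_compact R (n + n) (fun=> `[- M, M]%classic) (fun=> @segment_compact R (- M) M).
have UK k : [set v : 'rV[R]_(n + n) | forall i, `[- M, M]%classic (v ord0 i)] (U k).
  move=> i; rewrite /= in_itv /= -ler_norml /U.
  case: (split_ordP i) => j ->.
    rewrite row_mxEl mxE; apply: le_trans (normr_Re_le _) _.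
    exact: le_trans (cmod_le_cnorm _ _) (uM k).
  rewrite row_mxEr mxE; apply: le_trans (normr_Im_le _) _.
  exact: le_trans (cmod_le_cnorm _ _) (uM k).
have [p [_ hp]] := cK (U @ \oo) _ (filterE _ UK).
pose z : cvec R n := fun i => Complex (p ord0 (lshift n i)) (p ord0 (rshift n i)).
exists z => r r0 N.
(* Each of the n moduli is at most twice the coordinate bound, so r / (2 n + 1) yields a norm at
   most 2 n r / (2 n + 1) < r. *)
have n1 : 0 < 2 * n%:R + 1 :> R by have := ler0n R n; lra.
have e0 : 0 < r / (2 * n%:R + 1) by rewrite divr_gt0.
have [|v [[k Nk <-] kb]] := hp (U @` [set k | (N <= k)%N]) (ball p (r / (2 * n%:R + 1)))
  _ (nbhsx_ballx _ _ e0).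
  by exists N => // k Nk; exists k.
exists k => //; rewrite /cball/=; case: kb => _ kb.
have hb i : cmod (u k i - z i) <= 2 * (r / (2 * n%:R + 1)).
  apply: le_trans (cmod_le_ReIm _) _.
  have := kb ord0 (lshift n i); have := kb ord0 (rshift n i).
  rewrite /U row_mxEl row_mxEr !mxE /ball/= => /ltW A /ltW B.
  have -> : 2 * (r / (2 * n%:R + 1)) = r / (2 * n%:R + 1) + r / (2 * n%:R + 1) by ring.
  apply: lerD; first by rewrite distrC in B; move: B; case: (u k i).
  by rewrite distrC in A; move: A; case: (u k i).
apply: le_lt_trans (cnorm_le_sum _) _.
apply: le_lt_trans (ler_sum _ (fun i _ => hb i)) _.
rewrite sumr_const card_ord -[X in X < _]mulr_natr.
have -> : 2 * (r / (2 * n%:R + 1)) * n%:R = 2 * n%:R * r / (2 * n%:R + 1) by ring.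
by rewrite ltr_pdivrMr//; lra.
Qed.

(** The margin [eta] puts every cluster point of [K] inside [D], where continuity of f excludes
    values tending to infinity. *)
Lemma holomorphic_bounded (D K : set (cvec R n)) f (M eta : R) :
  0 < eta -> holomorphic_on D f -> (forall z, K z -> cnorm z <= M) ->
  (forall z, K z -> cball z eta `<=` D) ->
  exists A : R, 0 <= A /\ forall z, K z -> cmod (f z) <= A.
Proof.
move=> eta0 hf KM KD; apply: contrapT => nA.
have ex k : exists z, K z /\ k%:R < cmod (f z).
  apply: contrapT => hk; apply: nA; exists k%:R; split; first exact: ler0n.
  by move=> z Kz; rewrite leNgt; apply/negP => fz; apply: hk; exists z.
have [u hu] := choice ex.
have [z hz] := @cvec_cluster u M (fun k => KM _ (hu k).1).
have Dz : D z.
  have [k _ zk] := hz eta eta0 0%N; apply: (KD _ (hu k).1).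
  by rewrite /cball/= cnormBC.
have [d d0 hd] := holomorphic_continuous hf Dz ltr01.
pose N := Num.bound (cmod (f z) + 1).
have [k Nk /hd fk] := hz d d0 N.
have : cmod (f z) + 1 < N%:R by apply: archi_boundP; have := cmod_ge0 (f z); lra.
have : N%:R <= k%:R :> R by rewrite ler_nat.
have := (hu k).2; have := cmodD (f (u k) - f z) (f z); rewrite subrK; lra.
Qed.

End Compactness.

End SeveralVariables.

(** * Components and boundary points *)

Section Components.
Variables (R : realType) (n : nat).
Implicit Types (A B U V K : set (cvec R n)) (x y z p q w : cvec R n) (s t : R).

(** The exit time is the supremum of the times up to which P holds throughout; openness excludes P
    there. It serves both the connectedness of convex sets and the search for boundary points. *)
Lemma first_exit (P : R -> Prop) : P 0 ->
  (forall t, 0 <= t <= 1 -> P t -> exists2 d : R, 0 < d & forall s, `|s - t| < d -> P s) ->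
  ~ P 1 ->
  exists t, [/\ 0 < t <= 1, ~ P t & forall s, 0 <= s < t -> P s].
Proof.
move=> P0 Po P1.
pose S := [set t : R | 0 <= t <= 1 /\ forall s, 0 <= s <= t -> P s].
have S0 : S 0 by split; [lra|move=> s s0; have -> : s = 0 by lra].
have Sub : has_sup S by split; [exists 0|exists 1 => t [/andP[]]].
pose t := sup S.
have t0 : 0 <= t by exact: sup_upper_bound.
have t1 : t <= 1 by apply: ge_sup; [exists 0|move=> u [/andP[]]].
have below s : 0 <= s < t -> P s.
  move=> /andP[s0 st]; have e0 : 0 < t - s by lra.
  have [u [_ uP] ut] := sup_adherent e0 Sub; apply: uP; rewrite -/t in ut; lra.
have nPt : ~ P t.
  move=> Pt; have [|d d0 hd] := Po t _ Pt; first by rewrite t0.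
  have t'S : S (Num.min 1 (t + d / 2)).
    have h1 : Num.min 1 (t + d / 2) <= 1 by rewrite ge_min lexx.
    have h2 : Num.min 1 (t + d / 2) <= t + d / 2 by rewrite ge_min lexx orbT.
    split; first by rewrite h1 andbT le_min; lra.
    move=> s /andP[s0 sm]; have [st|ts] := ltP s t; first by apply: below; rewrite s0.
    by apply: hd; rewrite ger0_norm; lra.
  have h := sup_upper_bound Sub t'S; rewrite -/t in h.
  have [t1'|t1'] := ltP t 1; last by apply: P1; have <- : t = 1 by lra.
  by move: h; rewrite leNgt lt_min => /negP; apply; lra.
exists t; split => //; rewrite t1 andbT lt_neqAle t0 andbT.
by apply/negP => /eqP t00; apply: nPt; rewrite -t00.
Qed.

Definition segm p q t : cvec R n := fun i => p i + Complex t 0 * (q i - p i).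

Lemma segm0 p q : segm p q 0 = p.
Proof. by apply/funext => i; rewrite /segm mul0r addr0. Qed.

Lemma segm1 p q : segm p q 1 = q.
Proof. by apply/funext => i; rewrite /segm mul1r addrC subrK. Qed.

Lemma segm_dist p q s t :
  cnorm (fun i => segm p q s i - segm p q t i) = `|s - t| * cnorm (fun i => q i - p i).
Proof.
rewrite -cmod_real -cnormZ; congr cnorm; apply/funext => i; rewrite /segm.
have -> : Complex (s - t) 0 = Complex s 0 - Complex t 0.
  by apply/eqP; rewrite eq_complex /= subr0 !eqxx.
ring.
Qed.

Lemma segm_segm p q a b t : segm (segm p q a) (segm p q b) t = segm p q (a + t * (b - a)).
Proof.
apply/funext => i; rewrite /segm.
have -> : Complex (a + t * (b - a)) 0 =
    Complex a 0 + Complex t 0 * (Complex b 0 - Complex a 0).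
  by apply/eqP; rewrite eq_complex /=; apply/andP; split; apply/eqP; ring.
ring.
Qed.

Definition cconvex A := forall p q, A p -> A q -> forall t, 0 <= t <= 1 -> A (segm p q t).

Lemma segm_near p q U t : copen U -> U (segm p q t) ->
  exists2 d : R, 0 < d & forall s, `|s - t| < d -> U (segm p q s).
Proof.
move=> oU /oU[r r0 rU]; set L := cnorm (fun i => q i - p i).
have L1 : 0 < L + 1 by have := cnorm_ge0 (fun i => q i - p i); rewrite -/L; lra.
exists (r / (L + 1)); first by rewrite divr_gt0.
move=> s; rewrite ltr_pdivlMr// => h; apply: rU; rewrite /cball/= segm_dist -/L.
by apply: le_lt_trans h; rewrite ler_wpM2l// lerDl.
Qed.

Lemma cconvex_cball z (r : R) : cconvex (cball z r).
Proof.
move=> p q hp hq t ht; rewrite /cball/=.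
have -> : (fun i => segm p q t i - z i) =
    (fun i => Complex (1 - t) 0 * (p i - z i) + Complex t 0 * (q i - z i)).
  apply/funext => i; rewrite /segm.
  have -> : Complex (1 - t) 0 = 1 - Complex t 0 :> R[i].
    by apply/eqP; rewrite eq_complex /= subr0 !eqxx.
  ring.
apply: le_lt_trans (cnormD _ _) _; rewrite !cnormZ !cmod_real.
rewrite !ger0_norm; try lra.
move: hp hq; rewrite /cball/=; set P := cnorm _; set Q := cnorm _ => hp hq.
have m0 : Num.max P Q < r by rewrite gt_max hp.
have mP : 0 <= (1 - t) * (Num.max P Q - P).
  by apply: mulr_ge0; [lra|rewrite subr_ge0 le_max lexx].
have mQ : 0 <= t * (Num.max P Q - Q).
  by apply: mulr_ge0; [lra|rewrite subr_ge0 le_max lexx orbT].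
lra.
Qed.

(** On a segment from U to V the first point outside U lies in V; as V is open it also contains
    slightly earlier points, which are in U. *)
Lemma cconnected_convex A : cconvex A -> cconnected A.
Proof.
move=> cA U V oU oV AUV UV0; apply: contrapT => hn.
have [p [Ap Up]] : exists p, A p /\ U p.
  apply: contrapT => h; apply: hn; left; apply/seteqP; split => // p [Ap Up].
  by apply: h; exists p.
have [q [Aq Vq]] : exists q, A q /\ V q.
  apply: contrapT => h; apply: hn; right; apply/seteqP; split => // q [Aq Vq].
  by apply: h; exists q.
have no z : A z -> U z -> V z -> False.
  by move=> Az Uz Vz; have : (A `&` U `&` V) z by []; rewrite UV0.
have [|||t [/andP[t0 t1] nUt Ubelow]] := @first_exit (fun t => U (segm p q t)).
- by rewrite segm0.
- by move=> t _; exact: segm_near.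
- by rewrite segm1 => Uq; exact: no Aq Uq Vq.
have At s : 0 <= s <= 1 -> A (segm p q s) by exact: cA.
have Vt : V (segm p q t) by have [|//|//] := AUV (segm p q t); apply: At; lra.
have [d d0 hd] := segm_near oV Vt.
pose s := Num.max 0 (t - d / 2).
have s0 : 0 <= s by rewrite le_max lexx.
have s1 : t - d / 2 <= s by rewrite le_max lexx orbT.
have st : s < t by rewrite gt_max t0; lra.
apply: (no (segm p q s)); first by apply: At; lra.
  by apply: Ubelow; rewrite s0.
by apply: hd; rewrite ltr0_norm; lra.
Qed.

Lemma cconnectedU A B x : cconnected A -> cconnected B -> A x -> B x ->
  cconnected (A `|` B).
Proof.
move=> cA cB Ax Bx U V oU oV AB UV0.
have ne (P Q S : set (cvec R n)) : P `&` Q `&` S = set0 -> forall y, P y -> Q y -> S y -> False.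
  by move=> h y Py Qy Sy; have : (P `&` Q `&` S) y by []; rewrite h.
have no := ne _ _ _ UV0.
have sA : A `<=` U `|` V by move=> y Ay; apply: AB; left.
have sB : B `<=` U `|` V by move=> y By; apply: AB; right.
have eA : A `&` U `&` V = set0.
  by apply/seteqP; split => // y [[Ay Uy] Vy]; apply: (no y) => //; left.
have eB : B `&` U `&` V = set0.
  by apply/seteqP; split => // y [[By Uy] Vy]; apply: (no y) => //; right.
have bad P Q : P `&` Q = set0 -> forall y, P y -> Q y -> False.
  by move=> h y Py Qy; have : (P `&` Q) y by []; rewrite h.
have [hA|hA] := cA U V oU oV sA eA; have [hB|hB] := cB U V oU oV sB eB.
- by left; rewrite setIUl hA hB setU0.
- by have [/(bad _ _ hA _ Ax)|/(bad _ _ hB _ Bx)] := sA x Ax.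
- by have [/(bad _ _ hB _ Bx)|/(bad _ _ hA _ Ax)] := sA x Ax.
- by right; rewrite setIUl hA hB setU0.
Qed.

Lemma ccomponent_sub A x : ccomponent A x `<=` A.
Proof. by move=> y [K [KA _ _ Ky]]; exact: KA. Qed.

Lemma ccomponent_mono A B x : A `<=` B -> ccomponent A x `<=` ccomponent B x.
Proof. by move=> AB y [K [KA cK Kx Ky]]; exists K; split => //; apply: subset_trans AB. Qed.

Lemma ccomponent_add A x y B : ccomponent A x y -> cconnected B -> B `<=` A -> B y ->
  B `<=` ccomponent A x.
Proof.
move=> [K [KA cK Kx Ky]] cB BA By z Bz; exists (K `|` B); split.
- by move=> w [/KA|/BA].
- exact: cconnectedU Ky By.
- by left.
- by right.
Qed.

Lemma ccomponent_trans A x y : ccomponent A x y -> ccomponent A y `<=` ccomponent A x.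
Proof.
move=> xy z [K [KA cK Ky Kz]]; exact: (ccomponent_add xy cK KA Ky).
Qed.

Lemma ccomponent_refl A x : A x -> ccomponent A x x.
Proof.
move=> Ax; exists [set x]; split => //; first by move=> y ->.
apply: cconnected_convex => p q -> -> t _.
by apply/funext => i; rewrite /segm subrr mulr0 addr0.
Qed.

Lemma ccomponent_cball A x y (r : R) : 0 < r -> ccomponent A x y -> cball y r `<=` A ->
  cball y r `<=` ccomponent A x.
Proof.
move=> r0 xy yA; apply: (ccomponent_add xy) => //; last exact: cball_center.
exact/cconnected_convex/cconvex_cball.
Qed.

Lemma cboundary_notin D w : copen D -> cboundary D w -> ~ D w.
Proof.
move=> oD bw Dw; have [r r0 rD] := oD w Dw.
by have [_ [z [/rD Dz nDz]]] := bw r r0.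
Qed.

(* [zeta] is the first point outside [D] on the segment from [x] to [w]. *)
Lemma component_boundary D B x w : copen D -> cconvex B -> B x -> D x -> B w -> ~ D w ->
  exists zeta, cboundary D zeta /\
    forall d : R, 0 < d -> exists2 z, ccomponent (B `&` D) x z & cball zeta d z.
Proof.
move=> oD cB Bx Dx Bw nDw.
have [|||t [/andP[t0 t1] nDt Dbelow]] := @first_exit (fun t => D (segm x w t)).
- by rewrite segm0.
- by move=> t _; exact: segm_near.
- by rewrite segm1.
have near d : 0 < d -> exists2 z, ccomponent (B `&` D) x z & cball (segm x w t) d z.
  move=> d0; set L := cnorm (fun i => w i - x i).
  have L0 : 0 <= L by exact: cnorm_ge0.
  have L1 : 0 < L + 1 by lra.
  pose s := Num.max 0 (t - d / (L + 1) / 2).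
  have dL : 0 < d / (L + 1) by rewrite divr_gt0.
  have s0 : 0 <= s by rewrite le_max lexx.
  have s1 : t - d / (L + 1) / 2 <= s by rewrite le_max lexx orbT.
  have st : s < t by rewrite gt_max t0; lra.
  exists (segm x w s); last first.
    rewrite /cball/= segm_dist -/L ltr0_norm ?subr_lt0// opprB.
    have : (t - s) * (L + 1) < d by rewrite -ltr_pdivlMr//; lra.
    nra.
  exists [set y | exists2 u, 0 <= u < t & y = segm x w u]; split.
  - move=> _ [u /andP[u0 ut] ->]; split; last by apply: Dbelow; rewrite u0.
    by apply: cB => //; lra.
  - apply: cconnected_convex => _ _ [a ha ->] [b hb ->] u hu.
    exists (a + u * (b - a)); last exact: segm_segm.
    move: ha hb hu => /andP[a0 at_] /andP[b0 bt] /andP[u0 u1].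
    have m0 : Num.max a b < t by rewrite gt_max at_.
    have u1' : 0 <= 1 - u by lra.
    have ma : 0 <= (1 - u) * (Num.max a b - a).
      by apply: mulr_ge0 => //; rewrite subr_ge0 le_max lexx.
    have mb : 0 <= u * (Num.max a b - b).
      by apply: mulr_ge0 => //; rewrite subr_ge0 le_max lexx orbT.
    have pa : 0 <= (1 - u) * a by exact: mulr_ge0.
    have pb : 0 <= u * b by exact: mulr_ge0.
    lra.
  - by exists 0; [lra|rewrite segm0].
  - by exists s => //; rewrite s0.
exists (segm x w t); split=> // r r0; split.
  by have [z /ccomponent_sub[_ Dz] zr] := near r r0; exists z.
by exists (segm x w t); split => //; exact: cball_center.
Qed.

End Components.

(** * Integrals of powers of the modulus *)

Section LpIntegrals.
Variables (R : realType) (n : nat).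
Local Notation C := R[i].
Implicit Types (D E : set (cvec R n)) (f g h : cvec R n -> C) (phi psi chi : R -> R).

Definition cont_on D f := forall z, D z -> forall e : R, 0 < e ->
  exists2 d : R, 0 < d & forall w, cball z d w -> cmod (f w - f z) <= e.

(** As y is not bounded above, this combines monotonicity on [0, oo) with left continuity: a lower
    bound on |f| is enough to keep phi(|f|) large. *)
Definition left_lsc phi := forall x, 0 <= x -> forall a, a < phi x ->
  exists2 d, 0 < d & forall y, 0 <= y -> x - d < y -> a < phi y.

Definition ind D f phi : cvec R n -> \bar R :=
  fun z => if `[< D z >] then (phi (cmod (f z)))%:E else 0%E.

Lemma ind_ge0 D f phi : (forall x, 0 <= phi x) -> forall z, (0 <= ind D f phi z)%E.
Proof. by move=> phi0 z; rewrite /ind; case: ifP => // _; rewrite lee_fin. Qed.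

Lemma ind_in D f phi z : D z -> ind D f phi z = (phi (cmod (f z)))%:E.
Proof. by move=> Dz; rewrite /ind asboolT. Qed.

Lemma ind_notin D f phi z : ~ D z -> ind D f phi z = 0%E.
Proof. by move=> Dz; rewrite /ind asboolF. Qed.

(** Near a point of the open set D one stays in D; at other points the value is 0, the least
    possible, so jumps at the boundary go the right way. *)
Lemma ind_lsc D f phi : copen D -> cont_on D f -> (forall x, 0 <= phi x) ->
  left_lsc phi -> vlsc (ind D f phi).
Proof.
move=> oD cf phi0 lphi u z uz; apply: le_limn_einf => a.
have [Dz|nDz] := pselect (D z); last first.
  rewrite ind_notin// => a0; exists 0%N => k _.
  exact: le_trans (ltW a0) (ind_ge0 _ _ phi0 _).
rewrite ind_in// lte_fin => ha.
have [d d0 hd] := lphi _ (cmod_ge0 _) a ha.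
have [r r0 rD] := oD z Dz.
have [s s0 hs] := cf z Dz (d / 2) (divr_gt0 d0 (ltr0n _ 2)).
have [N1 hN1] := uz r r0; have [N2 hN2] := uz s s0.
exists (maxn N1 N2) => k; rewrite geq_max => /andP[/hN1/rD Dk /hN2/hs fk].
rewrite ind_in// lee_fin ltW// hd ?cmod_ge0//.
have := cmod_lb (f z) (f (u k) - f z); rewrite [f z + _]addrC subrK; lra.
Qed.

Lemma left_lsc_powR (p : R) : 0 < p -> left_lsc (fun x => x `^ p).
Proof.
move=> p0 x x0 a ha; have [a0|a0] := ltP a 0.
  by exists 1 => // y _ _; exact: lt_le_trans a0 (powR_ge0 _ _).
have e : (a `^ p^-1) `^ p = a by rewrite -powRrM mulVf ?gt_eqF// powRr1.
have bx : a `^ p^-1 < x.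
  rewrite ltNge; apply/negP => h; move: ha; rewrite -e ltNge => /negP; apply.
  by apply: ge0_ler_powR; rewrite ?nnegrE ?powR_ge0// ltW.
exists (x - a `^ p^-1); first by rewrite subr_gt0.
move=> y y0; rewrite subKr => ay; rewrite -e.
by apply: gt0_ltr_powR; rewrite ?nnegrE ?powR_ge0.
Qed.

Lemma left_lsc_cst (c : R) : left_lsc (fun=> c).
Proof. by move=> x _ a ac; exists 1. Qed.

(* The functions [trunc N eta x `^ q] increase to [x `^ q] as [N] grows and
   [eta] decreases to 0; unlike it they satisfy [trunc_powR_le], which makes the
   L^q condition open for a weaker distance. *)
Definition trunc (N eta : R) (x : R) : R := Num.max (Num.min x N - eta) 0.

Lemma trunc_ge0 N eta x : 0 <= trunc N eta x.
Proof. by rewrite le_max lexx orbT. Qed.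

Lemma trunc_mono N eta x y : trunc N eta x <= trunc N eta y + Num.max (x - y) 0.
Proof. rewrite /trunc /Num.max /Num.min; repeat case: ifPn; rewrite -?leNgt; lra. Qed.

Lemma left_lsc_trunc N eta (p : R) : 0 < p -> left_lsc (fun x => trunc N eta x `^ p).
Proof.
move=> p0 x x0 a ha.
have [d d0 hd] := left_lsc_powR p0 (trunc_ge0 N eta x) ha.
exists d => // y y0 xy; apply: hd; first exact: trunc_ge0.
have := trunc_mono N eta x y.
have : Num.max (x - y) 0 < d by rewrite gt_max d0 andbT; lra.
lra.
Qed.

(** Three functions with three weights, so that one comparison covers sums, changes of exponent and
    perturbed truncations. *)
Lemma volint_ind_le2 D f g h phi psi chi (c1 c2 : R) : copen D ->
  cont_on D f -> cont_on D g -> cont_on D h ->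
  (forall x, 0 <= phi x) -> (forall x, 0 <= psi x) -> (forall x, 0 <= chi x) ->
  left_lsc phi -> left_lsc psi -> left_lsc chi -> 0 <= c1 -> 0 <= c2 ->
  (forall z, D z -> phi (cmod (f z)) <= c1 * psi (cmod (g z)) + c2 * chi (cmod (h z))) ->
  (volint (ind D f phi) <=
     c1%:E * volint (ind D g psi) + c2%:E * volint (ind D h chi))%E.
Proof.
move=> oD cf cg ch phi0 psi0 chi0 lphi lpsi lchi c10 c20 H.
have G0 z : (0 <= c1%:E * ind D g psi z)%E by rewrite mule_ge0 ?lee_fin// ind_ge0.
have H0 z : (0 <= c2%:E * ind D h chi z)%E by rewrite mule_ge0 ?lee_fin// ind_ge0.
have Gl : vlsc (fun z => c1%:E * ind D g psi z)%E.
  by apply: vlscZ => //; [exact: ind_ge0|exact: ind_lsc].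
have Hl : vlsc (fun z => c2%:E * ind D h chi z)%E.
  by apply: vlscZ => //; [exact: ind_ge0|exact: ind_lsc].
have Fl : vlsc (ind D f phi) by exact: ind_lsc.
rewrite -!volintZ//; [|exact: ind_ge0|exact: ind_lsc|exact: ind_ge0|exact: ind_lsc].
rewrite -volintD//; apply: le_volint => //.
- exact: ind_ge0.
- exact: vlscD.
- move=> z; have [Dz|nDz] := pselect (D z); last by rewrite !ind_notin// !mule0 adde0.
  by rewrite !ind_in// lee_fin; exact: H.
Qed.

Lemma volint_ind_mono D E f phi psi : copen D -> copen E -> D `<=` E ->
  cont_on E f -> (forall x, 0 <= phi x) -> (forall x, 0 <= psi x) ->
  left_lsc phi -> left_lsc psi -> (forall x, 0 <= x -> phi x <= psi x) ->
  (volint (ind D f phi) <= volint (ind E f psi))%E.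
Proof.
move=> oD oE DE cf phi0 psi0 lphi lpsi pp.
apply: le_volint.
- exact: ind_ge0.
- by apply: ind_lsc => // z /DE; exact: cf.
- exact: ind_lsc.
- move=> z; have [Dz|nDz] := pselect (D z); last by rewrite ind_notin// ind_ge0.
  by rewrite !ind_in//; [rewrite lee_fin pp ?cmod_ge0|exact: DE].
Qed.

Lemma volint_ind_cst D (M : R) : copen D -> cbounded D -> 0 <= M ->
  (volint (ind D (fun=> 0%R) (fun=> M)) < +oo)%E.
Proof.
move=> oD [B hB] M0.
have s0 : 0 < `|B| + 1 by rewrite ltr_wpDl.
have c0 : cont_on D (fun=> 0) by move=> z _ e e0; exists 1 => // w _; rewrite subrr cmod0 ltW.
apply: le_lt_trans (volint_box_ub (w := fun=> 0) s0 M0 _ _ _ _) (ltry _).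
- exact: ind_ge0.
- by apply: ind_lsc => //; exact: left_lsc_cst.
- by move=> z _; rewrite /ind; case: ifP => //; rewrite lee_fin.
- move=> z nz; rewrite ind_notin// => Dz; apply: nz => i; rewrite subr0.
  have zB : cmod (z i) < `|B| + 1.
    have := cmod_le_cnorm z i; have := hB z Dz; have := ler_norm B; lra.
  by split; [exact: le_lt_trans (normr_Re_le _) zB|exact: le_lt_trans (normr_Im_le _) zB].
Qed.

Lemma Lpint_ind D (p : R) f : Lpint D p f = volint (ind D f (fun x => x `^ p)).
Proof. by []. Qed.

Lemma Lpint_ge0 D (p : R) f : (0 <= Lpint D p f)%E.
Proof. by rewrite Lpint_ind; apply: volint_ge0; apply: ind_ge0 => x; exact: powR_ge0. Qed.

Lemma Lpint_sub D E (p : R) f : 0 < p -> copen D -> copen E -> D `<=` E -> cont_on E f ->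
  (Lpint D p f <= Lpint E p f)%E.
Proof.
move=> p0 oD oE DE cf; rewrite !Lpint_ind; apply: volint_ind_mono => //;
  by [move=> x; exact: powR_ge0|exact: left_lsc_powR].
Qed.

Lemma Lpint_le2 D (p : R) f g h (c1 c2 : R) : 0 < p -> copen D ->
  cont_on D f -> cont_on D g -> cont_on D h -> 0 <= c1 -> 0 <= c2 ->
  (forall z, D z -> cmod (f z) `^ p <= c1 * cmod (g z) `^ p + c2 * cmod (h z) `^ p) ->
  (Lpint D p f <= c1%:E * Lpint D p g + c2%:E * Lpint D p h)%E.
Proof.
move=> p0 oD cf cg ch c10 c20 H; rewrite !Lpint_ind; apply: volint_ind_le2 => //;
  by [move=> x; exact: powR_ge0|exact: left_lsc_powR].
Qed.

Lemma powR_max (p x y : R) : 0 <= p -> 0 <= x -> 0 <= y ->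
  (x + y) `^ p <= 2 `^ p * x `^ p + 2 `^ p * y `^ p.
Proof.
move=> p0 x0 y0; rewrite -!powRM//.
have mono a b : 0 <= a -> a <= b -> a `^ p <= b `^ p.
  by move=> a0 ab; apply: ge0_ler_powR; rewrite ?nnegrE// (le_trans a0).
have [xy|/ltW yx] := leP x y.
  by apply: ler_wpDl; [exact: powR_ge0|apply: mono; lra].
by apply: ler_wpDr; [exact: powR_ge0|apply: mono; lra].
Qed.

Lemma Lpint_add_fin D (p : R) f g h : 0 < p -> copen D ->
  cont_on D f -> cont_on D g -> cont_on D h ->
  (forall z, D z -> cmod (f z) <= cmod (g z) + cmod (h z)) ->
  (Lpint D p g < +oo)%E -> (Lpint D p h < +oo)%E -> (Lpint D p f < +oo)%E.
Proof.
move=> p0 oD cf cg ch H gf hf.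
apply: le_lt_trans (Lpint_le2 (c1 := 2 `^ p) (c2 := 2 `^ p) p0 oD cf cg ch _ _ _) _.
- exact: powR_ge0.
- exact: powR_ge0.
- move=> z /H fgh; apply: le_trans (powR_max (ltW p0) (cmod_ge0 _) (cmod_ge0 _)).
  by apply: ge0_ler_powR; rewrite ?nnegrE ?addr_ge0 ?cmod_ge0// ltW.
by apply: lte_add_pinfty; apply: lte_mul_pinfty => //; rewrite ?lee_fin ?powR_ge0.
Qed.

Lemma LpintZ D (p : R) f (k : C) : 0 < p -> copen D -> cont_on D f ->
  Lpint D p (fun z => k * f z) = ((cmod k `^ p)%:E * Lpint D p f)%E.
Proof.
move=> p0 oD cf; rewrite !Lpint_ind -volintZ ?powR_ge0//; first last.
- by apply: ind_lsc => //; [move=> x; exact: powR_ge0|exact: left_lsc_powR].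
- by apply: ind_ge0 => x; exact: powR_ge0.
congr volint; apply/funext => z.
have [Dz|nDz] := pselect (D z); last by rewrite !ind_notin// mule0.
by rewrite !ind_in// cmodM powRM ?cmod_ge0.
Qed.

(** x^p <= x^r + 1 replaces Hölder's inequality; a bounded set has finite volume. *)
Lemma Lpint_exponent D (p r : R) f : 0 < p -> p <= r -> copen D -> cbounded D ->
  cont_on D f -> (Lpint D r f < +oo)%E -> (Lpint D p f < +oo)%E.
Proof.
move=> p0 pr oD bD cf fr; have r0 : 0 < r by lra.
have c0 : cont_on D (fun=> 0) by move=> z _ e e0; exists 1 => // w _; rewrite subrr cmod0 ltW.
have := @volint_ind_le2 D f f (fun=> 0) (fun x => x `^ p) (fun x => x `^ r) (fun=> 1) 1 1.
rewrite !mul1e => H; apply: le_lt_trans (H _ _ _ _ _ _ _ _ _ _ _ _ _) _ => //;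
  try by [move=> x; exact: powR_ge0|exact: left_lsc_powR|exact: left_lsc_cst].
  move=> z _; rewrite !mul1r; set x := cmod (f z).
  have x0 : 0 <= x by exact: cmod_ge0.
  have [x1|x1] := leP x 1.
    apply: ler_wpDl; first exact: powR_ge0.
    have <- : 1 `^ p = 1 by rewrite powR1.
    by apply: ge0_ler_powR; rewrite ?nnegrE//; exact: ltW.
  by apply: ler_wpDr => //; apply: ler_powR => //; exact: ltW.
by apply: lte_add_pinfty => //; exact: volint_ind_cst.
Qed.

(** A Chebyshev bound over the cube of half-side r / (2 n + 1), which lies in the ball. *)
Lemma Lpint_lb D (p : R) f z (r c : R) : 0 < p -> 0 < r -> 0 <= c -> copen D -> cont_on D f ->
  cball z r `<=` D -> (forall w, cball z r w -> c <= cmod (f w)) ->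
  ((c `^ p * ((2 * (r / (2 * n%:R + 1))) ^+ 2) ^+ n)%:E <= Lpint D p f)%E.
Proof.
move=> p0 r0 c0 oD cf zD H.
have n1 : 0 < 2 * n%:R + 1 :> R by have := ler0n R n; lra.
have s0 : 0 < r / (2 * n%:R + 1) by rewrite divr_gt0.
rewrite Lpint_ind; apply: (volint_box_lb (w := z)) => //.
- exact: powR_ge0.
- by apply: ind_ge0 => x; exact: powR_ge0.
- by apply: ind_lsc => //; [move=> x; exact: powR_ge0|exact: left_lsc_powR].
move=> w wz; have wr : cball z r w.
  rewrite /cball/=.
  have hb i : cmod (w i - z i) <= r / (2 * n%:R + 1) + r / (2 * n%:R + 1).
    by apply: le_trans (cmod_le_ReIm _) _; have [/ltW ? /ltW ?] := wz i; exact: lerD.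
  apply: le_lt_trans (cnorm_le_sum _) _.
  apply: le_lt_trans (ler_sum _ (fun i _ => hb i)) _.
  rewrite sumr_const card_ord -[X in X < _]mulr_natr.
  have -> : (r / (2 * n%:R + 1) + r / (2 * n%:R + 1)) * n%:R = 2 * n%:R * r / (2 * n%:R + 1) by ring.
  by rewrite ltr_pdivrMr//; lra.
rewrite ind_in; last exact: zD.
rewrite lee_fin; apply: ge0_ler_powR; rewrite ?nnegrE ?cmod_ge0//; [exact: ltW|exact: H].
Qed.

End LpIntegrals.

(** * The residual construction *)

Section WeightedSums.
Variable R : realType.
Implicit Types (N b : nat -> R).

Lemma half_expS (k : nat) : (2 : R) ^- k = 2 ^- k.+1 + 2 ^- k.+1.
Proof.
have h : (2 : R) ^+ k != 0 by rewrite expf_neq0.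
by rewrite exprS invfM; field.
Qed.

Lemma half_exp_gt0 (k : nat) : 0 < (2 : R) ^- k.
Proof. by rewrite invr_gt0 exprn_gt0. Qed.

Lemma half_exp_small (e : R) : 0 < e -> exists K, forall k, (K <= k)%N -> (2 : R) ^- k <= e.
Proof.
move=> e0; exists (Num.bound e^-1) => k hk.
rewrite -[e]invrK lef_pV2 ?posrE ?invr_gt0 ?exprn_gt0//.
apply: ltW; apply: lt_le_trans (archi_boundP _) _; first by rewrite invr_ge0 ltW.
apply: le_trans (_ : k%:R <= _); first by rewrite ler_nat.
by rewrite -natrX ler_nat ltnW// ltn_expl.
Qed.

Definition wsum N (M : nat) : R := \sum_(j < M) (2%:R ^- j.+1) * (N j / (1 + N j)).

Section Bounds.
Variable N : nat -> R.
Hypothesis N0 : forall j, 0 <= N j.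

Lemma wterm_ge0 j : 0 <= N j / (1 + N j).
Proof. by rewrite divr_ge0// addr_ge0. Qed.

Lemma wterm_le1 j : N j / (1 + N j) <= 1.
Proof.
have := N0 j => h; rewrite ler_pdivrMr ?mul1r ?lerDr//; lra.
Qed.

Lemma wterm_le j : N j / (1 + N j) <= N j.
Proof. have h := N0 j; rewrite ler_pdivrMr; [nra|lra]. Qed.

Lemma wsum_nd : nondecreasing_seq (wsum N).
Proof.
apply/nondecreasing_seqP => M; rewrite /wsum big_ord_recr /= lerDl.
by rewrite mulr_ge0 ?wterm_ge0// ltW// half_exp_gt0.
Qed.

(** The first J weights sum to less than 1, which gives eta; every fraction is at most 1, so the
    later terms add at most 2^-J. *)
Lemma wsum_le J (eta : R) : (forall j, (j < J)%N -> N j <= eta) -> 0 <= eta ->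
  forall M, wsum N M <= eta + 2 ^- J.
Proof.
move=> hN eta0.
have small M : (M <= J)%N -> wsum N M <= eta * (1 - 2 ^- M).
  elim: M => [|M IH] MJ; first by rewrite /wsum big_ord0 expr0 invr1 subrr mulr0.
  rewrite /wsum big_ord_recr /= -/(wsum N M).
  have h1 := IH (ltnW MJ); have h2 := le_trans (wterm_le M) (hN _ MJ).
  have := ler_wpM2l (ltW (half_exp_gt0 M.+1)) h2; rewrite (half_expS M) in h1; lra.
have large K : wsum N (J + K) <= eta + 2 ^- J - 2 ^- (J + K).
  elim: K => [|K IH].
    by rewrite addn0; have := small J (leqnn J); have := half_exp_gt0 J; nra.
  rewrite addnS /wsum big_ord_recr /= -/(wsum N (J + K)).
  have := ler_wpM2l (ltW (half_exp_gt0 (J + K).+1)) (wterm_le1 (J + K)).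
  move: IH; rewrite [(2 : R) ^- (J + K)]half_expS; lra.
move=> M; apply: le_trans (wsum_nd (leq_addl J M)) _.
by apply: le_trans (large M) _; rewrite gerBl ltW// half_exp_gt0.
Qed.

Lemma wsum_cvg : cvgn (wsum N).
Proof.
apply: nondecreasing_is_cvgn; first exact: wsum_nd.
exists (0 + 2 ^- 0) => _ [M _ <-]; exact: wsum_le.
Qed.

Lemma wsum_lim_ge : 2 ^- 1 * (N 0%N / (1 + N 0%N)) <= limn (wsum N).
Proof.
have := nondecreasing_cvgn_le wsum_nd wsum_cvg 1%N.
by rewrite {1}/wsum big_ord_recr big_ord0 /= add0r.
Qed.

Lemma wsum_lim_le J (eta : R) : (forall j, (j < J)%N -> N j <= eta) -> 0 <= eta ->
  limn (wsum N) <= eta + 2 ^- J.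
Proof.
move=> h eta0; apply: limr_le; first exact: wsum_cvg.
by apply: nearW => M; exact: wsum_le.
Qed.

End Bounds.

(* |b_0 + b_1 + ...| <= sup_m 2^(m+1) |b_m|, which replaces Minkowski's inequality. *)
Lemma powR_sum_le (p : R) b (M : nat) : 0 < p -> (forall m, 0 <= b m) ->
  (\sum_(m < M) b m) `^ p <= \sum_(m < M) (2 ^+ m.+1 * b m) `^ p.
Proof.
move=> p0; elim: M b => [|M IH] b b0; first by rewrite !big_ord0 powR0 ?gt_eqF.
rewrite !big_ord_recl /= expr1.
have S0 : 0 <= \sum_(i < M) b (lift ord0 i) by apply: sumr_ge0.
apply: le_trans (powR_max (ltW p0) (b0 0%N) S0) _; rewrite -powRM// -powRM// lerD2l.
rewrite mulr_sumr; apply: le_trans (IH (fun m => 2 * b m.+1) _) _.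
  by move=> m; rewrite mulr_ge0.
by apply: ler_sum => i _; rewrite mulrA -exprSr.
Qed.

End WeightedSums.

(** * The metric space of functions and the perturbation series *)

Section FunctionSpace.
Variables (R : realType) (n : nat) (Omega : set (cvec R n)) (q : \bar R) (p : nat -> R).
Local Notation C := R[i].
Implicit Types (f g h : cvec R n -> C).
Hypotheses (oO : copen Omega) (bO : cbounded Omega).
Hypotheses (p0_gt1 : 1 < p 0%N) (p_inc : forall j, p j < p j.+1).
Hypothesis p_cvg : (p j)%:E @[j --> \oo] --> q.

Lemma p_nd : {homo p : i j / (i <= j)%N >-> i <= j}.
Proof. by apply/nondecreasing_seqP => j; exact/ltW/p_inc. Qed.

Lemma p_gt1 j : 1 < p j.
Proof. exact: lt_le_trans p0_gt1 (p_nd (leq0n j)). Qed.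

Lemma p_gt0 j : 0 < p j.
Proof. exact: lt_trans (p_gt1 j). Qed.

Lemma p_ltq j : ((p j)%:E < q)%E.
Proof.
apply: (@lt_le_trans _ _ (p j.+1)%:E); first by rewrite lte_fin.
have <- : limn (fun j => (p j)%:E) = q by exact/cvg_lim.
apply: lime_ge; first by apply/cvg_ex; exists q.
by exists j.+1 => // k /= jk; rewrite lee_fin; exact: p_nd.
Qed.

Lemma p_cofinal (r : R) : (r%:E < q)%E -> exists j, r <= p j.
Proof.
move=> rq; apply: contrapT => h.
have : (q <= r%:E)%E.
  have <- : limn (fun j => (p j)%:E) = q by exact/cvg_lim.
  apply: lime_le; first by apply/cvg_ex; exists q.
  by apply: nearW => j; rewrite lee_fin leNgt; apply/negP => /ltW rp; apply: h; exists j.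
by rewrite leNgt rq.
Qed.

Local Notation X := (OLlt q Omega).

Lemma X_hol g : X g -> holomorphic_on Omega g.
Proof. by move=> /(_ (p 0%N) (ltW (p_gt1 0)) (p_ltq 0))[]. Qed.

Lemma X_cont g : X g -> cont_on Omega g.
Proof. by move=> /X_hol hg z Oz; exact: holomorphic_continuous hg Oz. Qed.

Lemma X_fin g j : X g -> (Lpint Omega (p j) g < +oo)%E.
Proof. by move=> /(_ (p j) (ltW (p_gt1 j)) (p_ltq j))[]. Qed.

(** The exponents p j are cofinal below q, and on a bounded set a larger exponent controls the
    smaller ones. *)
Lemma X_intro g : holomorphic_on Omega g ->
  (forall j, (Lpint Omega (p j) g < +oo)%E) -> X g.
Proof.
move=> hg fg r r1 rq; split=> //; have [j rj] := p_cofinal rq.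
have r0 : 0 < r by lra.
by apply: (Lpint_exponent r0 rj) => // z Oz; exact: holomorphic_continuous hg Oz.
Qed.

Lemma X_addZ f g (k : C) : X f -> X g -> X (fun z => f z + k * g z).
Proof.
move=> Xf Xg; have hk : holomorphic_on Omega (fun z => k * g z).
  by apply: holomorphicZ; exact: X_hol.
have hfg := holomorphicD (X_hol Xf) hk.
apply: X_intro => // j.
apply: (Lpint_add_fin (g := f) (h := fun z => k * g z) (p_gt0 j) oO).
- by move=> z Oz; exact: holomorphic_continuous hfg Oz.
- exact: X_cont.
- by move=> z Oz; exact: holomorphic_continuous hk Oz.
- by move=> z _; exact: cmodD.
- exact: X_fin.
- rewrite LpintZ//; [|exact: p_gt0|exact: X_cont].
  by apply: lte_mul_pinfty => //; [rewrite lee_fin powR_ge0|exact: X_fin].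
Qed.

Lemma X_sub f g : X f -> X g -> X (fun z => f z - g z)%R.
Proof.
move=> Xf Xg; have := X_addZ (-1) Xf Xg.
by congr OLlt; apply/funext => z; rewrite mulN1r.
Qed.

Lemma Lpint_distC (r : R) f g :
  Lpint Omega r (fun z => f z - g z)%R = Lpint Omega r (fun z => g z - f z)%R.
Proof. by congr volint; apply/funext => z; rewrite cmodBC. Qed.

Local Notation Nrm f g := (fun j => Lpnorm Omega (p j) (fun z => f z - g z)%R).

Lemma dmetricE f g : dmetric Omega p f g = limn (wsum (Nrm f g)).
Proof. by []. Qed.

Lemma Nrm_ge0 f g j : 0 <= Nrm f g j.
Proof. exact: powR_ge0. Qed.

Lemma Lpnorm_le r f (eta : R) : 0 < r -> 0 <= eta -> (Lpint Omega r f <= (eta `^ r)%:E)%E ->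
  Lpnorm Omega r f <= eta.
Proof.
move=> r0 eta0 h; rewrite /Lpnorm.
have -> : eta = (eta `^ r) `^ r^-1 by rewrite -powRrM divff ?gt_eqF// powRr1.
have fin : Lpint Omega r f \is a fin_num.
  by rewrite ge0_fin_numE ?Lpint_ge0// (le_lt_trans h)// ltry.
apply: ge0_ler_powR; rewrite ?nnegrE ?invr_ge0 ?powR_ge0 ?(ltW r0)//.
- by rewrite fine_ge0// Lpint_ge0.
- by rewrite -lee_fin fineK.
Qed.

Lemma dmetric_small f g (J : nat) (eta : R) : 0 <= eta ->
  (forall j, (j < J)%N -> (Lpint Omega (p j) (fun z => f z - g z)%R <= (eta `^ p j)%:E)%E) ->
  dmetric Omega p f g <= eta + 2 ^- J.
Proof.
move=> eta0 h; rewrite dmetricE; apply: wsum_lim_le => //.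
  by move=> j; exact: Nrm_ge0.
by move=> j jJ; apply: Lpnorm_le => //; [exact: p_gt0|exact: h].
Qed.

(** The first term of the series suffices: the distance is at least half of N / (1 + N), which is
    increasing in the L^(p_0) norm N. *)
Lemma dmetric_open (r : R) : 0 < r -> exists2 d : R, 0 < d &
  forall f g, X f -> X g -> dmetric Omega p f g < d ->
    (Lpint Omega (p 0%N) (fun z => g z - f z)%R <= r%:E)%E.
Proof.
move=> r0; pose nu := r `^ (p 0%N)^-1.
have nu0 : 0 < nu by exact: powR_gt0.
exists (2 ^- 1 * (nu / (1 + nu))).
  by rewrite mulr_gt0 ?half_exp_gt0// divr_gt0// addr_gt0.
move=> f g Xf Xg; rewrite dmetricE Lpint_distC.
set L := Lpint _ _ _; have L0 : (0 <= L)%E by exact: Lpint_ge0.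
(* Finiteness matters: [fine] sends +oo to 0, so a small [Lpnorm] alone bounds nothing. *)
have Lf : L \is a fin_num by rewrite ge0_fin_numE// X_fin//; exact: X_sub.
have := wsum_lim_ge (Nrm_ge0 f g); set N := Lpnorm _ _ _ => h1 h2.
have N0 : 0 <= N by exact: powR_ge0.
have : N < nu.
  rewrite ltNge; apply/negP => nuN.
  have : nu / (1 + nu) <= N / (1 + N).
    by rewrite ler_pdivrMr ?addr_gt0// mulrAC ler_pdivlMr; nra.
  have := le_lt_trans h1 h2; rewrite ltr_pM2l ?half_exp_gt0//; lra.
move=> Nnu; rewrite -(fineK Lf) lee_fin leNgt; apply/negP => rL.
have : nu <= N.
  apply: ge0_ler_powR; rewrite ?nnegrE ?invr_ge0 ?(ltW (p_gt0 0)) ?(ltW r0)//.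
  - by rewrite fine_ge0.
  - exact: ltW.
lra.
Qed.

Section Residual.
Variable U : nat -> set (cvec R n -> C).
Hypothesis U_open : forall k g, X g -> U k g -> exists2 r : R, 0 < r &
  forall h, X h -> (Lpint Omega (p 0%N) (fun z => h z - g z)%R <= r%:E)%E -> U k h.
Hypothesis U_dense : forall k g, X g -> exists F, X F /\
  forall t : R, 0 < t -> U k (fun z => g z + Complex t 0 * F z).
Variable J : nat.

(** An exhaustion of Omega with the margin that [holomorphic_bounded] asks for. *)
Definition Kset (m : nat) : set (cvec R n) := [set z | cball z m.+1%:R^-1 `<=` Omega].

(* [s] is a current function together with the L^(p_0) budget left for later changes; the factor
   [2 ^+ m.+1] is the weight of the m-th term in [powR_sum_le]. *)
Definition approx_step (m : nat) (s s' : (cvec R n -> C) * R) : Prop :=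
  [/\ X s'.1, 0 < s'.2 <= s.2,
    forall j, (j <= m + J)%N ->
      (((2 ^+ m.+1) `^ p j)%:E * Lpint Omega (p j) (fun z => s'.1 z - s.1 z)%R
         <= (2 ^- m.+1 * s.2)%:E)%E,
    forall z, Kset m z -> cmod (s'.1 z - s.1 z) <= 2 ^- m &
    forall h, X h -> (Lpint Omega (p 0%N) (fun z => h z - s'.1 z)%R <= (s'.2)%:E)%E -> U m h].

Lemma approx_step_ex m s : X s.1 -> 0 < s.2 -> exists s', approx_step m s s'.
Proof.
case: s => g tau /= Xg tau0; have [F [XF UF]] := U_dense m Xg.
have [B hB] := bO.
have [A [A0 hA]] : exists A : R, 0 <= A /\ forall z, Kset m z -> cmod (F z) <= A.
  apply: (@holomorphic_bounded R n Omega (Kset m) F B m.+1%:R^-1) => //.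
  - exact: X_hol.
  - by move=> z Kz; apply: hB; apply: Kz; apply: cball_center; rewrite invr_gt0.
pose c j := (2 ^+ m.+1) `^ p j * fine (Lpint Omega (p j) F).
have c0 j : 0 <= c j by rewrite mulr_ge0 ?powR_ge0// fine_ge0// Lpint_ge0.
(* K dominates A and every c j with j <= m + J, so a single t meets all the bounds; t <= 1 gives
   t^(p j) <= t. *)
pose K := \sum_(j < (m + J).+1) c j + A + 1.
have S0 : 0 <= \sum_(j < (m + J).+1) c j by apply: sumr_ge0 => j _; exact: c0.
have K0 : 0 < K by rewrite /K; lra.
pose t := Num.min 1 (Num.min (2 ^- m.+1 * tau / K) (2 ^- m / K)).
have t0 : 0 < t by rewrite !lt_min ltr01 !divr_gt0 ?mulr_gt0 ?half_exp_gt0.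
have t1 : t <= 1 by rewrite ge_min lexx.
have t2 : t * K <= 2 ^- m.+1 * tau by rewrite -ler_pdivlMr// !ge_min lexx orbT.
have t3 : t * K <= 2 ^- m by rewrite -ler_pdivlMr// !ge_min lexx !orbT.
pose g' z := g z + Complex t 0 * F z.
have Xg' : X g' by exact: X_addZ.
have [r r0 hr] := U_open Xg' (UF t t0).
exists (g', Num.min tau r); split => //=.
- by rewrite lt_min tau0 r0 ge_min lexx.
- move=> j jm.
  have -> : (fun z => g' z - g z) = (fun z => Complex t 0 * F z).
    by apply/funext => z; rewrite /g' addrAC subrr add0r.
  rewrite LpintZ//; [|exact: p_gt0|exact: X_cont].
  rewrite cmod_real ger0_norm ?(ltW t0)//.
  rewrite -(fineK (x := Lpint _ _ F)); last by rewrite ge0_fin_numE ?Lpint_ge0// X_fin.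
  rewrite -!EFinM lee_fin mulrCA -/(c j); apply: le_trans t2.
  apply: ler_pM => //; first exact: powR_ge0.
    by apply: ge1r_powR; [rewrite t0|exact/ltW/p_gt1].
  rewrite /K (bigD1 (Ordinal (_ : (j < (m + J).+1)%N)))//= -!addrA lerDl !addr_ge0//.
  by apply: sumr_ge0 => i _; exact: c0.
- move=> z /hA Fz; rewrite /g' addrAC subrr add0r cmodM cmod_real ger0_norm ?(ltW t0)//.
  by apply: le_trans t3; apply: ler_wpM2l; [exact: ltW|rewrite /K; lra].
- move=> h Xh hh; apply: hr => //; apply: le_trans hh _.
  by rewrite lee_fin ge_min lexx orbT.
Qed.

Section Sequence.
Variables (f : cvec R n -> C) (tau : R).
Hypotheses (Xf : X f) (tau_gt0 : 0 < tau).

Lemma approx_seq_ex : exists s : nat -> (cvec R n -> C) * R,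
  s 0%N = (f, tau) /\ forall m, approx_step m (s m) (s m.+1).
Proof.
have ex (ms : nat * ((cvec R n -> C) * R)) : exists s', X ms.2.1 -> 0 < ms.2.2 ->
    approx_step ms.1 ms.2 s'.
  have [[h1 h2]|h] := pselect (X ms.2.1 /\ 0 < ms.2.2).
    by have [s' hs'] := approx_step_ex ms.1 h1 h2; exists s'.
  by exists ms.2 => h1 h2; case: h.
have [F hF] := choice ex.
pose s := fix s m := if m is m'.+1 then F (m', s m') else (f, tau).
exists s; split => // m.
have inv k : X (s k).1 /\ 0 < (s k).2.
  elim: k => [//|k [h1 h2]].
  by have [? /andP[? _]] := hF (k, s k) h1 h2.
by have [h1 h2] := inv m; exact: (hF (m, s m)).
Qed.

Variable s : nat -> (cvec R n -> C) * R.
Hypotheses (s0 : s 0%N = (f, tau)) (hs : forall m, approx_step m (s m) (s m.+1)).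
Let g m := (s m).1.

Lemma gX m : X (g m).
Proof. by case: m => [|m]; [rewrite /g s0|case: (hs m)]. Qed.

Lemma tau_pos m : 0 < (s m).2.
Proof. by case: m => [|m]; [rewrite s0|case: (hs m) => _ /andP[]]. Qed.

Lemma tau_ni m k : (s (m + k)).2 <= (s m).2.
Proof.
elim: k => [|k IH]; first by rewrite addn0.
by rewrite addnS; case: (hs (m + k)) => _ /andP[_ h] _ _ _; exact: le_trans h IH.
Qed.

Lemma Kset_ball z : Omega z -> exists2 r : R, 0 < r & exists M, forall m, (M <= m)%N ->
  cball z r `<=` Kset m.
Proof.
move=> /oO[r r0 rO]; exists (r / 2); first by rewrite divr_gt0.
exists (Num.bound (r / 2)^-1) => m hm w wz y yw; apply: rO.
have hb : m.+1%:R^-1 <= r / 2.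
  rewrite -[X in _ <= X]invrK lef_pV2 ?posrE ?invr_gt0 ?divr_gt0//.
  apply: ltW; apply: lt_le_trans (archi_boundP _) _.
    by rewrite invr_ge0 divr_ge0// ltW.
  by rewrite ler_nat (leq_trans hm).
apply: (cball_sub (w := w) (s := m.+1%:R^-1)) yw.
by apply: le_trans (lerD (ltW wz) hb) _; rewrite -splitr.
Qed.

(** The step from m to m + 1 moves the value by at most 2^-m, so g k and g l are each within 2 *
    2^-M of g M. *)
Lemma g_dist M w : (forall m, (M <= m)%N -> Kset m w) ->
  forall k l, (M <= k)%N -> (M <= l)%N -> cmod (g k w - g l w) <= 4 * 2 ^- M.
Proof.
move=> Kw; have H k : cmod (g (M + k) w - g M w) <= 2 * (2 ^- M - 2 ^- (M + k)).
  elim: k => [|k IH]; first by rewrite addn0 !subrr mulr0 cmod0.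
  apply: le_trans (cmod_triang _ _ (g (M + k) w)) _.
  case: (hs (M + k)) => _ _ _ /(_ w (Kw _ (leq_addr _ _))) h _.
  rewrite addnS; rewrite /g in IH *; have := half_expS R (M + k); lra.
move=> k l Mk Ml; apply: le_trans (cmod_triang _ _ (g M w)) _.
have := H (k - M)%N; have := H (l - M)%N; rewrite !subnKC// (cmodBC (g l w)).
have := half_exp_gt0 R k; have := half_exp_gt0 R l; lra.
Qed.

Lemma limit_ex : exists G, holomorphic_on Omega G /\
  forall z, Omega z -> clim (fun k => g k z) (G z).
Proof.
have ex z : exists a : C, Omega z -> clim (fun k => g k z) a.
  have [Oz|nO] := pselect (Omega z); last by exists 0.
  have [r r0 [M hM]] := Kset_ball Oz.
  have [a ha] : exists a, clim (fun k => g k z) a; last by exists a.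
  apply: complex_cauchy => e e0; have e4 : 0 < e / 4 by lra.
  have [K hK] := half_exp_small e4.
  exists (maxn M K) => k l hk hl; apply: le_trans (g_dist _ hk hl) _.
    by move=> m hm; apply: (hM m); [exact: leq_trans (leq_maxl _ _) hm|exact: cball_center].
  have := hK (maxn M K) (leq_maxr _ _); lra.
have [G hG] := choice ex; exists G; split => //.
apply: (holomorphic_limit (g := g) oO); first by move=> k; apply: X_hol; exact: gX.
move=> z Oz; have [r r0 [M hM]] := Kset_ball Oz; exists r => // e e0.
have e4 : 0 < e / 4 by lra.
have [K hK] := half_exp_small e4.
exists (maxn M K) => k hk w wz.
have Kw m : (maxn M K <= m)%N -> Kset m w.
  by move=> hm; apply: (hM m) => //; exact: leq_trans (leq_maxl _ _) hm.
have Ow : Omega w by apply: (Kw _ (leqnn _)); apply: cball_center; rewrite invr_gt0.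
apply: (clim_dist_le (K := maxn M K) (hG w Ow)) => l hl.
apply: le_trans (g_dist Kw hk hl) _.
have := hK (maxn M K) (leq_maxr _ _); lra.
Qed.

Variable G : cvec R n -> C.
Hypothesis hG : holomorphic_on Omega G.
Hypothesis limG : forall z, Omega z -> clim (fun k => g k z) (G z).

(** G - g M is the limit of sums of later steps. [powR_sum_le] bounds its power by weighted powers
    of the steps, Fatou passes to the limit, and the shares 2^-(m+1) of the budget sum to at most 1.
    The restriction on j is the range of exponents controlled from step M on. *)
Lemma tail_bound M j : (j <= M + J)%N ->
  (Lpint Omega (p j) (fun z => G z - g M z)%R <= ((s M).2)%:E)%E.
Proof.
move=> jM; set P := p j; have P0 : 0 < P by exact: p_gt0.
have powR0P : forall x : R, 0 <= x `^ P by move=> x; exact: powR_ge0.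
pose d m z := g (M + m).+1 z - g (M + m) z.
have dX m : X (d m) by apply: X_sub; exact: gX.
pose kd m z := Complex (2 ^+ m.+1) 0 * d m z.
have kdc m : cont_on Omega (kd m).
  move=> z Oz; have := holomorphicZ (Complex (2 ^+ m.+1) 0) (X_hol (dX m)).
  by move=> /holomorphic_continuous; exact.
have cG : cont_on Omega (fun z => G z - g M z)%R.
  have h := holomorphicB hG (X_hol (gX M)).
  by move=> z Oz; exact: holomorphic_continuous h Oz.
rewrite Lpint_ind; apply: (volint_sum_le (F := fun m => ind Omega (kd m) (fun x => x `^ P)%R)).
- by move=> m z; exact: ind_ge0.
- by move=> m; apply: ind_lsc => //; exact: left_lsc_powR.
- by move=> z; exact: ind_ge0.
- by apply: ind_lsc => //; exact: left_lsc_powR.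
- move=> z; have Sge N : (0 <= \sum_(k < N) ind Omega (kd k) (fun x => x `^ P)%R z)%E.
    by apply: sume_ge0 => k _; exact: ind_ge0.
  have [Oz|nO] := pselect (Omega z); last first.
    rewrite ind_notin//; apply: le_limn_einf => a a0; exists 0%N => k _.
    exact: le_trans (ltW a0) (Sge k).
  rewrite ind_in//; apply: le_limn_einf => a; rewrite lte_fin => ha.
  have [e e0 he] := left_lsc_powR P0 (cmod_ge0 _) ha.
  have [K hK] := limG Oz (divr_gt0 e0 (ltr0n _ 2)).
  exists K => N KN.
  have -> : (\sum_(k < N) ind Omega (kd k) (fun x => x `^ P)%R z)%E =
      (\sum_(k < N) (2 ^+ k.+1 * cmod (d k z)) `^ P)%R%:E.
    rewrite -sumEFin; apply: eq_bigr => k _; rewrite ind_in// /kd cmodM cmod_real.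
    by rewrite ger0_norm// exprn_ge0.
  rewrite lee_fin; apply: le_trans (_ : cmod (g (M + N) z - g M z) `^ P <= _).
    apply: ltW; apply: he; first exact: cmod_ge0.
    have := hK (M + N)%N (leq_trans KN (leq_addl _ _)) => hk.
    have := cmod_triang (G z) (g M z) (g (M + N) z); rewrite (cmodBC (G z) (g (M + N)%N z)); lra.
  have -> : g (M + N) z - g M z = \sum_(k < N) d k z.
    elim: N {KN} => [|N IH]; first by rewrite addn0 subrr big_ord0.
    by rewrite big_ord_recr /= -IH /d addnS; ring.
  have := powR_sum_le N P0 (fun m => cmod_ge0 (d m z)); apply: le_trans.
  apply: ge0_ler_powR; rewrite ?nnegrE ?cmod_ge0 ?(ltW P0)//; last exact: cmod_sum.
  by apply: sumr_ge0 => k _; exact: cmod_ge0.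
move=> N.
(* Steps are counted from M here and from 0 in [approx_step]: there the weight 2^(M+m+1) is larger
   and the allowance smaller. *)
have term m : (volint (ind Omega (kd m) (fun x => x `^ P)%R) <= (2 ^- m.+1 * (s M).2)%:E)%E.
  rewrite -[X in (X <= _)%E]/(Lpint Omega P (kd m)) LpintZ//; last exact: X_cont.
  rewrite cmod_real ger0_norm ?exprn_ge0//.
  have [_ _ h _ _] := hs (M + m).
  have := h j (leq_trans jM _); rewrite leq_add2r leq_addr => /(_ isT).
  rewrite -/P => {}h; apply: le_trans (le_trans h _).
    apply: lee_wpmul2r; first exact: Lpint_ge0.
    rewrite lee_fin; apply: ge0_ler_powR; rewrite ?nnegrE ?exprn_ge0 ?(ltW P0)//.
    by rewrite ler_weXn2l ?ler1n// ltnS leq_addl.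
  rewrite lee_fin; apply: ler_pM; rewrite ?(ltW (half_exp_gt0 _ _)) ?(ltW (tau_pos _))//.
    by rewrite lef_pV2 ?posrE ?exprn_gt0// ler_weXn2l ?ler1n// ltnS leq_addl.
  exact: tau_ni.
apply: (@le_trans _ _ (\sum_(k < N) (2 ^- k.+1 * (s M).2)%:E)%E).
  by apply: lee_sum => m _; exact: term.
rewrite sumEFin lee_fin -mulr_suml ler_piMl ?(ltW (tau_pos _))//.
suff -> : \sum_(m < N) (2 : R) ^- m.+1 = 1 - 2 ^- N.
  by rewrite gerBl ltW// half_exp_gt0.
elim: N => [|N IH]; first by rewrite big_ord0 expr0 invr1 subrr.
by rewrite big_ord_recr /= IH; have := half_expS R N; lra.
Qed.

Lemma limit_X : X G.
Proof.
apply: X_intro => // j.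
apply: (Lpint_add_fin (g := fun z => G z - g j z) (h := g j) (p_gt0 j) oO).
- by move=> z Oz; exact: holomorphic_continuous hG Oz.
- have h := holomorphicB hG (X_hol (gX j)).
  by move=> z Oz; exact: holomorphic_continuous h Oz.
- by apply: X_cont; exact: gX.
- by move=> z _; rewrite -{1}[G z](subrK (g j z)); exact: cmodD.
- by apply: le_lt_trans (ltry (s j).2); apply: tail_bound; exact: leq_addr.
- by apply: X_fin; exact: gX.
Qed.

(** The tail after step m fits the budget fixed at that step, within which [U m] persists. *)
Lemma limit_U m : U m G.
Proof.
have [_ _ _ _] := hs m; apply; first exact: limit_X.
exact: tail_bound.
Qed.

End Sequence.

End Residual.

Theorem residual_dense (U : nat -> set (cvec R n -> C)) :
  (forall k g, X g -> U k g -> exists2 r : R, 0 < r &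
    forall h, X h -> (Lpint Omega (p 0%N) (fun z => h z - g z)%R <= r%:E)%E -> U k h) ->
  (forall k g, X g -> exists F, X F /\
    forall t : R, 0 < t -> U k (fun z => g z + Complex t 0 * F z)) ->
  forall f, X f -> forall e : R, 0 < e ->
  exists g, [/\ X g, forall k, U k g & dmetric Omega p f g < e].
Proof.
move=> Uo Ud f Xf e e0; have e4 : 0 < e / 4 by lra.
have [J hJ] := half_exp_small e4.
pose eta := Num.min 1 (e / 4).
have eta0 : 0 < eta by rewrite lt_min ltr01.
have eta1 : eta <= 1 by rewrite ge_min lexx.
have etae : eta <= e / 4 by rewrite ge_min lexx orbT.
(* As eta <= 1, eta^(p J) <= eta^(p j) for j <= J: one budget makes the first J norms at most
   eta. *)
pose tau := eta `^ p J; have tau0 : 0 < tau by exact: powR_gt0.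
have [s [s0 hs]] := approx_seq_ex Uo Ud J Xf tau0.
have [G [hG limG]] := limit_ex Xf s0 hs.
exists G; split.
- exact: (limit_X Xf tau0 s0 hs).
- exact: (limit_U Xf tau0 s0 hs).
apply: le_lt_trans (_ : eta + 2 ^- J < e); last by have := hJ J (leqnn J); lra.
apply: dmetric_small; first exact: ltW.
move=> j jJ; rewrite Lpint_distC.
have := tail_bound Xf tau0 s0 hs hG limG (M := 0) (j := j) (ltnW jJ).
rewrite s0 /= => h; apply: le_trans h _; rewrite lee_fin /tau.
by apply: ger_powR; [rewrite eta0|exact/p_nd/ltnW].
Qed.

End FunctionSpace.

(** * The open dense conditions *)

Section RationalVectors.
Variables (R : realType) (n : nat).

(** Finite functions, so that the type is countable and indices can be enumerated by [unpickle]. *)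
Definition ratvec := {ffun 'I_n -> rat * rat}.

Definition qvec (v : ratvec) : cvec R n := fun i => Complex (ratr (v i).1) (ratr (v i).2).

Lemma qvec_dense (z : cvec R n) (e : R) : 0 < e -> exists v, cball z e (qvec v).
Proof.
move=> e0; have n1 : 0 < 2 * n%:R + 1 :> R by have := ler0n R n; lra.
set d := e / (2 * n%:R + 1); have d0 : 0 < d by rewrite divr_gt0.
have ex (x : R) : exists a : rat, `|ratr a - x| <= d.
  have [a] := @rat_in_itvoo R (x - d) (x + d) ltac:(lra).
  by rewrite in_itv /= => h; exists a; rewrite ler_norml; lra.
have [c hc] := choice ex.
exists [ffun i => (c (complex.Re (z i)), c (complex.Im (z i)))].
have hb i : cmod (qvec [ffun i => (c (complex.Re (z i)), c (complex.Im (z i)))] i - z i) <= d + d.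
  rewrite /qvec ffunE /=; apply: le_trans (cmod_le_ReIm _) _.
  by have := hc (complex.Re (z i)); have := hc (complex.Im (z i)); case: (z i) => x y /=; lra.
rewrite /cball/=; apply: le_lt_trans (cnorm_le_sum _) _.
apply: le_lt_trans (ler_sum _ (fun i _ => hb i)) _.
rewrite sumr_const card_ord -[X in X < _]mulr_natr.
have -> : (d + d) * n%:R = 2 * n%:R * e / (2 * n%:R + 1) by rewrite /d; ring.
by rewrite ltr_pdivrMr//; lra.
Qed.

Lemma rational_ball (w : cvec R n) (s delta : R) : 0 <= s -> s < delta ->
  exists (v : ratvec) (r : rat) (d : R), [/\ s < d,
    cball w d `<=` cball (qvec v) (ratr r) & cball (qvec v) (ratr r) `<=` cball w delta].
Proof.
move=> s0 sd; pose eta := (delta - s) / 4; have eta0 : 0 < eta by rewrite /eta; lra.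
have [v hv] := qvec_dense w eta0.
have [r] := @rat_in_itvoo R (delta - 2 * eta) (delta - eta) ltac:(lra).
rewrite in_itv /= => /andP[r1 r2].
exists v, r, (delta - 3 * eta); split.
- by rewrite /eta; lra.
- by apply: cball_sub; rewrite cnormBC; move: hv; rewrite /cball/=; lra.
- by apply: cball_sub; move: hv; rewrite /cball/=; lra.
Qed.

End RationalVectors.

Section Conditions.
Variables (R : realType) (n : nat) (Omega : set (cvec R n)).
Local Notation C := R[i].
Implicit Types (g h : cvec R n -> C) (a x zeta : cvec R n).
Hypothesis oO : copen Omega.

(** The ball about zeta contains x so that total unboundedness at zeta applies to the component of x
    there, which lies in the component taken in the larger rational ball. *)
Definition unbounded_cond a (r : R) x (M : R) g : Prop :=
  (exists zeta (d : R), [/\ cboundary Omega zeta, 0 < d, cball zeta d `<=` cball a r &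
     (cball zeta d `&` Omega) x]) ->
  exists2 z, ccomponent (cball a r `&` Omega) x z & M < cmod (g z).

Definition nonintegrable_cond (q : R) a (r : R) (M : R) g : Prop :=
  (exists zeta (d : R), [/\ cboundary Omega zeta, 0 < d & cball zeta d `<=` cball a r]) ->
  (M%:E < Lpint (cball a r `&` Omega) q g)%E.

(** If |h| <= M on the component while |g z| > M, then |h - g| is bounded below on a whole ball
    about z inside the component, so its p-integral cannot be small. *)
Lemma unbounded_cond_open (p : R) a r x M g : 0 < p -> holomorphic_on Omega g ->
  unbounded_cond a r x M g -> exists2 e : R, 0 < e &
  forall h, holomorphic_on Omega h ->
    (Lpint Omega p (fun z => h z - g z)%R <= e%:E)%E -> unbounded_cond a r x M h.
Proof.
move=> p0 hg cg.
set prem := exists zeta (d : R), [/\ cboundary Omega zeta, 0 < d, cball zeta d `<=` cball a r &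
     (cball zeta d `&` Omega) x].
have [pr|npr] := pselect prem; last by exists 1 => // h _ _ pr; case: npr.
have [z Ez Mz] := cg pr; have oB := copenI (copen_cball (z := a) (r := r)) oO.
have [rho rho0 hrho] := oB z (ccomponent_sub Ez).
have Erho := ccomponent_cball rho0 Ez hrho.
have Oz : Omega z by have [] := ccomponent_sub Ez.
(* On the small ball |g| >= M + 2 eta, so |h| <= M forces |h - g| >= eta. *)
pose eta := (cmod (g z) - M) / 3; have eta0 : 0 < eta by rewrite /eta; lra.
have [d d0 hd] := holomorphic_continuous hg Oz eta0.
pose s := Num.min rho d; have s0 : 0 < s by rewrite lt_min rho0.
have sr w : cball z s w -> cball z rho w by rewrite /cball/= lt_min => /andP[].
have sd w : cball z s w -> cball z d w by rewrite /cball/= lt_min => /andP[].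
have n1 : 0 < 2 * n%:R + 1 :> R by have := ler0n R n; lra.
set V := eta `^ p * ((2 * (s / (2 * n%:R + 1))) ^+ 2) ^+ n.
have V0 : 0 < V by rewrite mulr_gt0 ?powR_gt0// !exprn_gt0// mulr_gt0// divr_gt0.
exists (V / 2); first by rewrite divr_gt0.
move=> h hh hle _; apply: contrapT => hno.
have hM w : ccomponent (cball a r `&` Omega) x w -> cmod (h w) <= M.
  by move=> Ew; rewrite leNgt; apply/negP => hw; apply: hno; exists w.
have hB := holomorphicB hh hg.
have : (V%:E <= Lpint Omega p (fun z => h z - g z)%R)%E.
  apply: (@Lpint_lb R n Omega p _ z s eta) => //; first exact: ltW.
  - by move=> w Ow; exact: holomorphic_continuous hB Ow.
  - by move=> w /sr /hrho[].
  move=> w wz; have := hM w (Erho _ (sr _ wz)); have := hd w (sd _ wz).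
  have := cmod_lb (g w) (h w - g w); have := cmod_lb (g z) (g w - g z).
  rewrite [g z + _]addrC [g w + (h w - _)]addrC !subrK /eta; lra.
move=> /le_trans/(_ hle); rewrite lee_fin; lra.
Qed.

Lemma unbounded_cond_perturb a r x M g :
  unbounded_cond a r x M g \/
  exists2 zeta, cboundary Omega zeta & forall f,
    (forall K : R, exists2 d : R, 0 < d &
        forall z, Omega z -> cball zeta d z -> K < cmod (f z)) ->
    forall t : R, 0 < t -> unbounded_cond a r x M (fun z => g z + Complex t 0 * f z).
Proof.
have [|ng] := pselect (unbounded_cond a r x M g); first by left.
right.
have [[zeta [d [bz d0 zr [xz Ox]]]] nE] : (exists zeta (d : R),
    [/\ cboundary Omega zeta, 0 < d, cball zeta d `<=` cball a r &
     (cball zeta d `&` Omega) x]) /\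
    ~ exists2 z, ccomponent (cball a r `&` Omega) x z & M < cmod (g z).
  by apply: contrapT => h; apply: ng => pr; apply: contrapT => h2; exact: h.
(* zeta itself may be out of reach of the component of x; zeta' is approached from inside it. *)
have [zeta' [bz' near]] := component_boundary oO (@cconvex_cball _ _ a r) (zr _ xz) Ox
  (zr _ (cball_center zeta d0)) (cboundary_notin oO bz).
exists zeta' => // f hf t t0 _.
(* |g| <= M on the component, so |t f| > 2 |M| + 1 leaves |g + t f| > M. *)
have [e e0 he] := hf ((2 * `|M| + 1) / t).
have [z Ez ze] := near e e0; exists z => //.
have [_ Oz] := ccomponent_sub Ez.
have gz : cmod (g z) <= M by rewrite leNgt; apply/negP => hz; apply: nE; exists z.
have := he z Oz ze; rewrite ltr_pdivrMr// => fz.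
have := cmod_lb (Complex t 0 * f z) (g z).
rewrite [Complex t 0 * f z + _]addrC cmodM cmod_real (ger0_norm (ltW t0)).
have := ler_norm M; rewrite mulrC in fz; lra.
Qed.

Section Nonintegrable.
Variables (p q : R).
Hypotheses (p0 : 0 < p) (q0 : 0 < q).

Lemma powR_nnle (r x y : R) : 0 < r -> 0 <= x -> x <= y -> x `^ r <= y `^ r.
Proof. by move=> r0 x0 xy; apply: ge0_ler_powR; rewrite ?nnegrE ?(ltW r0)// (le_trans x0). Qed.

(** Where c <= eta, subtracting eta absorbs c; where c > eta, the truncation is at most N and (c /
    eta)^p >= 1. *)
Lemma trunc_powR_le (N eta a b c : R) : 0 < N -> 0 < eta -> 0 <= b -> 0 <= c ->
  a <= b + c ->
  trunc N eta a `^ q <= 1 * b `^ q + (N `^ q / eta `^ p) * c `^ p.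
Proof.
move=> N0 eta0 b0 c0 abc; rewrite mul1r; have [ce|ec] := leP c eta.
  apply: ler_wpDr; first by rewrite mulr_ge0 ?powR_ge0// divr_ge0 ?powR_ge0.
  apply: powR_nnle => //; first exact: trunc_ge0.
  rewrite ge_max b0 andbT; have : Num.min a N <= a by rewrite ge_min lexx.
  lra.
apply: ler_wpDl; first exact: powR_ge0.
apply: le_trans (_ : N `^ q <= _).
  apply: powR_nnle => //; first exact: trunc_ge0.
  rewrite ge_max (ltW N0) andbT; have : Num.min a N <= N by rewrite ge_min lexx orbT.
  lra.
rewrite mulrAC -mulrA ler_peMr ?powR_ge0// ler_pdivlMr ?powR_gt0// mul1r.
by apply: powR_nnle => //; exact: ltW.
Qed.

(** Fatou in the role of monotone convergence: truncated integrals all at most M would bound the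
    full one by M. *)
Lemma Lpint_trunc D g (M : R) : copen D -> cont_on D g -> (M%:E < Lpint D q g)%E ->
  exists i : nat, (M%:E <
    volint (ind D g (fun y => trunc i.+1%:R i.+1%:R^-1 y `^ q)%R))%E.
Proof.
move=> oD cg; apply: contraPP => h; apply/negP; rewrite -leNgt Lpint_ind.
have powq : forall x : R, 0 <= x `^ q by move=> x; exact: powR_ge0.
apply: le_trans (volint_fatou
  (Fk := fun i => ind D g (fun y => trunc i.+1%:R i.+1%:R^-1 y `^ q)%R) _ _ _ _ _) _.
- exact: ind_ge0.
- by apply: ind_lsc => //; exact: left_lsc_powR.
- by move=> k; apply: ind_ge0.
- by move=> k; apply: ind_lsc => //; exact: left_lsc_trunc.
- move=> z; have [Dz|nDz] := pselect (D z); last first.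
    rewrite ind_notin//; apply: le_limn_einf => a a0; exists 0%N => k _.
    by apply: le_trans (ltW a0) _; exact: ind_ge0.
  rewrite ind_in//; apply: le_limn_einf => a; rewrite lte_fin => ha.
  have [d d0 hd] := left_lsc_powR q0 (cmod_ge0 _) ha.
  exists (maxn (Num.bound d^-1) (Num.bound (cmod (g z)))) => k.
  rewrite geq_max => /andP[k1 k2]; rewrite ind_in// lee_fin; apply/ltW/hd.
    exact: trunc_ge0.
  have h1 : k.+1%:R^-1 < d.
    rewrite -[X in _ < X]invrK ltf_pV2 ?posrE ?invr_gt0//.
    apply: lt_le_trans (archi_boundP _) _; first by rewrite invr_ge0 ltW.
    by rewrite ler_nat leqW.
  have h2 : cmod (g z) < k.+1%:R.
    apply: lt_le_trans (archi_boundP (cmod_ge0 _)) _.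
    by rewrite ler_nat leqW.
  rewrite /trunc lt_max min_l ?(ltW h2)//; apply/orP; left.
  by rewrite ltrD2l ltrN2.
apply: limn_einf_le => N; exists N => //.
by rewrite leNgt; apply/negP => hN; apply: h; exists N.
Qed.

Lemma nonintegrable_cond_open a r M g : holomorphic_on Omega g ->
  nonintegrable_cond q a r M g -> exists2 e : R, 0 < e &
  forall h, holomorphic_on Omega h ->
    (Lpint Omega p (fun z => h z - g z)%R <= e%:E)%E -> nonintegrable_cond q a r M h.
Proof.
move=> hg cg.
set prem := exists zeta (d : R), [/\ cboundary Omega zeta, 0 < d & cball zeta d `<=` cball a r].
have [pr|npr] := pselect prem; last by exists 1 => // h _ _ pr; case: npr.
set D := cball a r `&` Omega.
have oD : copen D by apply: copenI => //; exact: copen_cball.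
have DO : D `<=` Omega by move=> z [].
have hc f : holomorphic_on Omega f -> cont_on D f.
  by move=> hf z /DO Oz; exact: holomorphic_continuous hf Oz.
have [i hi] := Lpint_trunc oD (hc _ hg) (cg pr).
set W := volint _ in hi.
(* A real w makes the gap w - M usable without asking whether W is finite. *)
have [w Mw wW] : exists2 w : R, M < w & (w%:E <= W)%E.
  case: W hi => [x| |] //; first by rewrite lte_fin => h; exists x.
  by move=> _; exists (M + 1); [lra|rewrite leey].
set N : R := i.+1%:R in W hi wW *; set eta : R := i.+1%:R^-1 in W hi wW *.
pose K := N `^ q / eta `^ p.
have eta0 : 0 < eta by rewrite invr_gt0.
have K0 : 0 < K by rewrite divr_gt0// powR_gt0.
(* With this radius, a q-integral of h at most M would give W <= M + (w - M) / 2 < w. *)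
exists ((w - M) / 2 / K); first by rewrite divr_gt0// divr_gt0// subr_gt0.
move=> h hh hle _; rewrite ltNge; apply/negP => hM.
have hB := holomorphicB hh hg.
have le1 : (W <= 1%:E * Lpint D q h + K%:E * Lpint D p (fun z => h z - g z)%R)%E.
  rewrite !Lpint_ind; apply: volint_ind_le2 => //.
  - exact: hc.
  - exact: hc.
  - exact: hc.
  - by move=> x; exact: powR_ge0.
  - by move=> x; exact: powR_ge0.
  - by move=> x; exact: powR_ge0.
  - exact: left_lsc_trunc.
  - exact: left_lsc_powR.
  - exact: left_lsc_powR.
  - exact: ltW.
  move=> z Dz; apply: trunc_powR_le => //; rewrite ?cmod_ge0//.
  have {1}-> : g z = h z - (h z - g z) by ring.
  exact: cmodB.
have le2 : (Lpint D p (fun z => h z - g z)%R <= ((w - M) / 2 / K)%:E)%E.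
  apply: le_trans (Lpint_sub p0 oD oO DO _) hle.
  by move=> z Oz; exact: holomorphic_continuous hB Oz.
have : (w%:E <= M%:E + (K * ((w - M) / 2 / K))%:E)%E.
  apply: le_trans wW (le_trans le1 _); rewrite mul1e; apply: leeD => //.
  by rewrite [leRHS]EFinM; apply: lee_wpmul2l => //; rewrite lee_fin ltW.
by rewrite mulrC divfK ?gt_eqF// -EFinD lee_fin; lra.
Qed.

(** t f is the difference of g + t f and g: if both had finite q-integral on the ball, f would be
    q-integrable near zeta. *)
Lemma nonintegrable_cond_perturb a r M g : holomorphic_on Omega g ->
  nonintegrable_cond q a r M g \/
  exists2 zeta, cboundary Omega zeta & forall f, holomorphic_on Omega f ->
    (forall d : R, 0 < d -> ~ (Lpint (cball zeta d `&` Omega) q f < +oo)%E) ->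
    forall t : R, 0 < t -> nonintegrable_cond q a r M (fun z => g z + Complex t 0 * f z).
Proof.
move=> hg; have [|ng] := pselect (nonintegrable_cond q a r M g); first by left.
right; set D := cball a r `&` Omega.
have oD : copen D by apply: copenI => //; exact: copen_cball.
have DO : D `<=` Omega by move=> z [].
have hc f : holomorphic_on Omega f -> cont_on D f.
  by move=> hf z /DO Oz; exact: holomorphic_continuous hf Oz.
have [[zeta [d [bz d0 zr]]] gM] : (exists zeta (d : R),
    [/\ cboundary Omega zeta, 0 < d & cball zeta d `<=` cball a r]) /\
    (Lpint D q g <= M%:E)%E.
  by apply: contrapT => h; apply: ng => pr; rewrite ltNge; apply/negP => h2; exact: h.
exists zeta => // f hf nf t t0 _; rewrite ltNge; apply/negP => hM.
have htf := holomorphicZ (Complex t 0) hf.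
have hs := holomorphicD hg htf.
have tf : (Lpint D q (fun z => Complex t 0 * f z)%R < +oo)%E.
  apply: (Lpint_add_fin (g := fun z => g z + Complex t 0 * f z) (h := g) q0 oD).
  - exact: hc.
  - exact: hc.
  - exact: hc.
  - move=> z _; have {1}-> : Complex t 0 * f z = (g z + Complex t 0 * f z) - g z by ring.
    exact: cmodB.
  - exact: le_lt_trans hM (ltry _).
  - exact: le_lt_trans gM (ltry _).
have ff : (Lpint D q f < +oo)%E.
  have -> : f = (fun z => Complex t^-1 0 * (Complex t 0 * f z)).
    apply/funext => z; rewrite mulrA.
    have -> : Complex t^-1 0 * Complex t 0 = 1 :> C.
      apply/eqP; rewrite eq_complex /= !mulr0 !mul0r subr0 addr0 mulVf.
        by rewrite !eqxx.
      by rewrite gt_eqF.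
    by rewrite mul1r.
  rewrite LpintZ//; last exact: hc.
  by apply: lte_mul_pinfty => //; rewrite lee_fin powR_ge0.
apply: (nf d d0); apply: le_lt_trans ff; apply: Lpint_sub => //.
- by apply: copenI => //; exact: copen_cball.
- by move=> z [/zr].
- exact: hc.
Qed.

End Nonintegrable.

End Conditions.

(** * The countable family of conditions and the generic set *)

Section TheGenericSet.
Variables (R : realType) (n : nat) (Omega : set (cvec R n)).
Implicit Type q : \bar R.
Implicit Types (g h : cvec R n -> R[i]).
Hypothesis oO : copen Omega.

Definition cond_index : Type := ((ratvec n * rat) * (ratvec n * nat)) * bool.

Definition cond q (i : cond_index) (g : cvec R n -> R[i]) : Prop :=
  let: (((v, r), (x, M)), b) := i in
  if b then unbounded_cond Omega (qvec R v) (ratr r) (qvec R x) M%:R g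
  else match q with
       | (r'%:E)%E => nonintegrable_cond Omega r' (qvec R v) (ratr r) M%:R g
       | _ => True
       end.

Definition Ucond q (k : nat) : set (cvec R n -> R[i]) :=
  [set g | if unpickle k is Some i then cond q i g else True].

Lemma UcondP q g : (forall k, Ucond q k g) <-> (forall i, cond q i g).
Proof.
split=> [h i|h k]; first by have := h (pickle i); rewrite /Ucond/= pickleK.
by rewrite /Ucond/=; case: unpickle.
Qed.

Lemma generic_cond q g : (1%:E < q)%E -> holomorphic_on Omega g ->
  totally_unbounded Omega g ->
  (forall zeta, cboundary Omega zeta -> forall eps : R, 0 < eps ->
     ~ OL q (cball zeta eps `&` Omega) g) ->
  forall i, cond q i g.
Proof.
move=> q1 hg ug ng [[[v r] [x M]] [|]] /=.
  move=> [zeta [d [bz d0 zr xz]]]; have [z [Ez Mz]] := ug zeta bz d d0 _ xz M%:R.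
  by exists z => //; apply: ccomponent_mono Ez; exact: setSI.
case: q q1 ng => [r'| |] //; rewrite lte_fin => r1 ng [zeta [d [bz d0 zr]]].
rewrite ltNge; apply/negP => h; apply: (ng zeta bz d d0); split.
  by apply: holomorphic_sub hg => z [].
have r0 : 0 < r' by lra.
apply: le_lt_trans (ltry M%:R); apply: le_trans h; apply: Lpint_sub => //.
- by apply: copenI => //; exact: copen_cball.
- by apply: copenI => //; exact: copen_cball.
- exact: setSI.
- by move=> z [_ Oz]; exact: holomorphic_continuous hg Oz.
Qed.

(** A rational ball is squeezed between B(w, d), which makes the premise true, and B(w, delta); x is
    traded for a rational point of a small ball about x, hence of the same component. *)
Lemma cond_unbounded q g : (forall i, cond q i g) -> totally_unbounded Omega g.
Proof.
move=> hc w bw delta d0 x [xw Ox] M.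
have s0 := cnorm_ge0 (fun i => x i - w i).
have [v [r [d [sd wv vw]]]] := rational_ball w s0 xw.
have [rho rho0 hrho] := oO Ox.
pose e := Num.min rho (d - cnorm (fun i => x i - w i)).
have e0 : 0 < e by rewrite lt_min rho0 subr_gt0.
have [y hy] := qvec_dense x e0.
have xe : cball x e `<=` cball w d.
  by apply: cball_sub; rewrite addrC -lerBrDr ge_min lexx orbT.
have xO : cball x e `<=` Omega.
  by move=> z; rewrite /cball/= lt_min => /andP[+ _]; exact: hrho.
have := hc (((v, r), (y, Num.bound `|M|)), true); case.
  exists w, d; split => //; first exact: le_lt_trans s0 sd.
  by split; [exact: xe|exact: xO].
move=> z Ez Mz; exists z; split; last first.
  apply: le_lt_trans Mz; apply: le_trans (ler_norm _) _.
  exact/ltW/archi_boundP.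
have Ey : ccomponent (cball w delta `&` Omega) x (qvec R y).
  apply: (ccomponent_cball e0 (ccomponent_refl _)) hy; first by [].
  by move=> t ht; split; [apply: vw; apply: wv; exact: xe|exact: xO].
apply: (ccomponent_trans Ey); apply: ccomponent_mono Ez; exact: setSI.
Qed.

Lemma cond_nonintegrable q g : (1%:E < q)%E -> holomorphic_on Omega g -> (forall i, cond q i g) ->
  forall zeta, cboundary Omega zeta -> forall eps : R, 0 < eps ->
     ~ OL q (cball zeta eps `&` Omega) g.
Proof.
move=> q1 hg hc zeta bz eps e0 [_].
have ug := cond_unbounded hc; case: q q1 hc => [r| |] //.
- rewrite lte_fin => r1 hc fin; have r0 : 0 < r by lra.
  have [v [rr [d [d0 wv vw]]]] := rational_ball zeta (lexx 0) e0.
  set L := Lpint _ _ _ in fin.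
  have L0 : (0 <= L)%E by exact: Lpint_ge0.
  have Lf : L \is a fin_num by rewrite ge0_fin_numE.
  have hL : nonintegrable_cond Omega r (qvec R v) (ratr rr) (Num.bound (fine L))%:R g :=
    hc (((v, rr), ([ffun=> (0, 0)], Num.bound (fine L))), false).
  have := hL (ex_intro _ zeta (ex_intro _ d (And3 bz d0 wv))).
  apply/negP; rewrite -leNgt; apply: (@le_trans _ _ L).
    apply: Lpint_sub => //.
    + by apply: copenI => //; exact: copen_cball.
    + by apply: copenI => //; exact: copen_cball.
    + exact: setSI.
    + by move=> z [_ Oz]; exact: holomorphic_continuous hg Oz.
  rewrite -(fineK Lf) lee_fin; apply/ltW/archi_boundP; exact: fine_ge0.
- move=> _ _ [M hM]; have [[x [xz Ox]] _] := bz eps e0.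
  have [z [Ez]] := ug zeta bz eps e0 x (conj xz Ox) M.
  by rewrite ltNge hM//; exact: ccomponent_sub Ez.
Qed.

Lemma cond_open q (p : R) i g : 0 < p -> (1%:E < q)%E -> holomorphic_on Omega g ->
  cond q i g -> exists2 e : R, 0 < e &
  forall h, holomorphic_on Omega h ->
    (Lpint Omega p (fun z => h z - g z)%R <= e%:E)%E -> cond q i h.
Proof.
move=> p0 q1 hg; case: i => [[[v r] [x M]] [|]] /=; first exact: unbounded_cond_open.
case: q q1 => [r'| |]; [|by exists 1|by exists 1].
by rewrite lte_fin => r1; apply: nonintegrable_cond_open => //; lra.
Qed.

Lemma cond_perturb q i g : (1%:E < q)%E -> holomorphic_on Omega g ->
  cond q i g \/ exists2 zeta, cboundary Omega zeta & forall f,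
    holomorphic_on Omega f ->
    (forall eps : R, 0 < eps -> ~ OL q (cball zeta eps `&` Omega) f) ->
    (forall M : R, exists2 d : R, 0 < d &
       forall z, Omega z -> cball zeta d z -> M < cmod (f z)) ->
    forall t : R, 0 < t -> cond q i (fun z => g z + Complex t 0 * f z).
Proof.
move=> q1 hg; case: i => [[[v r] [x M]] [|]] /=.
  have [|[zeta bz h]] := unbounded_cond_perturb oO (qvec R v) (ratr r) (qvec R x) M%:R g.
    by left.
  by right; exists zeta => // f _ _; exact: h.
case: q q1 => [r'| |]; [|by left|by left].
rewrite lte_fin => r1; have r0 : 0 < r' by lra.
have [|[zeta bz h]] := nonintegrable_cond_perturb oO r0 (qvec R v) (ratr r) M%:R hg.
  by left.
right; exists zeta => // f hf nf _; apply: h => // d d0 fin; apply: (nf d d0).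
by split=> //; apply: holomorphic_sub hf => z [].
Qed.

End TheGenericSet.

Theorem theorem8 (R : realType) (n : nat) (Omega : set (cvec R n)) (q : \bar R)
  (p : nat -> R) :
  (0 < n)%N ->
  copen Omega -> cbounded Omega ->
  (1%:E < q)%E ->
  (forall zeta, cboundary Omega zeta ->
     exists f : cvec R n -> R[i],
       OLlt q Omega f /\
       (forall eps : R, 0 < eps -> ~ OL q (cball zeta eps `&` Omega) f) /\
       (forall M : R, exists2 d : R, 0 < d &
          forall z, Omega z -> cnorm (fun i => z i - zeta i) < d ->
            M < cmod (f z))) ->
  1 < p 0%N -> (forall j, p j < p j.+1) ->
  ((p j)%:E @[j --> \oo] --> q) ->
  let X := [set g | OLlt q Omega g] in
  let S := [set g | OLlt q Omega g /\ totally_unbounded Omega g /\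
             (forall zeta, cboundary Omega zeta -> forall eps : R, 0 < eps ->
                ~ OL q (cball zeta eps `&` Omega) g)] in
  dense_in (dmetric Omega p) X S /\ Gdelta_in (dmetric Omega p) X S.
Proof.
move=> _ oO bO q1 hf p0 pinc pcvg X S.
have pp0 : 0 < p 0%N by lra.
have hol g : X g -> holomorphic_on Omega g := X_hol p0 pinc pcvg (g := g).
have SE : S = X `&` \bigcap_k (Ucond Omega q k).
  apply/seteqP; split => g.
    move=> [Xg [ug ng]]; split=> // k _; apply/(UcondP _ _ _).2: k.
    by apply: generic_cond => //; exact: hol.
  move=> [Xg Ug]; have hc : forall i, cond Omega q i g.
    by apply/UcondP => k; exact: Ug.
  split=> //; split; first exact: cond_unbounded hc.
  by apply: cond_nonintegrable hc => //; exact: hol.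
have Uo k g : X g -> Ucond Omega q k g -> exists2 r : R, 0 < r &
    forall h, X h -> (Lpint Omega (p 0%N) (fun z => h z - g z)%R <= r%:E)%E ->
    Ucond Omega q k h.
  move=> Xg; rewrite /Ucond/=; case: unpickle => [i|]; last by exists 1.
  move=> /(cond_open oO pp0 q1 (hol _ Xg))[e e0 he].
  by exists e => // h /hol; exact: he.
split.
  have Ud k g : X g -> exists F, X F /\
      forall t : R, 0 < t -> Ucond Omega q k (fun z => g z + Complex t 0 * F z).
    move=> Xg.
    have triv : Ucond Omega q k g -> exists F, X F /\
        forall t : R, 0 < t -> Ucond Omega q k (fun z => g z + Complex t 0 * F z).
      (* The zero function, written so that [X_sub] gives membership: g already satisfies the
         condition and is left unchanged. *)
      move=> Ug; exists (fun z => g z - g z); split; first exact: (X_sub oO bO p0 pinc pcvg).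
      move=> t _; have -> : (fun z => g z + Complex t 0 * (g z - g z)) = g => //.
      by apply/funext => z; rewrite subrr mulr0 addr0.
    case E : (unpickle k) => [i|]; last by apply: triv; rewrite /Ucond/= E.
    have [gi|[zeta bz h]] := cond_perturb oO i q1 (hol _ Xg).
      by apply: triv; rewrite /Ucond/= E.
    have [f [Xf [nf bf]]] := hf zeta bz; exists f; split=> // t t0.
    by rewrite /Ucond/= E; apply: h => //; exact: hol.
  move=> f Xf e e0.
  have [g [Xg Ug dg]] := residual_dense oO bO p0 pinc pcvg Uo Ud Xf e0.
  by exists g; split=> //; rewrite SE; split.
exists (Ucond Omega q); split=> // k g Xg Ug.
have [r r0 hr] := Uo k g Xg Ug.
have [d d0 hd] := dmetric_open oO bO p0 pinc pcvg r0.
by exists d => // h Xh dh; apply: hr => //; exact: hd.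
Qed.
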